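(* The variety of reductions $Red(4)$ in $\mathfrak{sl}_4$ coincides with the space $Ab(4)$ of three-dimensional abelian subalgebras of $\mathfrak{sl}_4$. It is made of $14$ $PGL_4$-orbits, exactly three of which are closed: a three-dimensional projective space $\mathbb{P}^3$, its dual $\check{\mathbb{P}}^3$, and a variety $\mathbb{F}_4$ of complete flags in $\mathbb{C}^4$.
   Context: Everything is over $\mathbb{C}$. $G(3,\mathfrak{sl}_4)$ is the Grassmannian of $3$-dimensional linear subspaces of $\mathfrak{sl}_4$. $Ab(4)\subset G(3,\mathfrak{sl}_4)$ is the closed subset of $3$-dimensional abelian Lie subalgebras. $Red(4)\subset Ab(4)$ is the Zariski closure in $G(3,\mathfrak{sl}_4)$ of the set of Cartan subalgebras of $\mathfrak{sl}_4$ (the subalgebras of traceless matrices diagonal with respect to some basis of $\mathbb{C}^4$). The equality is as sets (reduced varieties). $PGL_4$ acts by conjugation. *)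

(* Defs.v *)
From mathcomp Require Import all_boot all_order all_algebra.
From mathcomp Require Import mpoly complex.
From mathcomp Require Import boolp classical_sets functions cardinality reals.

Set Implicit Arguments.
Unset Strict Implicit.
Unset Printing Implicit Defensive.

Import GRing.Theory.

Local Open Scope classical_set_scope.
Local Open Scope ring_scope.

(* Subsets of projective space.  A (quasi-)projective variety is given by a set
   X of points of a type T and a map c sending each point of X to a vector of
   homogeneous coordinates.  The definitions below only depend on c x up to a
   nonzero scalar, which may vary with x. *)
Section ProjectiveVarieties.
Variable F : fieldType.

Definition zclosed (T : Type) (n : nat) (c : T -> 'I_n -> F) (X Z : set T) :
    Prop :=
  exists2 S : set {mpoly F[n]},
    (forall p, S p -> exists d, p \is d.-homog) &
    Z = X `&` [set x | forall p, S p -> p.@[c x] = 0].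

Definition zopen (T : Type) (n : nat) (c : T -> 'I_n -> F) (X U : set T) :
    Prop :=
  U `<=` X /\ zclosed c X (X `\` U).

Definition zclosure (T : Type) (n : nat) (c : T -> 'I_n -> F) (X A : set T) :
    set T :=
  smallest (zclosed c X) A.

(* Morphisms of varieties: near every point, the homogeneous coordinates of the
   image are homogeneous polynomials of one common degree, up to a nonzero
   scalar. *)
Definition regular_map (T T' : Type) (n m : nat)
    (c : T -> 'I_n -> F) (X : set T) (c' : T' -> 'I_m -> F) (Y : set T')
    (f : T -> T') : Prop :=
  set_fun X Y f /\
  forall x, X x -> exists (U : set T) (d : nat) (q : 'I_m -> {mpoly F[n]}),
    [/\ zopen c X U, U x, forall j, q j \is d.-homog &
        forall y, U y -> exists2 a : F, a != 0 &
          forall j, c' (f y) j = a * (q j).@[c y]].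

Definition biregular (T T' : Type) (n m : nat)
    (c : T -> 'I_n -> F) (X : set T) (c' : T' -> 'I_m -> F) (Y : set T')
    (f : T -> T') : Prop :=
  regular_map c X c' Y f /\
  exists g : T' -> T,
    [/\ regular_map c' Y c X g, forall x, X x -> g (f x) = x &
        forall y, Y y -> f (g y) = y].

(* Isomorphism of varieties with an action of GL_k (given by its restriction to
   unitmx); in all uses below scalar matrices act trivially, so that these are
   actions of PGL_k. *)
Definition pgl_isomorphic (k : nat) (T T' : Type) (n m : nat)
    (c : T -> 'I_n -> F) (act : 'M[F]_k -> T -> T) (X : set T)
    (c' : T' -> 'I_m -> F) (act' : 'M[F]_k -> T' -> T') (Y : set T') : Prop :=
  exists f : T -> T', biregular c X c' Y f /\
    forall g x, g \in unitmx -> X x -> f (act g x) = act' g (f x).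

End ProjectiveVarieties.

Section Grassmannians.
Variable F : fieldType.

Definition grass (V : vectType F) (k : nat) (W : {vspace V}) :
    set {vspace V} :=
  [set U | (U <= W)%VS /\ \dim U = k].

Definition plucker_idx (V : vectType F) (k : nat) :=
  {ffun 'I_k -> 'I_(\dim {:V})}.

(* The Pluecker coordinates of U (of dimension k), that is, the k x k minors of
   the matrix whose rows are the coordinates of a basis of U.  They are indexed
   by all maps from 'I_k to the set of columns rather than by the increasing
   ones; the additional coordinates are zero or equal up to sign to those of
   increasing maps (the k-th exterior power is viewed inside the k-th tensor
   power).  Any other choice of bases gives proportional coordinates on grass k
   (for U) or linearly equivalent ones (for V). *)
Definition plucker_mx (V : vectType F) (k : nat) (U : {vspace V}) :
    'M[F]_(k, \dim {:V}) :=
  \matrix_(i, j) coord (vbasis {:V}) j (vbasis U)`_i.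

Definition plucker (V : vectType F) (k : nat) (U : {vspace V})
    (s : 'I_#|plucker_idx V k|) : F :=
  \det (colsub (enum_val s) (plucker_mx k U)).

End Grassmannians.

Arguments grass {F} V k W.
Arguments plucker {F} V k U s.

Section Reductions.
Variables (F : fieldType) (n : nat).

Definition sl : {vspace 'M[F]_n} := lker (linfun (@mxtrace F n : _ -> F^o)).

Definition lie_bracket (x y : 'M[F]_n) : 'M[F]_n := x *m y - y *m x.

Definition Ab : set {vspace 'M[F]_n} :=
  grass _ n.-1 sl `&`
  [set U : {vspace _} | forall x y, x \in U -> y \in U -> lie_bracket x y = 0].

(* The columns of the invertible matrix g are a basis of F^n. *)
Definition cartan : set {vspace 'M[F]_n} :=
  [set U : {vspace _} | exists2 g, g \in unitmx &
     forall x, (x \in U) = (x \in sl) && is_diag_mx (invmx g *m x *m g)].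

Definition closed_in_grass (Z : set {vspace 'M[F]_n}) : Prop :=
  zclosed (plucker _ n.-1) (grass _ n.-1 sl) Z.

Definition Red : set {vspace 'M[F]_n} :=
  zclosure (plucker _ n.-1) (grass _ n.-1 sl) cartan.

Definition conj_act (g : 'M[F]_n) (U : {vspace 'M[F]_n}) : {vspace 'M[F]_n} :=
  (linfun (mulmxr (invmx g) \o mulmx g) @: U)%VS.

(* Since scalar matrices act trivially, this is also the orbit under PGL_n. *)
Definition pgl_orbit (U : {vspace 'M[F]_n}) : set {vspace 'M[F]_n} :=
  [set U' | exists2 g, g \in unitmx & U' = conj_act g U].

Definition pgl_orbits (X : set {vspace 'M[F]_n}) :
    set (set {vspace 'M[F]_n}) :=
  [set pgl_orbit U | U in X].

Definition proj_space : set {vspace 'cV[F]_n} := grass _ 1 fullv.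

Definition proj_act (g : 'M[F]_n) (L : {vspace 'cV[F]_n}) :
    {vspace 'cV[F]_n} := (linfun (mulmx g) @: L)%VS.

(* A row vector is a linear form on 'cV[F]_n. *)
Definition dual_proj_space : set {vspace 'rV[F]_n} := grass _ 1 fullv.

Definition dual_proj_act (g : 'M[F]_n) (L : {vspace 'rV[F]_n}) :
    {vspace 'rV[F]_n} := (linfun (mulmxr (invmx g)) @: L)%VS.

End Reductions.

Arguments sl : clear implicits.
Arguments Ab : clear implicits.
Arguments cartan : clear implicits.
Arguments Red : clear implicits.
Arguments proj_space : clear implicits.
Arguments dual_proj_space : clear implicits.

Section CompleteFlags.
Variable F : fieldType.

Definition flag4_type : Type :=
  ({vspace 'cV[F]_4} * {vspace 'cV[F]_4} * {vspace 'cV[F]_4})%type.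

Definition flag4 : set flag4_type :=
  [set E | [/\ \dim E.1.1 = 1, \dim E.1.2 = 2, \dim E.2 = 3 &
              (E.1.1 <= E.1.2)%VS && (E.1.2 <= E.2)%VS]%N].

Definition flag4_idx : finType :=
  ('I_#|plucker_idx 'cV[F]_4 1| * 'I_#|plucker_idx 'cV[F]_4 2|
    * 'I_#|plucker_idx 'cV[F]_4 3|)%type.

(* The Segre embedding of G(1,4) x G(2,4) x G(3,4). *)
Definition flag4_coord (E : flag4_type) (s : 'I_#|flag4_idx|) : F :=
  plucker _ 1 E.1.1 (enum_val s).1.1 * plucker _ 2 E.1.2 (enum_val s).1.2
    * plucker _ 3 E.2 (enum_val s).2.

Definition flag4_act (g : 'M[F]_4) (E : flag4_type) : flag4_type :=
  (proj_act g E.1.1, proj_act g E.1.2, proj_act g E.2).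

End CompleteFlags.

Arguments flag4 : clear implicits.

(* Main.v *)
(** Let N be an abelian subalgebra of dimension 3.  If some element of N has two
    eigenvalues, its spectral projectors split N into commuting families of 2x2
    and 3x3 matrices; otherwise N is nilpotent and is put in normal form by the
    nilpotency index of its elements.  This gives 14 normal forms, which are
    separated by conjugation invariant conditions.  Polynomial curves of normal
    forms starting at the Cartan orbit degenerate to all the others, whence
    Red(4) = Ab(4), and show that every orbit but three is not closed.  The three
    remaining ones are the loci in Ab(4) of subalgebras with a common image line,
    with a common kernel hyperplane, and of flag type, which are closed since they
    are cut out by multilinear equations.  An equivariant bijection onto the
    projective space, its dual or the flag variety is a morphism because the
    subspaces involved are spanned by the values of homogeneous polynomial
    sections in the Pluecker coordinates. *)
Require Import Defs.
From mathcomp Require Import all_boot all_order all_algebra.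
From mathcomp Require Import fingroup perm mpoly complex.
From mathcomp Require Import boolp classical_sets functions cardinality reals.
From mathcomp Require Import ring.

Set Implicit Arguments.
Unset Strict Implicit.
Unset Printing Implicit Defensive.

Import GRing.Theory Num.Theory.

Local Open Scope classical_set_scope.
Local Open Scope ring_scope.

(** * Homogeneous polynomial functions of coordinates *)

Section HomogeneousPolynomialMaps.
Variables (F : fieldType) (n : nat).

(** Closedness and regularity are stated in Pluecker coordinates, whereas every condition below
    speaks of elements of a subspace. The bridge is the interior product: contracting the Pluecker
    vector of [U] in all but one index gives vectors of [U], linear in the coordinates, that
    together span [U]. A multilinear identity on [U] thereby becomes a system of homogeneous
    equations, and a polynomial recipe for vectors of a subspace becomes a section. The main
    obstacle is to cut out the flag orbit by closed conditions. Orbits 12 and 13 both consist of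
    spaces of maps from V/W to W with \dim W = 2, that is, of hyperplanes in the 2 x 2 matrices; the
    determinant degenerates on the hyperplane for orbit 12 and not for orbit 13. The expression x
    adj(y) z - z adj(y) x is alternating in x, y, z and gives the vector normal to the hyperplane
    for the polarised determinant, so orbit 12 is where this vector has rank one. On orbit 12 the
    same vector is a map whose image is the line and whose kernel is the hyperplane of the flag, and
    so it also provides the sections of these two. *)

Definition hpoly d (f : ('I_n -> F) -> F) : Prop :=
  exists2 p : {mpoly F[n]}, p \is d.-homog & forall v, f v = p.@[v].

Lemma hpoly0 d : hpoly d (fun=> 0).
Proof. by exists 0 => [|v]; rewrite ?dhomog0 ?meval0. Qed.

Lemma hpolyC a : hpoly 0 (fun=> a).
Proof.
exists (a *: 1) => [|v]; first by rewrite dhomogZ ?dhomog1.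
by rewrite mevalZ meval1 mulr1.
Qed.

Lemma hpolyX i : hpoly 1 (fun v => v i).
Proof. by exists 'X_i => [|v]; rewrite ?mevalXU // dhomogX /= mdeg1. Qed.

Lemma hpolyD d f g : hpoly d f -> hpoly d g -> hpoly d (fun v => f v + g v).
Proof.
move=> [p hp fE] [q hq gE]; exists (p + q) => [|v]; first exact: dhomogD.
by rewrite mevalD fE gE.
Qed.

Lemma hpolyM d e f g :
  hpoly d f -> hpoly e g -> hpoly (d + e)%N (fun v => f v * g v).
Proof.
move=> [p hp fE] [q hq gE]; exists (p * q) => [|v]; first exact: dhomogM.
by rewrite mevalM fE gE.
Qed.

Lemma hpolyZ d a f : hpoly d f -> hpoly d (fun v => a * f v).
Proof. by move=> hf; exact: (hpolyM (hpolyC a) hf). Qed.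

Lemma hpolyZr d a f : hpoly d f -> hpoly d (fun v => f v * a).
Proof. by move=> hf; rewrite -[d]addn0; exact: (hpolyM hf (hpolyC a)). Qed.

Lemma hpolyN d f : hpoly d f -> hpoly d (fun v => - f v).
Proof.
by move=> [p hp fE]; exists (- p) => [|v]; rewrite ?dhomogN // mevalN fE.
Qed.

Lemma hpolyB d f g : hpoly d f -> hpoly d g -> hpoly d (fun v => f v - g v).
Proof. by move=> hf hg; apply: hpolyD => //; apply: hpolyN. Qed.

Lemma hpoly_sum d (I : Type) (r : seq I) (P : pred I) f :
  (forall i, hpoly d (f i)) -> hpoly d (fun v => \sum_(i <- r | P i) f i v).
Proof.
move=> hf; elim: r => [|i r IHr].
  by under eq_fun do rewrite big_nil; exact: hpoly0.
under eq_fun do rewrite big_cons.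
by case: (P i) => //; exact: hpolyD.
Qed.

Lemma hpoly_prod (I : Type) (r : seq I) (d : I -> nat) f :
  (forall i, hpoly (d i) (f i)) ->
  hpoly (\sum_(i <- r) d i)%N (fun v => \prod_(i <- r) f i v).
Proof.
move=> hf; elim: r => [|i r IHr].
  by rewrite big_nil; under eq_fun do rewrite big_nil; exact: hpolyC.
rewrite big_cons; have /= := hpolyM (hf i) IHr.
by congr (hpoly _ _); apply/funext => v; rewrite big_cons.
Qed.

Lemma hpoly_det k (d : 'I_k -> nat) (f : 'I_k -> 'I_k -> ('I_n -> F) -> F) :
  (forall i j, hpoly (d i) (f i j)) ->
  hpoly (\sum_i d i)%N (fun v => \det (\matrix_(i, j) f i j v)).
Proof.
move=> hf; rewrite /determinant; apply: hpoly_sum => s.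
apply: hpolyZ; have /= := hpoly_prod (index_enum 'I_k) (fun i => hf i (s i)).
congr (hpoly _ _); apply/funext => v; apply: eq_bigr => i _.
by rewrite mxE.
Qed.

Lemma hpoly_scale d f a v :
  hpoly d f -> f (fun i => a * v i) = a ^+ d * f v.
Proof.
move=> [p /dhomogP hp fE]; rewrite !fE !mevalE mulr_sumr.
apply: eq_big_seq => m /hp <-; rewrite mulrCA; congr (_ * _).
under eq_bigr do rewrite exprMn.
by rewrite big_split /= -expr_sum mdegE.
Qed.

End HomogeneousPolynomialMaps.

(** * Interior products of Pluecker vectors *)

Section Contractions.
Variables (F : fieldType) (V : vectType F).
Local Notation b := (vbasis {:V}).

(* Replacing the m-th column index by every j in turn: the interior product of
   the decomposable k-vector of U with a coordinate (k-1)-form lies in U. *)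
Definition contr k (c : 'I_#|plucker_idx V k| -> F) (f : plucker_idx V k)
    (m : 'I_k) : V :=
  \sum_(j < \dim {:V})
    c (enum_rank ([ffun i => if i == m then j else f i] : plucker_idx V k))
      *: b`_j.

(** Expanding the minors along column [m] leaves cofactors that do not involve the replaced index;
    the remaining sum over [j] reassembles the basis vectors of [U]. *)
Lemma contrE (U : {vspace V}) k (f : plucker_idx V k) (m : 'I_k) :
  contr (plucker V k U) f m =
  \sum_(i < k) \adj (colsub f (plucker_mx k U)) m i *: (vbasis U)`_i.
Proof.
set M := plucker_mx k U.
have minorE j : plucker V k U (enum_rank
      ([ffun i => if i == m then j else f i] : plucker_idx V k)) =
    \sum_i \adj (colsub f M) m i * M i j.
  rewrite /plucker enum_rankK (expand_det_col _ m); apply: eq_bigr => i _.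
  rewrite mulrC !mxE ffunE eqxx; congr (_ * _); rewrite /cofactor.
  congr (_ * \det _); apply/matrixP => p q; rewrite !mxE ffunE.
  by rewrite eq_sym (negPf (neq_lift _ _)).
rewrite /contr; under eq_bigr do rewrite minorE scaler_suml.
rewrite exchange_big /=; apply: eq_bigr => i _.
under eq_bigr do rewrite -scalerA.
rewrite -scaler_sumr; congr (_ *: _).
rewrite [RHS](coord_vbasis (memvf _)); apply: eq_bigr => j _.
by rewrite mxE.
Qed.

Lemma contr_in (U : {vspace V}) k (f : plucker_idx V k) m :
  \dim U = k -> contr (plucker V k U) f m \in U.
Proof.
move=> dU; rewrite contrE; apply: memv_suml => i _; apply: memvZ.
by apply/vbasis_mem/mem_nth; rewrite size_tuple dU.
Qed.

Lemma codom_spanP k (w : 'I_k -> V) u :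
  u \in <<codom w>>%VS -> exists a : 'I_k -> F, u = \sum_i a i *: w i.
Proof.
rewrite span_def big_image /= => /memv_sumP[v vw ->].
have /choice [a aE] : forall i, exists a, v i = a *: w i.
  by move=> i; apply/vlineP; exact: vw.
by exists a; apply: eq_bigr => i _.
Qed.

(** The rows [w i] factor through the chosen basis of [U], so the determinant of this change of
    vectors multiplies all minors alike. It is nonzero once the [w i] span [U], since the basis is
    then expressed back through [Q]. *)
Lemma plucker_minors (U : {vspace V}) k (w : 'I_k -> V) :
  \dim U = k -> (forall i, w i \in U) -> exists a : F,
  (forall s : 'I_#|plucker_idx V k|, \det (colsub (enum_val s) (\matrix_(i, j) coord b j (w i)))
             = a * plucker V k U s) /\
  ((forall u, u \in U -> u \in <<codom w>>%VS) -> a != 0).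
Proof.
move=> dU; subst k => wU.
pose P := \matrix_(i, l) coord (vbasis U) l (w i).
exists (\det P); split.
  move=> s; rewrite /plucker -det_mulmx; congr (\det _).
  apply/matrixP => i j; rewrite !mxE {1}(coord_vbasis (wU i)) linear_sum.
  by apply: eq_bigr => l _; rewrite linearZ /= !mxE.
move=> wsp.
have wcod u : u \in U -> exists a : 'I_(\dim U) -> F, u = \sum_i a i *: w i.
  by move=> /wsp /codom_spanP.
have [Q QE] : exists Q : 'M_(\dim U),
    forall i : 'I_(\dim U), (vbasis U)`_i = \sum_j Q i j *: w j.
  have /choice [q qE] : forall i : 'I_(\dim U), exists a : 'I_(\dim U) -> F,
      (vbasis U)`_i = \sum_j a j *: w j.
    by move=> i; apply/wcod/vbasis_mem/mem_nth; rewrite size_tuple.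
  exists (\matrix_(i, j) q i j) => i; rewrite qE.
  by apply: eq_bigr => j _; rewrite mxE.
suff QP : Q *m P = 1%:M.
  by apply/eqP => dP0; have := congr1 determinant QP;
    rewrite det_mulmx dP0 mulr0 det1 => /esym/eqP; rewrite oner_eq0.
apply/matrixP => i l; rewrite !mxE.
have := congr1 (coord (vbasis U) l) (QE i); rewrite linear_sum /=.
rewrite coord_free ?(basis_free (vbasisP U)) // => ->.
by apply: eq_bigr => j _; rewrite linearZ !mxE.
Qed.

(** The coordinates of the projections to [U] of the ambient basis form a right inverse of the
    Pluecker matrix. Its rank is therefore [k], and [k] independent columns give a nonzero minor. *)
Lemma plucker_neq0 (U : {vspace V}) k :
  \dim U = k -> exists s, plucker V k U s != 0.
Proof.
move=> dU; pose M := plucker_mx k U.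
have rfM : row_free M.
  apply/row_freeP; subst k.
  have fb := basis_free (vbasisP U).
  exists (\matrix_(j, l) coord (vbasis U) l (projv U b`_j)).
  apply/matrixP => i l; rewrite !mxE.
  have uU : (vbasis U)`_i \in U.
    by apply/vbasis_mem/mem_nth; rewrite size_tuple.
  rewrite -(coord_free _ _ fb) -[in RHS](projv_id uU).
  rewrite [X in projv U X](coord_vbasis (memvf _)) !linear_sum.
  by apply: eq_bigr => j _; rewrite !linearZ !mxE.
have rfT : row_full M^T by rewrite /row_full mxrank_tr.
have := mxrank_fullrowsub rfT; set f := fullrankfun rfT => rf.
exists (enum_rank [ffun i => f i]); rewrite /plucker enum_rankK.
have -> : colsub [ffun i => f i] M = (rowsub f M^T)^T.
  by apply/matrixP => i j; rewrite !mxE ffunE.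
by rewrite det_tr -unitfE -unitmxE -row_full_unit /row_full rf.
Qed.

(** Choose [f] with invertible minor [A]. By [contrE] the contractions at [f] are [\adj A] applied
    to the basis of [U], and since [A *m \adj A] is the scalar [\det A], they recover the basis.
    Linear properties of elements of [U] can thus be proved on contractions. *)
Lemma contr_ind (U : {vspace V}) k (P : V -> Prop) :
  \dim U = k -> P 0 -> (forall a u v, P u -> P v -> P (a *: u + v)) ->
  (forall f m, P (contr (plucker V k U) f m)) -> forall u, u \in U -> P u.
Proof.
move=> dU P0 PL Pc.
have [s s0] := plucker_neq0 dU; pose f : plucker_idx V k := enum_val s.
pose A := colsub f (plucker_mx k U).
have Psum k' (a : 'I_k' -> F) (w : 'I_k' -> V) :
    (forall i, P (w i)) -> P (\sum_i a i *: w i).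
  by move=> Pw; elim/big_rec: _ => // i x _ Px; exact: PL.
have basisE (i : 'I_k) : (vbasis U)`_i =
    \sum_m ((\det A)^-1 * A i m) *: contr (plucker V k U) f m.
  under [RHS]eq_bigr do rewrite contrE scaler_sumr.
  rewrite exchange_big /= (bigD1 i) //= [X in _ + X]big1 ?addr0.
    under eq_bigr do rewrite scalerA -mulrA.
    rewrite -scaler_suml -mulr_sumr.
    have := congr1 (fun B : 'M_k => B i i) (mul_mx_adj A).
    by rewrite !mxE eqxx mulr1n => ->; rewrite mulVf // scale1r.
  move=> j jNi; under eq_bigr do rewrite scalerA -mulrA.
  rewrite -scaler_suml -mulr_sumr.
  have := congr1 (fun B : 'M_k => B i j) (mul_mx_adj A).
  by rewrite !mxE eq_sym (negPf jNi) mulr0n => ->; rewrite mulr0 scale0r.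
move=> u uU; rewrite (coord_vbasis uU); apply: (Psum) => i.
have ik : (i < k)%N by rewrite -dU.
rewrite -[val i]/(val (Ordinal ik)) basisE.
exact: Psum.
Qed.

(** Greedy extraction: fewer than [k] vectors do not span [U], so by the last hypothesis some
    element of [G] lies outside their span. *)
Lemma basis_choice (U : {vspace V}) k (G : V -> Prop) :
  \dim U = k -> (forall v, G v -> v \in U) ->
  (forall S : {vspace V}, (forall v, G v -> v \in S) -> (U <= S)%VS) ->
  exists w : 'I_k -> V, (forall i, G (w i)) /\
    forall u, u \in U -> u \in <<codom w>>%VS.
Proof.
move=> dU GU Gsp.
have [s [sz fs sG]] : exists s : seq V,
    [/\ size s = k, free s & forall v, v \in s -> G v].
  have : (k <= k)%N by [].
  elim: {-2}k => [|i IHi] ik; first by exists [::]; rewrite nil_free.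
  have [s [sz fs sG]] := IHi (ltnW ik).
  have [v Gv vs] : exists2 v, G v & v \notin <<s>>%VS.
    apply: contrapT => no; have := dim_span s; rewrite sz leqNgt.
    rewrite (leq_trans ik) // -dU; apply/dimvS/Gsp => v Gv.
    by apply: contrapT => /negP vs; apply: no; exists v.
  exists (v :: s); split; rewrite /= ?sz ?free_cons ?vs //.
  by move=> x; rewrite inE => /predU1P[-> //|/sG].
exists (fun i => s`_i); split=> [i|u].
  by apply/sG/mem_nth; rewrite sz.
have -> : codom (fun i : 'I_k => s`_i) = s.
  apply: (@eq_from_nth _ 0) => [|i]; rewrite size_codom card_ord ?sz // => ik.
  by rewrite (nth_codom 0 _ (cast_ord (esym (card_ord k)) (Ordinal ik)))
     //= enum_val_ord.
suff -> : <<s>>%VS = U by [].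
apply/eqP; rewrite eqEdim dU; apply/andP; split.
  by apply/span_subvP => v /sG /GU.
by move: fs; rewrite /free sz => /eqP ->.
Qed.

End Contractions.

(** * Polynomial sections and regularity *)

Section RegularMaps.
Variables (F : fieldType) (n : nat).
Implicit Types p q d e : nat.

Definition hmx p q d (w : ('I_n -> F) -> 'M[F]_(p, q)) : Prop :=
  forall i j, hpoly d (fun v => w v i j).

Lemma hmxC p q (A : 'M[F]_(p, q)) : hmx 0 (fun=> A).
Proof. by move=> i j; exact: hpolyC. Qed.

Lemma hmxM p q r d e (w : _ -> 'M_(p, q)) (w' : _ -> 'M_(q, r)) :
  hmx d w -> hmx e w' -> hmx (d + e) (fun v => w v *m w' v).
Proof.
move=> hw hw' i j.
have := @hpoly_sum _ _ (d + e)%N _ (index_enum 'I_q) xpredT _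
  (fun k => hpolyM (hw i k) (hw' k j)).
by congr (hpoly _ _); apply/funext => v; rewrite mxE.
Qed.

Lemma hmxB p q d (w w' : _ -> 'M_(p, q)) :
  hmx d w -> hmx d w' -> hmx d (fun v => w v - w' v).
Proof.
move=> hw hw' i j; have := hpolyB (hw i j) (hw' i j).
by congr (hpoly _ _); apply/funext => v; rewrite !mxE.
Qed.

Lemma hmxT p q d (w : _ -> 'M_(p, q)) : hmx d w -> hmx d (fun v => (w v)^T).
Proof.
move=> hw i j; have := hw j i.
by congr (hpoly _ _); apply/funext => v; rewrite mxE.
Qed.

Lemma hmxMl p q r d (A : 'M_(p, q)) (w : _ -> 'M_(q, r)) :
  hmx d w -> hmx d (fun v => A *m w v).
Proof. by move=> hw; exact: (hmxM (hmxC A) hw). Qed.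

Lemma hmxMr p q r d (w : _ -> 'M_(p, q)) (A : 'M_(q, r)) :
  hmx d w -> hmx d (fun v => w v *m A).
Proof. by move=> hw; rewrite -[d]addn0; exact: (hmxM hw (hmxC A)). Qed.

Lemma hmx_linear p q d (w : _ -> 'M_(p, q)) (l : {linear 'M[F]_(p, q) -> F^o}) :
  hmx d w -> hpoly d (fun v => l (w v)).
Proof.
move=> hw.
have := @hpoly_sum _ _ d _ (index_enum 'I_p) xpredT _ (fun i =>
  @hpoly_sum _ _ d _ (index_enum 'I_q) xpredT _ (fun j =>
    hpolyZr (l (delta_mx i j)) (hw i j))).
congr (hpoly _ _); apply/funext => v.
rewrite [in RHS](matrix_sum_delta (w v)) linear_sum.
apply: eq_bigr => i _; rewrite linear_sum; apply: eq_bigr => j _.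
by rewrite linearZ.
Qed.

Lemma zclosed_zeros (T I : Type) (c : T -> 'I_n -> F) (X : set T)
    (d : I -> nat) (f : I -> ('I_n -> F) -> F) :
  (forall i, hpoly (d i) (f i)) ->
  zclosed c X (X `&` [set x | forall i, f i (c x) = 0]).
Proof.
move=> hf; exists (fun r : {mpoly F[n]} => exists2 i, r \is (d i).-homog &
    forall v, f i v = r.@[v]); first by move=> r [i hp _]; exists (d i).
apply/seteqP; split=> x [Xx fx]; split=> //=.
  by move=> r [i _ <-].
by move=> i; have [p hp fE] := hf i; rewrite fE; apply: fx; exists i.
Qed.

Lemma zclosedI (T : Type) (c : T -> 'I_n -> F) (X Z Z' : set T) :
  zclosed c X Z -> zclosed c X Z' -> zclosed c X (Z `&` Z').
Proof.
move=> [S Sh ->] [S' Sh' ->]; exists (S `|` S').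
  by move=> p [/Sh|/Sh'].
apply/seteqP; split=> x /=.
  by move=> [[Xx Sx] [_ S'x]]; split=> // p [/Sx|/S'x].
by move=> [Xx SSx]; split; split=> // p Sp; apply: SSx; [left|right].
Qed.

Lemma zopen_nonzero (T : Type) m (c : T -> 'I_n -> F) (X : set T)
    d (f : 'I_m -> ('I_n -> F) -> F) :
  (forall i, hpoly d (f i)) ->
  zopen c X (X `&` [set x | exists i, f i (c x) != 0]).
Proof.
move=> hf; split; first by move=> x [].
have := @zclosed_zeros _ _ c X (fun=> d) f hf; congr (zclosed _ _ _).
apply/seteqP; split=> x [Xx fx]; split=> //=.
  by move=> [_ [i /eqP]].
by move=> i; apply: contrapT => /eqP fi; apply: fx; split=> //; exists i.
Qed.

(** The neighbourhood of [regular_map] is fixed to be the locus where some [q j] is nonzero, so that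
    no open set has to be carried around. *)
Definition locally_poly (T T' : Type) m (c : T -> 'I_n -> F) (X : set T)
    (c' : T' -> 'I_m -> F) (f : T -> T') : Prop :=
  forall x, X x -> exists d (q : 'I_m -> ('I_n -> F) -> F),
    [/\ forall j, hpoly d (q j), exists j, q j (c x) != 0 &
        forall y, X y -> (exists j, q j (c y) != 0) ->
          exists2 a : F, a != 0 & forall j, c' (f y) j = a * q j (c y)].

Lemma locally_poly_regular (T T' : Type) m (c : T -> 'I_n -> F) (X : set T)
    (c' : T' -> 'I_m -> F) (Y : set T') (f : T -> T') :
  set_fun X Y f -> locally_poly c X c' f -> regular_map c X c' Y f.
Proof.
move=> fXY fq; split=> // x Xx; have [d [q [hq qx qE] ] ] := fq x Xx.
have /choice [p pP] : forall j, exists p : {mpoly F[n]},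
    p \is d.-homog /\ forall v, q j v = p.@[v].
  by move=> j; have [p hp pE] := hq j; exists p.
exists (X `&` [set x | exists j, q j (c x) != 0]), d, p.
split=> [||j|y [Xy qy]]; first exact: zopen_nonzero.
- by split.
- by have [] := pP j.
have [a a0 aE] := qE y Xy qy; exists a => // j.
by rewrite aE; have [_ ->] := pP j.
Qed.

Section Frames.
Variables (T : Type) (c : T -> 'I_n -> F) (X : set T) (p q : nat).
Implicit Type f : T -> {vspace 'M[F]_(p, q)}.

Definition section_of f (w : ('I_n -> F) -> 'M[F]_(p, q)) : Prop :=
  exists d, hmx d w /\ forall x, X x -> w (c x) \in f x.

(** Quantifying over the subspaces [S] that contain all the values replaces the span of an infinite
    family. *)
Definition globally_generated f : Prop :=
  forall x, X x -> forall S : {vspace 'M[F]_(p, q)},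
    (forall w, section_of f w -> w (c x) \in S) -> (f x <= S)%VS.

(** Take sections whose values at [x] form a basis of [f x]: the maximal minors of their coordinates
    represent the Pluecker coordinates of [f] near [x]. *)
Lemma generated_locally_poly k f :
  (forall x, X x -> \dim (f x) = k) -> globally_generated f ->
  locally_poly c X (plucker _ k) f.
Proof.
move=> df fg x Xx.
pose G v := exists2 w, section_of f w & v = w (c x).
have [v [vG vsp] ] : exists v : 'I_k -> 'M[F]_(p, q), (forall i, G (v i)) /\
    forall u, u \in f x -> u \in <<codom v>>%VS.
  apply: basis_choice => [|_ [w [d [_ wf] ] ->]|S SG]; first exact: df.
  - exact: wf.
  - by apply: fg => // w hw; apply: SG; exists w.
have /choice [w wP] : forall i, exists w, section_of f w /\ v i = w (c x).
  by move=> i; have [w] := vG i; exists w.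
have /choice [d dP] : forall i, exists d, hmx d (w i).
  by move=> i; have [[d [] ] ] := wP i; exists d.
pose M y := \matrix_(i, j) coord (vbasis {:'M[F]_(p, q)}) j (w i y).
have wf i y : X y -> w i (c y) \in f y.
  by move=> Xy; have [[d' [_ hw] ] _] := wP i; exact: hw.
exists (\sum_i d i)%N,
  (fun s y => \det (colsub (enum_val s : plucker_idx _ k) (M y))); split.
- move=> s; have := @hpoly_det _ _ _ d (fun i j y => coord
    (vbasis {:'M[F]_(p, q)}) ((enum_val s : plucker_idx _ k) j) (w i y))
    (fun i j => hmx_linear _ (dP i)).
  congr (hpoly _ _); apply/funext => y; congr (\det _).
  by apply/matrixP => i j; rewrite !mxE.
- have [a [aE a0] ] := plucker_minors (df x Xx) (fun i => wf i x Xx).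
  have [s s0] := plucker_neq0 (df x Xx).
  exists s; rewrite aE mulf_neq0 // a0 //.
  suff -> : (fun i => w i (c x)) = v by [].
  by apply/funext => i; have [_ ->] := wP i.
(* One nonzero minor at [y] already forces the common factor [a] to be nonzero. *)
move=> y Xy [s]; have [a [aE _] ] := plucker_minors (df y Xy)
  (fun i => wf i y Xy).
rewrite aE => as0; have a0 : a != 0.
  by apply: contraNneq as0 => ->; rewrite mul0r.
by exists a^-1 => [|j]; rewrite ?invr_eq0 // aE mulrA mulVf // mul1r.
Qed.

End Frames.
End RegularMaps.

Section GrassmannianFrames.
Variables (F : fieldType) (p q k : nat).
Local Notation V := 'M[F]_(p, q).

(** The map [r] lets a contraction read its Pluecker coordinates inside a longer coordinate vector,
    as needed for the Segre coordinates of flags. *)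
Lemma hmx_contr_reindex n (r : 'I_#|plucker_idx V k| -> 'I_n)
    (f : plucker_idx V k) m : hmx 1 (fun c : 'I_n -> F => contr (c \o r) f m).
Proof.
move=> i j.
have := @hpoly_sum F n 1 _ (index_enum 'I_(\dim {:V})) xpredT _ (fun l =>
  hpolyZr ((vbasis {:V})`_l i j) (hpolyX F (r (enum_rank
    ([ffun i' => if i' == m then l else f i'] : plucker_idx V k))))).
congr (hpoly _ _); apply/funext => v.
by rewrite /contr summxE; apply: eq_bigr => l _; rewrite mxE.
Qed.

Lemma hmx_contr (f : plucker_idx V k) m : hmx 1 (fun c => contr c f m).
Proof. exact: (hmx_contr_reindex id). Qed.

End GrassmannianFrames.

(** * Explicit 4 x 4 matrices *)

Notation i0 := (@Ordinal 4 0 isT).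
Notation i1 := (@Ordinal 4 1 isT).
Notation i2 := (@Ordinal 4 2 isT).
Notation i3 := (@Ordinal 4 3 isT).

Section FourByFour.
Variable R : comUnitRingType.

Definition mx4 (a00 a01 a02 a03 a10 a11 a12 a13 a20 a21 a22 a23
    a30 a31 a32 a33 : R) : 'M[R]_4 :=
  \matrix_(i, j) nth 0 (nth [::]
    [:: [:: a00; a01; a02; a03]; [:: a10; a11; a12; a13];
        [:: a20; a21; a22; a23]; [:: a30; a31; a32; a33]] i) j.

Lemma ord4P (P : 'I_4 -> Prop) : P i0 -> P i1 -> P i2 -> P i3 -> forall i, P i.
Proof.
move=> P0 P1 P2 P3 [[|[|[|[|//] ] ] ] Hi].
- by rewrite (_ : Ordinal Hi = i0) //; apply: val_inj.
- by rewrite (_ : Ordinal Hi = i1) //; apply: val_inj.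
- by rewrite (_ : Ordinal Hi = i2) //; apply: val_inj.
- by rewrite (_ : Ordinal Hi = i3) //; apply: val_inj.
Qed.

Lemma sum4 (V : nmodType) (f : 'I_4 -> V) :
  \sum_i f i = f i0 + f i1 + f i2 + f i3.
Proof.
rewrite !big_ord_recl big_ord0 addr0 !addrA.
by congr (f _ + f _ + f _ + f _); apply: val_inj.
Qed.

Lemma mx4P (A B : 'M[R]_4) :
  A i0 i0 = B i0 i0 -> A i0 i1 = B i0 i1 -> A i0 i2 = B i0 i2 ->
  A i0 i3 = B i0 i3 -> A i1 i0 = B i1 i0 -> A i1 i1 = B i1 i1 ->
  A i1 i2 = B i1 i2 -> A i1 i3 = B i1 i3 -> A i2 i0 = B i2 i0 ->
  A i2 i1 = B i2 i1 -> A i2 i2 = B i2 i2 -> A i2 i3 = B i2 i3 ->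
  A i3 i0 = B i3 i0 -> A i3 i1 = B i3 i1 -> A i3 i2 = B i3 i2 ->
  A i3 i3 = B i3 i3 -> A = B.
Proof. by move=> *; apply/matrixP; do 2!apply: ord4P. Qed.

Lemma mx4E (A : 'M[R]_4) : A = mx4
  (A i0 i0) (A i0 i1) (A i0 i2) (A i0 i3) (A i1 i0) (A i1 i1) (A i1 i2) (A i1 i3)
  (A i2 i0) (A i2 i1) (A i2 i2) (A i2 i3) (A i3 i0) (A i3 i1) (A i3 i2) (A i3 i3).
Proof. by apply: mx4P; rewrite mxE. Qed.

Lemma mul_mx4 a00 a01 a02 a03 a10 a11 a12 a13 a20 a21 a22 a23 a30 a31 a32 a33
    b00 b01 b02 b03 b10 b11 b12 b13 b20 b21 b22 b23 b30 b31 b32 b33 :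
  mx4 a00 a01 a02 a03 a10 a11 a12 a13 a20 a21 a22 a23 a30 a31 a32 a33 *m
  mx4 b00 b01 b02 b03 b10 b11 b12 b13 b20 b21 b22 b23 b30 b31 b32 b33 =
  mx4 (a00 * b00 + a01 * b10 + a02 * b20 + a03 * b30)
      (a00 * b01 + a01 * b11 + a02 * b21 + a03 * b31)
      (a00 * b02 + a01 * b12 + a02 * b22 + a03 * b32)
      (a00 * b03 + a01 * b13 + a02 * b23 + a03 * b33)
      (a10 * b00 + a11 * b10 + a12 * b20 + a13 * b30)
      (a10 * b01 + a11 * b11 + a12 * b21 + a13 * b31)
      (a10 * b02 + a11 * b12 + a12 * b22 + a13 * b32)
      (a10 * b03 + a11 * b13 + a12 * b23 + a13 * b33)
      (a20 * b00 + a21 * b10 + a22 * b20 + a23 * b30)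
      (a20 * b01 + a21 * b11 + a22 * b21 + a23 * b31)
      (a20 * b02 + a21 * b12 + a22 * b22 + a23 * b32)
      (a20 * b03 + a21 * b13 + a22 * b23 + a23 * b33)
      (a30 * b00 + a31 * b10 + a32 * b20 + a33 * b30)
      (a30 * b01 + a31 * b11 + a32 * b21 + a33 * b31)
      (a30 * b02 + a31 * b12 + a32 * b22 + a33 * b32)
      (a30 * b03 + a31 * b13 + a32 * b23 + a33 * b33).
Proof. by apply: mx4P; rewrite !mxE sum4 !mxE. Qed.

Lemma mx4_lin s a00 a01 a02 a03 a10 a11 a12 a13 a20 a21 a22 a23 a30 a31 a32 a33
    b00 b01 b02 b03 b10 b11 b12 b13 b20 b21 b22 b23 b30 b31 b32 b33 :
  s *: mx4 a00 a01 a02 a03 a10 a11 a12 a13 a20 a21 a22 a23 a30 a31 a32 a33 +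
  mx4 b00 b01 b02 b03 b10 b11 b12 b13 b20 b21 b22 b23 b30 b31 b32 b33 =
  mx4 (s * a00 + b00) (s * a01 + b01) (s * a02 + b02) (s * a03 + b03)
      (s * a10 + b10) (s * a11 + b11) (s * a12 + b12) (s * a13 + b13)
      (s * a20 + b20) (s * a21 + b21) (s * a22 + b22) (s * a23 + b23)
      (s * a30 + b30) (s * a31 + b31) (s * a32 + b32) (s * a33 + b33).
Proof. by apply: mx4P; rewrite !mxE. Qed.

Lemma tr_mx4 a00 a01 a02 a03 a10 a11 a12 a13 a20 a21 a22 a23 a30 a31 a32 a33 :
  (mx4 a00 a01 a02 a03 a10 a11 a12 a13 a20 a21 a22 a23 a30 a31 a32 a33)^T =
  mx4 a00 a10 a20 a30 a01 a11 a21 a31 a02 a12 a22 a32 a03 a13 a23 a33.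
Proof. by apply: mx4P; rewrite !mxE. Qed.

Lemma scalar_mx4 a : a%:M = mx4 a 0 0 0 0 a 0 0 0 0 a 0 0 0 0 a.
Proof. by apply: mx4P; rewrite !mxE. Qed.

Lemma mx4_unit (g h : 'M[R]_4) : g *m h = 1%:M -> g \in unitmx.
Proof. by case/mulmx1_unit. Qed.

End FourByFour.

(** * The fourteen normal forms *)

Section NormalForms.
Variable F : fieldType.

(* 0 is the Cartan subalgebra; the orbits of 10, 11 and 12 are the closed ones. *)
Definition nform (k : nat) (a b c : F) : 'M[F]_4 :=
  match k with
  | 0 => mx4 a 0 0 0  0 b 0 0  0 0 c 0  0 0 0 (- a - b - c)
  | 1 => mx4 a b 0 0  0 a 0 0  0 0 c 0  0 0 0 (- a - a - c)
  | 2 => mx4 a b 0 0  0 a 0 0  0 0 (- a) c  0 0 0 (- a)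
  | 3 => mx4 a b c 0  0 a b 0  0 0 a 0  0 0 0 (- a - a - a)
  | 4 => mx4 a b c 0  0 a 0 0  0 0 a 0  0 0 0 (- a - a - a)
  | 5 => mx4 a 0 b 0  0 a c 0  0 0 a 0  0 0 0 (- a - a - a)
  | 6 => mx4 0 a b c  0 0 a b  0 0 0 a  0 0 0 0
  | 7 => mx4 0 a b c  0 0 0 b  0 0 0 a  0 0 0 0
  | 8 => mx4 0 a 0 b  0 0 0 a  0 0 0 c  0 0 0 0
  | 9 => mx4 0 a c b  0 0 0 a  0 0 0 0  0 0 0 0
  | 10 => mx4 0 a b c  0 0 0 0  0 0 0 0  0 0 0 0
  | 11 => mx4 0 0 0 a  0 0 0 b  0 0 0 c  0 0 0 0
  | 12 => mx4 0 0 a b  0 0 0 c  0 0 0 0  0 0 0 0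
  | _ => mx4 0 0 a b  0 0 b c  0 0 0 0  0 0 0 0
  end.

Definition rep k : {vspace 'M[F]_4} :=
  <<[:: nform k 1 0 0; nform k 0 1 0; nform k 0 0 1]>>%VS.

Lemma nform_lin k s a b c a' b' c' :
  s *: nform k a b c + nform k a' b' c' =
  nform k (s * a + a') (s * b + b') (s * c + c').
Proof.
by do 14?[case: k => [|k] ]; rewrite mx4_lin; congr mx4; ring.
Qed.

Lemma nform0 k : nform k 0 0 0 = 0.
Proof.
by do 14?[case: k => [|k] ]; apply: mx4P; rewrite !mxE /=; ring.
Qed.

Lemma nformE k a b c :
  nform k a b c = a *: nform k 1 0 0 + (b *: nform k 0 1 0 + c *: nform k 0 0 1).
Proof.
have cE : c *: nform k 0 0 1 = nform k 0 0 c.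
  by rewrite -[LHS]addr0 -(nform0 k) nform_lin; congr nform; ring.
by rewrite cE !nform_lin; congr nform; ring.
Qed.

Lemma mem_rep k x :
  (x \in rep k) <-> exists a b c, x = nform k a b c.
Proof.
rewrite /rep !span_cons span_nil addv0; split.
  move=> /memv_addP[u /vlineP[a ->] [v /memv_addP[w /vlineP[b ->]
    [z /vlineP[c ->] ->] ] ->] ].
  by exists a, b, c; rewrite [RHS]nformE.
move=> [a [b [c ->] ] ]; rewrite nformE.
by rewrite !memv_add // memvZ // memv_line.
Qed.

Lemma nform_in k a b c : nform k a b c \in rep k.
Proof. by apply/mem_rep; exists a, b, c. Qed.

Lemma nform_eq0 k a b c : nform k a b c = 0 -> [/\ a = 0, b = 0 & c = 0].
Proof.
move=> /matrixP E.
by do 14?[case: k E => [|k] E]; have := (E i0 i0, E i0 i1, E i0 i2, E i0 i3, 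
  E i1 i1, E i1 i2, E i1 i3, E i2 i2, E i2 i3, E i3 i3); rewrite !mxE /=;
  move=> [ [ [ [ [ [ [ [ [? ?] ?] ?] ?] ?] ?] ?] ?] ?].
Qed.

Lemma dim_rep k : \dim (rep k) = 3.
Proof.
have fr : free [tuple nform k 1 0 0; nform k 0 1 0; nform k 0 0 1].
  apply/freeP => a.
  rewrite !big_ord_recl big_ord0 /= addr0 -nformE => /nform_eq0[a0 b0 c0].
  case=> [ [|[|[|//] ] ] Hi].
  - by rewrite -a0; congr a; apply: val_inj.
  - by rewrite -b0; congr a; apply: val_inj.
  - by rewrite -c0; congr a; apply: val_inj.
by move: fr; rewrite /free => /eqP.
Qed.

Lemma nformC k a b c a' b' c' :
  nform k a b c *m nform k a' b' c' = nform k a' b' c' *m nform k a b c.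
Proof.
by do 14?[case: k => [|k] ]; rewrite !mul_mx4; congr mx4; ring.
Qed.

Lemma nform_tr k a b c : \tr (nform k a b c) = 0.
Proof.
by do 14?[case: k => [|k] ]; rewrite /mxtrace sum4 !mxE /=; ring.
Qed.

Lemma mem_sl n (x : 'M[F]_n) : (x \in sl F n) = (\tr x == 0).
Proof. by rewrite memv_ker lfunE. Qed.

Lemma AbP (U : {vspace 'M[F]_4}) : Ab F 4 U <->
  [/\ forall x, x \in U -> \tr x = 0, \dim U = 3 &
      forall x y, x \in U -> y \in U -> x *m y = y *m x].
Proof.
split=> [ [ [/subvP sU dU] cU]|[sU dU cU] ]; split=> //.
- by move=> x /sU; rewrite mem_sl => /eqP.
- by move=> x y xU yU; apply/eqP; rewrite -subr_eq0; apply/eqP/cU.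
- by split=> //; apply/subvP => x /sU; rewrite mem_sl => ->.
- by move=> x y xU yU; rewrite /= /lie_bracket (cU x) ?subrr.
Qed.

Lemma rep_Ab k : Ab F 4 (rep k).
Proof.
apply/AbP; split=> [x||x y]; first by move=> /mem_rep[a [b [c ->] ] ]; exact: nform_tr.
  exact: dim_rep.
move=> /mem_rep[a [b [c ->] ] ] /mem_rep[a' [b' [c' ->] ] ]; exact: nformC.
Qed.

End NormalForms.

(** * Conjugation action and orbits *)

Section Conjugation.
Variable F : fieldType.

Section General.
Variable n : nat.
Implicit Types (g h x : 'M[F]_n) (U : {vspace 'M[F]_n}).

Lemma mem_conj g U x :
  g \in unitmx -> (x \in conj_act g U) = (invmx g *m x *m g \in U).
Proof.
move=> gu; apply/memv_imgP/idP => [[u uU ->]|xU].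
  by rewrite lfunE /= !mulmxA mulVmx // mul1mx mulmxKV.
exists (invmx g *m x *m g) => //.
by rewrite lfunE /= !mulmxA mulmxV // mul1mx mulmxK.
Qed.

Lemma conj_in g U x : g \in unitmx -> x \in U ->
  g *m x *m invmx g \in conj_act g U.
Proof. by move=> gu xU; rewrite mem_conj // !mulmxA mulVmx // mul1mx mulmxKV. Qed.

Lemma conj_inP g U y : g \in unitmx -> y \in conj_act g U ->
  exists2 x, x \in U & y = g *m x *m invmx g.
Proof.
move=> gu; rewrite mem_conj // => yU; exists (invmx g *m y *m g) => //.
by rewrite !mulmxA mulmxV // mul1mx mulmxK.
Qed.

Lemma invmx_mul g h : g \in unitmx -> h \in unitmx ->
  invmx (g *m h) = invmx h *m invmx g.
Proof.
move=> gu hu; have ghu : g *m h \in unitmx by rewrite unitmx_mul gu.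
rewrite -[RHS](mulmxK ghu) [_ *m (g *m h)]mulmxA (mulmxKV gu).
by rewrite mulVmx // mul1mx.
Qed.

Lemma conj_act_comp g h U : g \in unitmx -> h \in unitmx ->
  conj_act g (conj_act h U) = conj_act (g *m h) U.
Proof.
move=> gu hu; apply/vspaceP => x.
rewrite !mem_conj ?unitmx_mul ?gu // invmx_mul // !mulmxA; congr (_ \in U).
Qed.

Lemma conj_act1 U : conj_act 1%:M U = U.
Proof.
by apply/vspaceP => x; rewrite mem_conj ?unitmx1 // invmx1 mul1mx mulmx1.
Qed.

Lemma conj_actK g U : g \in unitmx -> conj_act (invmx g) (conj_act g U) = U.
Proof.
by move=> gu; rewrite conj_act_comp ?unitmx_inv // mulVmx ?conj_act1.
Qed.

Lemma dim_conj g U : g \in unitmx -> \dim (conj_act g U) = \dim U.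
Proof.
move=> gu; rewrite limg_dim_eq //; apply/eqP; rewrite -subv0.
apply/subvP => x; rewrite memv_cap memv_ker lfunE /= memv0 => /andP[_ /eqP E].
apply/eqP; rewrite -[x](mulKmx gu) -[g *m x](mulmxKV gu) E.
by rewrite mul0mx mulmx0.
Qed.

Lemma pgl_orbit_conj g U : g \in unitmx ->
  pgl_orbit (conj_act g U) = pgl_orbit U.
Proof.
move=> gu; apply/seteqP; split=> _ [h hu ->].
  by exists (h *m g); rewrite ?unitmx_mul ?hu // conj_act_comp.
exists (h *m invmx g); first by rewrite unitmx_mul hu unitmx_inv.
by rewrite -conj_act_comp ?unitmx_inv // conj_actK.
Qed.

Lemma pgl_orbit_refl U : pgl_orbit U U.
Proof. by exists 1%:M; rewrite ?unitmx1 // conj_act1. Qed.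

Lemma pgl_orbitE U U' : pgl_orbit U U' -> pgl_orbit U' = pgl_orbit U.
Proof. by move=> [g gu ->]; exact: pgl_orbit_conj. Qed.

End General.

Lemma Ab_conj g U : g \in unitmx -> Ab F 4 U -> Ab F 4 (conj_act g U).
Proof.
move=> gu /AbP[sU dU cU]; apply/AbP; split; rewrite ?dim_conj //.
  move=> y /(conj_inP gu)[x /sU tx ->].
  by rewrite mxtrace_mulC mulmxA mulVmx // mul1mx.
move=> _ _ /(conj_inP gu)[x xU ->] /(conj_inP gu)[y yU ->].
rewrite !mulmxA mulmxKV // mulmxKV // -!mulmxA; congr (_ *m _).
by rewrite !mulmxA (cU x y).
Qed.

Lemma Ab_orbit_rep k U : pgl_orbit (rep F k) U -> Ab F 4 U.
Proof. by move=> [g gu ->]; apply: Ab_conj => //; exact: rep_Ab. Qed.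

(** Both spaces have dimension 3, so an inclusion into a conjugate of [rep k] is an equality. The
    classification therefore only has to bring all elements of [U] to the shape of [nform k] in one
    basis. *)
Lemma orbit_rep_nform (U : {vspace 'M[F]_4}) k g :
  \dim U = 3 -> g \in unitmx ->
  (forall x, x \in U -> exists a b c, x *m g = g *m nform k a b c) ->
  pgl_orbit (rep F k) U.
Proof.
move=> dU gu Ug; exists g => //; apply/eqP.
rewrite eqEdim dim_conj // dim_rep dU leqnn andbT; apply/subvP => x /Ug.
move=> [a [b [c xg] ] ]; rewrite mem_conj // -mulmxA xg mulKmx //.
exact: nform_in.
Qed.

Lemma cartan_orbit : cartan F 4 = pgl_orbit (rep F 0).
Proof.
have diagP g x : g \in unitmx ->
    (x \in sl F 4) && is_diag_mx (invmx g *m x *m g) =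
    (x \in conj_act g (rep F 0)).
  move=> gu; rewrite mem_conj // mem_sl.
  have -> : \tr x = \tr (invmx g *m x *m g).
    by rewrite mxtrace_mulC mulmxA mulmxV // mul1mx.
  move: (invmx g *m x *m g) => y; apply/andP/idP.
    move=> [/eqP ty /is_diag_mxP dy]; apply/mem_rep.
    exists (y i0 i0), (y i1 i1), (y i2 i2).
    apply: mx4P; rewrite !mxE //=; try exact: dy.
    by apply/esym/subr0_eq; rewrite -oppr0 -ty /mxtrace sum4; ring.
  move=> /mem_rep[a [b [c ->] ] ]; rewrite nform_tr eqxx; split=> //.
  by apply/is_diag_mxP; do 2!apply: ord4P; rewrite ?mxE.
apply/seteqP; split=> U [g gu UE]; exists g => //.
  by apply/vspaceP => x; rewrite UE diagP.
by move=> x; rewrite UE diagP.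
Qed.

End Conjugation.

(** * Rank-one spaces, cyclic nilpotents and spectral projectors *)

Section LinearAlgebra.
Variable F : fieldType.

Lemma unitmx_inj n (g : 'M[F]_n) :
  (forall u : 'cV_n, g *m u = 0 -> u = 0) -> g \in unitmx.
Proof.
move=> ginj; rewrite -unitmx_tr -row_free_unit -kermx_eq0.
apply/eqP/row_matrixP => i; rewrite row0; apply: trmx_inj.
rewrite trmx0; apply: ginj; apply: trmx_inj.
by rewrite trmx_mul trmxK trmx0 -row_mul mulmx_ker row0.
Qed.

Lemma mulmx_nilp_eigen n (A : 'M[F]_n.+1) k (v : 'cV_n.+1) a :
  A ^+ k = 0 -> v != 0 -> A *m v = a *: v -> a = 0.
Proof.
move=> Ak v0 Av.
have Av' j : A ^+ j *m v = a ^+ j *: v.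
  elim: j => [|j IHj]; first by rewrite !expr0 mul1mx scale1r.
  by rewrite exprSr -mulmxE -mulmxA Av -scalemxAr IHj scalerA exprS.
have /esym/eqP := Av' k; rewrite Ak mul0mx scaler_eq0 (negPf v0) orbF.
by rewrite expf_eq0 => /andP[_ /eqP].
Qed.

Lemma unit_first_col n (u : 'cV[F]_n.+1) : u != 0 ->
  exists2 g, g \in unitmx & u = g *m delta_mx 0 0.
Proof.
move=> u0; pose e : 'rV[F]_n.+1 := delta_mx 0 0.
have rke : \rank e = 1 by rewrite mxrank_delta.
have [|g gu gE] := @complete_unitmx _ _ _ e (\matrix_(i, j) u j 0).
  have -> : e *m (\matrix_(i, j) u j 0) = u^T.
    rewrite -rowE; apply/rowP => j; by rewrite !mxE.
  by rewrite rke mxrank_tr; apply/eqP; rewrite eqn_leq rank_leq_col lt0n mxrank_eq0.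
exists g^T; first by rewrite unitmx_tr.
apply: trmx_inj; rewrite trmx_mul trmxK trmx_delta -[RHS]gE -rowE.
by apply/rowP => j; rewrite !mxE.
Qed.

Lemma unit_last_row n (f : 'rV[F]_n.+1) : f != 0 ->
  exists2 g, g \in unitmx & f *m g = delta_mx 0 ord_max.
Proof.
move=> f0; pose e : 'rV[F]_n.+1 := delta_mx 0 ord_max.
have rke : \rank e = 1 by rewrite mxrank_delta.
have [|g gu gE] := @complete_unitmx _ _ _ e (\matrix_(i, j) f 0 j).
  have -> : e *m (\matrix_(i, j) f 0 j) = f.
    by rewrite -rowE; apply/rowP => j; rewrite !mxE.
  by rewrite rke; apply/eqP; rewrite eqn_leq rank_leq_row lt0n mxrank_eq0.
exists (invmx g); first by rewrite unitmx_inv.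
have <- : e *m g = f.
  by rewrite -gE -rowE; apply/rowP => j; rewrite !mxE.
by rewrite mulmxK.
Qed.

Definition lincomb_closed (V : lmodType F) (S : V -> Prop) : Prop :=
  forall a u v, S u -> S v -> S (a *: u + v).

Lemma col_proportional n (u u' : 'cV[F]_n) :
  u != 0 -> (forall i k, u i 0 * u' k 0 = u k 0 * u' i 0) ->
  exists a, u' = a *: u.
Proof.
move=> u0 uu; have [i ui] : exists i, u i 0 != 0.
  apply: contrapT => no; move/eqP: u0; apply; apply/colP => i.
  by rewrite mxE; apply: contrapT => /eqP ui; apply: no; exists i.
exists (u' i 0 / u i 0); apply/colP => k; rewrite mxE.
by rewrite mulrAC [_ * u k 0]mulrC -uu mulrC mulKf.
Qed.

Lemma row_proportional n (f f' : 'rV[F]_n) :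
  f != 0 -> (forall i k, f 0 i * f' 0 k = f 0 k * f' 0 i) ->
  exists a, f' = a *: f.
Proof.
move=> f0 ff; have [||a aE] := @col_proportional _ f^T f'^T.
- by rewrite trmx_eq0.
- by move=> i k; rewrite !mxE.
by exists a; apply: trmx_inj; rewrite aE linearZ.
Qed.

Definition mx_rank1 m n (x : 'M[F]_(m, n)) : Prop :=
  forall i j k l, x i j * x k l = x i l * x k j.

Lemma mx_rank1P m n (x : 'M[F]_(m, n)) :
  mx_rank1 x -> exists u (f : 'rV_n), x = u *m f.
Proof.
move=> rx; have [->|] := eqVneq x 0; first by exists 0, 0; rewrite mul0mx.
move=> x0; have [k [l xkl]] : exists k l, x k l != 0.
  apply: contrapT => no; move/eqP: x0; apply; apply/matrixP => k l.
  by rewrite mxE; apply: contrapT => /eqP xkl; apply: no; exists k, l.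
exists (col l x), ((x k l)^-1 *: row k x); apply/matrixP => i j.
rewrite !mxE big_ord1 !mxE mulrCA -rx mulrCA.
by rewrite mulVf // mulr1.
Qed.

Lemma rank1_minors m n (u : 'cV[F]_m) (f : 'rV_n) i j k l :
  (u *m f) i j * (u *m f) k l = (u *m f) i l * (u *m f) k j.
Proof. by rewrite !mxE !big_ord1; ring. Qed.

(** Each 2 x 2 minor of the sum is a minor of [u, u'] times a minor of [f, f'], and a field has no
    zero divisors. *)
Lemma rank1_sum m n (u u' : 'cV[F]_m) (f f' : 'rV_n) :
  mx_rank1 (u *m f + u' *m f') ->
  (forall i k, u i 0 * u' k 0 = u k 0 * u' i 0) \/
  (forall j l, f 0 j * f' 0 l = f 0 l * f' 0 j).
Proof.
move=> r1; have [|] := pselect (forall i k, u i 0 * u' k 0 = u k 0 * u' i 0).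
  by left.
move=> /existsNP[i /existsNP[k /eqP ik]]; right=> j l; apply/eqP.
have /eqP := r1 i j k l; rewrite !mxE !big_ord1 -subr_eq0.
rewrite (_ : _ - _ = (u i 0 * u' k 0 - u k 0 * u' i 0) *
  (f 0 j * f' 0 l - f 0 l * f' 0 j)); last ring.
by rewrite mulf_eq0 subr_eq0 (negPf ik) /= subr_eq0.
Qed.

(* A linear space of matrices of rank at most one has a common image line or a
   common kernel hyperplane. *)
Lemma rank1_space m n (S : 'M[F]_(m.+1, n.+1) -> Prop) :
  lincomb_closed S -> (forall x, S x -> mx_rank1 x) ->
  (exists2 u : 'cV_m.+1, u != 0 & forall x, S x -> exists f : 'rV_n.+1, x = u *m f) \/
  (exists2 f : 'rV_n.+1, f != 0 & forall x, S x -> exists u : 'cV_m.+1, x = u *m f).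
Proof.
move=> Sl S1.
have [[x0 [Sx0 x00]]|Sz] := pselect (exists x, S x /\ x <> 0); last first.
  left; exists (delta_mx 0 0).
    apply/eqP => /matrixP /(_ 0 0); rewrite !mxE /= => /eqP.
    by rewrite oner_eq0.
  move=> x Sx; exists 0; rewrite mulmx0; apply: contrapT => x0.
  by apply: Sz; exists x.
have [u0 [f0 x0E]] := mx_rank1P (S1 _ Sx0).
have u00 : u0 != 0 by apply: contra_notN x00 => /eqP u0z; rewrite x0E u0z mul0mx.
have f00 : f0 != 0 by apply: contra_notN x00 => /eqP f0z; rewrite x0E f0z mulmx0.
have Sum x y : S x -> S y -> mx_rank1 (x + y).
  by move=> Sx Sy; apply: S1; rewrite -[x]scale1r; exact: Sl.
have [Su|] := pselect (forall x, S x -> exists f : 'rV_n.+1, x = u0 *m f).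
  by left; exists u0.
(* The image of [x1] is not the line of [u0], which forces its form [f1] onto the line of [f0]; any
   further [x] is compared with both [x0] and [x1]. *)
move=> /existsNP[x1 /not_implyP[Sx1 nx1]]; right; exists f0 => //.
have [u1 [f1 x1E]] := mx_rank1P (S1 _ Sx1).
have u01 : ~ (forall i k, u0 i 0 * u1 k 0 = u0 k 0 * u1 i 0).
  move=> /(col_proportional u00)[a u1E]; apply: nx1; exists (a *: f1).
  by rewrite x1E u1E -scalemxAl scalemxAr.
have [a f1E] : exists a, f1 = a *: f0.
  have := Sum _ _ Sx0 Sx1; rewrite x0E x1E => /rank1_sum[//|].
  exact: row_proportional.
move=> x Sx; have [u [f xE]] := mx_rank1P (S1 _ Sx).
have f10 : f1 != 0.
  by apply: contra_notN nx1 => /eqP f1z; exists 0; rewrite x1E f1z !mulmx0.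
have := Sum _ _ Sx0 Sx; rewrite x0E xE => /rank1_sum[]; last first.
  by move=> /(row_proportional f00)[b ->]; exists (b *: u);
    rewrite -scalemxAr scalemxAl.
(* Here [u] is a multiple of [u0]. As [u1] is off the line of [u0], the sum with [x1] puts [f] on
   the line of [f1], which is that of [f0], unless [b] vanishes and [x] is zero. *)
move=> /(col_proportional u00)[b uE].
have := Sum _ _ Sx1 Sx; rewrite x1E xE => /rank1_sum[]; last first.
  move=> /(row_proportional f10)[d ->]; rewrite f1E scalerA.
  by exists ((d * a) *: u); rewrite -scalemxAr scalemxAl.
rewrite uE => u1u; have [->|b0] := eqVneq b 0.
  by exists 0; rewrite scale0r !mul0mx.
exfalso; apply: u01 => i k; apply: (mulfI b0).
by have := u1u k i; rewrite !mxE => E; transitivity (u1 k 0 * (b * u0 i 0));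
  [ring|rewrite E; ring].
Qed.

Definition jordan n : 'M[F]_n.+1 := \matrix_(i, j) (i.+1 == j :> nat)%:R.

(** [v] is a cyclic vector: in the basis [x ^+ n *m v], ..., [v] the matrix [x] is one Jordan block.
    A matrix [y] commuting with [x] is determined by [y *m v], hence equals the polynomial in [x]
    that has the same value at [v]. *)
Lemma nilp_regular n (x : 'M[F]_n.+1) (v : 'cV_n.+1) :
  x ^+ n.+1 = 0 -> x ^+ n *m v <> 0 ->
  exists2 g, g \in unitmx & forall y, x *m y = y *m x ->
    exists u : 'I_n.+1 -> F,
      y *m g = g *m \sum_(j < n.+1) u j *: jordan n ^+ (n - j).
Proof.
move=> xn1 xnv.
have xpow0 k : (n < k)%N -> x ^+ k = 0.
  by move=> /subnK <-; rewrite exprD xn1 mulr0.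
pose g : 'M[F]_n.+1 := \matrix_(i, j) (x ^+ (n - j) *m v) i 0.
have colg j : col j g = x ^+ (n - j) *m v.
  by apply/colP => i; rewrite !mxE.
have gE (u : 'cV_n.+1) : g *m u = \sum_j u j 0 *: (x ^+ (n - j) *m v).
  apply/colP => i; rewrite mxE summxE; apply: eq_bigr => j _.
  by rewrite [RHS]mxE mulrC [g i j]mxE.
have gu : g \in unitmx.
  apply: unitmx_inj => u; rewrite gE => gu0.
  (* Multiplying a relation by [x ^+ j] kills the columns before [j], whose exponent then exceeds
     [n]; the coefficients after [j] vanish by induction on [n - j]. *)
  suff uz k (j : 'I_n.+1) : (n - j < k)%N -> u j 0 = 0.
    apply/colP => j; rewrite mxE; exact: (uz n.+1 j (leq_subr _ _)).
  elim: k j => // k IHk j; rewrite ltnS => jk.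
  apply: contrapT => /eqP uj0; apply: xnv; apply/eqP.
  have := congr1 (mulmx (x ^+ j)) gu0; rewrite mulmx0 mulmx_sumr (bigD1 j) //=.
  rewrite big1 => [|l lj].
    rewrite addr0 -scalemxAr mulmxA mulmxE -exprD subnKC ?leq_ord //.
    by move=> /eqP; rewrite scaler_eq0 (negPf uj0).
  have [lj'|jl] := ltnP l j.
    rewrite -scalemxAr mulmxA mulmxE -exprD xpow0 ?mul0mx ?scaler0 //.
    by rewrite -{1}(subnKC (leq_ord l)) ltn_add2r.
  have {}jl : (j < l)%N by rewrite ltn_neqAle jl eq_sym andbT.
  rewrite IHk ?scale0r ?mulmx0 // (leq_trans _ jk) //.
  by rewrite ltn_sub2l // (leq_trans jl) // -ltnS.
have xg : x *m g = g *m jordan n.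
  apply/matrixP => i j; have -> : (x *m g) i j = (x ^+ (n - j).+1 *m v) i 0.
    rewrite exprS -mulmxE -mulmxA -colg !mxE.
    by apply: eq_bigr => l _; rewrite [in RHS]mxE.
  rewrite [RHS]mxE; case: j => [[|j] jn] /=.
    rewrite subn0 xn1 mul0mx mxE big1 // => l _.
    by rewrite !mxE /= mulr0.
  rewrite (bigD1 (Ordinal (ltnW jn))) //= big1 => [|l lj].
    by rewrite !mxE /= eqxx mulr1 addr0 subnSK.
  rewrite !mxE /= eqSS.
  suff -> : (l == j :> nat) = false by rewrite mulr0.
  by apply/negbTE; apply: contraNneq lj => lj; apply/eqP/val_inj.
have xkg k : x ^+ k *m g = g *m jordan n ^+ k.
  elim: k => [|k IHk]; first by rewrite !expr0 mul1mx mulmx1.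
  by rewrite !exprSr -!mulmxE -mulmxA xg mulmxA IHk mulmxA.
exists g => // y xy.
have xky k : x ^+ k *m y = y *m x ^+ k.
  elim: k => [|k IHk]; first by rewrite !expr0 mul1mx mulmx1.
  by rewrite !exprSr -!mulmxE -mulmxA xy mulmxA IHk mulmxA.
pose u := invmx g *m (y *m v); exists (fun j => u j 0).
pose Y := \sum_(j < n.+1) u j 0 *: x ^+ (n - j).
have Yv : Y *m v = y *m v.
  rewrite -[RHS](mulKVmx gu) gE mulmx_suml; apply: eq_bigr => j _.
  by rewrite scalemxAl.
have xkY k : x ^+ k *m Y = Y *m x ^+ k.
  rewrite mulmx_sumr mulmx_suml; apply: eq_bigr => j _.
  by rewrite -scalemxAr -scalemxAl mulmxE -!exprD addnC.
transitivity (Y *m g).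
  apply/matrixP => i j.
  have colE (A : 'M_n.+1) : (A *m g) i j = (A *m (x ^+ (n - j) *m v)) i 0.
    by rewrite -colg !mxE; apply: eq_bigr => l _; rewrite [in RHS]mxE.
  by rewrite !colE !mulmxA -xky -xkY -!mulmxA Yv.
rewrite mulmx_suml mulmx_sumr; apply: eq_bigr => j _.
by rewrite -scalemxAl xkg scalemxAr.
Qed.

End LinearAlgebra.

(** If the characteristic polynomial is not a power of one linear factor, it is a product of coprime
    factors [('X - a%:P) ^+ m] and [q]. A Bezout relation yields a nontrivial idempotent [e],
    polynomial in [A], and [d] is the diagonal of [e] in a basis that diagonalises it. What commutes
    with [A] commutes with [e], hence respects its eigenspaces. *)
Lemma spectral_split (F : numClosedFieldType) n (A : 'M[F]_n.+1) :
  (exists a, (A - a%:M) ^+ n.+1 = 0 /\ \tr A = a *+ n.+1) \/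
  exists P (d : 'rV[F]_n.+1), [/\ P \in unitmx, exists i j, d 0 i != d 0 j &
    forall B, A *m B = B *m A ->
      forall i j, d 0 i != d 0 j -> (P *m B *m invmx P) i j = 0].
Proof.
have [a ra] : exists a, root (char_poly A) a.
  by apply/closed_rootP; rewrite size_char_poly.
have [m [q]] := multiplicity_XsubC (char_poly A) a.
have chm := char_poly_monic A; rewrite monic_neq0 //= => qa chE.
have qm : q \is monic.
  by rewrite -(monicMr _ (monic_exp m (monicXsubC a))) -chE.
have [sq|sq] := eqVneq (size q) 1%N.
  left; exists a; have q1 : q = 1.
    by move: qm; rewrite [q]size1_polyC ?sq // monicE lead_coefC => /eqP ->.
  have mn : m = n.+1.
    have := size_char_poly A; rewrite chE q1 mul1r size_exp_XsubC.
    by case.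
  rewrite q1 mul1r mn in chE; split.
    have := Cayley_Hamilton A; rewrite chE rmorphXn rmorphB /=.
    by rewrite horner_mx_X horner_mx_C.
  apply: oppr_inj; rewrite -char_poly_trace // chE.
  have -> : a *+ n.+1 = \tr (a%:M : 'M[F]_n.+1) by rewrite mxtrace_scalar.
  rewrite -char_poly_trace // /char_poly /char_poly_mx map_scalar_mx.
  by rewrite -rmorphB /= det_scalar.
right.
have [b rb] : exists b, root q b by apply/closed_rootP.
have cop : coprimep (('X - a%:P) ^+ m) q.
  by apply: coprimep_expl; rewrite coprimep_sym coprimep_XsubC.
have /Bezout_eq1_coprimepP[[u w] /= uw] := cop.
pose e := horner_mx A (w * q).
have eE : 1 - e = horner_mx A (u * ('X - a%:P) ^+ m).
  by rewrite -(rmorph1 (horner_mx A)) -uw rmorphD addrK.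
have ee : e * (1 - e) = 0.
  rewrite eE -rmorphM /=.
  rewrite mulrACA -chE.
  by rewrite rmorphM /= Cayley_Hamilton mulr0.
have eigenv c : root (char_poly A) c -> exists2 v : 'rV[F]_n.+1, v != 0 &
    forall p, v *m horner_mx A p = p.[c] *: v.
  rewrite -eigenvalue_root_char => /eigenvalueP[v vA v0]; exists v => // p.
  elim/poly_ind: p => [|p x IHp].
    by rewrite rmorph0 mulmx0 horner0 scale0r.
  rewrite rmorphD rmorphM /= horner_mx_X horner_mx_C mulmxDr -mulmxE mulmxA IHp.
  by rewrite -scalemxAl vA mul_mx_scalar scalerA -scalerDl hornerMXaddC.
(* An eigenvector for a root of [q] is killed by [e], and one for [a] is killed by [1 - e]; hence
   [e] is neither 1 nor 0. *)
have e1 : e != 1.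
  have [|v v0 vE] := eigenv b; first by rewrite chE rootM rb.
  apply: contraNneq v0 => e1; rewrite -[v]mulmx1 -[1%:M]/(1 : 'M_n.+1) -e1 vE.
  by rewrite hornerM (rootP rb) mulr0 scale0r.
have e0 : e != 0.
  have [v v0 vE] := eigenv _ ra.
  apply: contraNneq v0 => e0; rewrite -[v]mulmx1 -[1%:M]/(1 : 'M_n.+1).
  have -> : 1 = 1 - e by rewrite e0 subr0.
  rewrite eE vE hornerM horner_exp !hornerE subrr.
  have m0 : m != 0%N.
    by apply: contraNneq qa => m0; move: ra; rewrite chE m0 expr0 mulr1.
  by rewrite expr0n (negPf m0) mulr0 scale0r.
have /diagonalizableP : exists2 rs, uniq rs &
    mxminpoly e %| \prod_(x <- rs) ('X - x%:P).
  exists [:: 0; 1]; first by rewrite /= inE eq_sym oner_eq0.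
  apply: mxminpoly_min; rewrite !big_cons big_nil mulr1 rmorphM !rmorphB /=.
  rewrite horner_mx_X !horner_mx_C; apply: oppr_inj.
  by rewrite -mulrN opprB oppr0 raddf0 subr0.
move=> [P Pu /diagonalizable_forPex[d /(simmxP Pu) Pe] ].
have eP : e = invmx P *m diag_mx d *m P by rewrite -mulmxA -Pe mulKmx.
exists P, d; split=> //.
  apply: contrapT => dconst.
  have dE : diag_mx d = (d 0 0)%:M.
    apply/matrixP => i j; rewrite !mxE; congr (_ *+ _).
    by apply: contrapT => /eqP dij; apply: dconst; exists i, 0.
  have eE' : e = (d 0 0)%:M.
    by rewrite eP dE scalar_mxC mulmxKV.
  move: (d 0 0) eE' => t eE'.
  have : (t * (1 - t)) *: (1%:M : 'M[F]_n.+1) = 0.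
    rewrite -[RHS]ee eE' -[1 in RHS]/(1%:M : 'M[F]_n.+1) -raddfB /=.
    by rewrite -mulmxE -scalar_mxM scalemx1.
  move=> /eqP; rewrite scaler_eq0 oner_eq0 orbF mulf_eq0 subr_eq0.
  case/orP => /eqP tE; first by move: e0; rewrite eE' tE raddf0 eqxx.
  by move: e1; rewrite eE' -tE eqxx.
move=> B AB i j dij; pose C := P *m B *m invmx P.
have eB : e *m B = B *m e by exact: comm_horner_mx.
have : C *m diag_mx d = diag_mx d *m C.
  have -> : diag_mx d = P *m e *m invmx P by rewrite Pe mulmxK.
  by rewrite /C !mulmxA !mulmxKV // -[P *m B *m e]mulmxA -eB mulmxA.
move=> /matrixP /(_ i j); rewrite mul_mx_diag mul_diag_mx !mxE mulrC.
by move=> /eqP; rewrite -subr_eq0 -mulrBl mulf_eq0 subr_eq0 eq_sym (negPf dij);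
  move=> /eqP.
Qed.

(** * Block matrices and square-zero families *)

Notation j0 := (@Ordinal 3 0 isT).
Notation j1 := (@Ordinal 3 1 isT).
Notation j2 := (@Ordinal 3 2 isT).
Notation k0 := (@Ordinal 2 0 isT).
Notation k1 := (@Ordinal 2 1 isT).

Section SmallMatrices.
Variable F : fieldType.

Lemma ord3P (P : 'I_3 -> Prop) : P j0 -> P j1 -> P j2 -> forall i, P i.
Proof.
move=> P0 P1 P2 [[|[|[|//] ] ] Hi].
- by rewrite (_ : Ordinal Hi = j0) //; apply: val_inj.
- by rewrite (_ : Ordinal Hi = j1) //; apply: val_inj.
- by rewrite (_ : Ordinal Hi = j2) //; apply: val_inj.
Qed.

Lemma ord2P (P : 'I_2 -> Prop) : P k0 -> P k1 -> forall i, P i.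
Proof.
move=> P0 P1 [[|[|//] ] Hi].
- by rewrite (_ : Ordinal Hi = k0) //; apply: val_inj.
- by rewrite (_ : Ordinal Hi = k1) //; apply: val_inj.
Qed.

Lemma sum3 (V : nmodType) (f : 'I_3 -> V) : \sum_i f i = f j0 + f j1 + f j2.
Proof.
rewrite !big_ord_recl big_ord0 addr0 !addrA.
by congr (f _ + f _ + f _); apply: val_inj.
Qed.

Lemma sum2 (V : nmodType) (f : 'I_2 -> V) : \sum_i f i = f k0 + f k1.
Proof.
rewrite !big_ord_recl big_ord0 addr0.
by congr (f _ + f _); apply: val_inj.
Qed.

Definition mx2 (a b c d : F) : 'M[F]_2 :=
  \matrix_(i, j) nth 0 (nth [::] [:: [:: a; b]; [:: c; d]] i) j.

Definition mx3 (a00 a01 a02 a10 a11 a12 a20 a21 a22 : F) : 'M[F]_3 :=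
  \matrix_(i, j) nth 0 (nth [::]
    [:: [:: a00; a01; a02]; [:: a10; a11; a12]; [:: a20; a21; a22]] i) j.

Lemma mx2P (A B : 'M[F]_2) : A k0 k0 = B k0 k0 -> A k0 k1 = B k0 k1 ->
  A k1 k0 = B k1 k0 -> A k1 k1 = B k1 k1 -> A = B.
Proof. by move=> *; apply/matrixP; do 2!apply: ord2P. Qed.

Lemma mx3P (A B : 'M[F]_3) : A j0 j0 = B j0 j0 -> A j0 j1 = B j0 j1 ->
  A j0 j2 = B j0 j2 -> A j1 j0 = B j1 j0 -> A j1 j1 = B j1 j1 ->
  A j1 j2 = B j1 j2 -> A j2 j0 = B j2 j0 -> A j2 j1 = B j2 j1 ->
  A j2 j2 = B j2 j2 -> A = B.
Proof. by move=> *; apply/matrixP; do 2!apply: ord3P. Qed.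

Definition emb21 (Q : 'M[F]_2) t : 'M[F]_3 :=
  mx3 (Q k0 k0) (Q k0 k1) 0 (Q k1 k0) (Q k1 k1) 0 0 0 t.

Definition emb31 (B : 'M[F]_3) t : 'M[F]_4 :=
  mx4 (B j0 j0) (B j0 j1) (B j0 j2) 0 (B j1 j0) (B j1 j1) (B j1 j2) 0
      (B j2 j0) (B j2 j1) (B j2 j2) 0 0 0 0 t.

Definition emb22 (P Q : 'M[F]_2) : 'M[F]_4 :=
  mx4 (P k0 k0) (P k0 k1) 0 0 (P k1 k0) (P k1 k1) 0 0
      0 0 (Q k0 k0) (Q k0 k1) 0 0 (Q k1 k0) (Q k1 k1).

Lemma emb21M Q t Q' t' :
  emb21 Q t *m emb21 Q' t' = emb21 (Q *m Q') (t * t').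
Proof. by apply: mx3P; rewrite !mxE sum3 ?sum2 !mxE /=; ring. Qed.

Lemma emb31M B t B' t' :
  emb31 B t *m emb31 B' t' = emb31 (B *m B') (t * t').
Proof. by rewrite mul_mx4; congr mx4; rewrite ?mxE ?sum3; ring. Qed.

Lemma emb22M P Q P' Q' :
  emb22 P Q *m emb22 P' Q' = emb22 (P *m P') (Q *m Q').
Proof. by rewrite mul_mx4; congr mx4; rewrite ?mxE ?sum2; ring. Qed.

Lemma emb21_unit h : h \in unitmx -> emb21 h 1 \in unitmx.
Proof.
move=> hu; have : emb21 h 1 *m emb21 (invmx h) 1 = 1%:M.
  by rewrite emb21M mulmxV // mulr1; apply: mx3P; rewrite !mxE.
by case/mulmx1_unit.
Qed.

Lemma emb31_unit h : h \in unitmx -> emb31 h 1 \in unitmx.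
Proof.
move=> hu; apply: (@mx4_unit _ _ (emb31 (invmx h) 1)).
by rewrite emb31M mulmxV // mulr1; apply: mx4P; rewrite !mxE.
Qed.

Lemma emb22_unit h h' : h \in unitmx -> h' \in unitmx -> emb22 h h' \in unitmx.
Proof.
move=> hu hu'; apply: (@mx4_unit _ _ (emb22 (invmx h) (invmx h'))).
by rewrite emb22M !mulmxV //; apply: mx4P; rewrite !mxE.
Qed.

Lemma emb21_inj Q t Q' t' : emb21 Q t = emb21 Q' t' -> Q = Q'.
Proof.
move=> /matrixP E; have := (E j0 j0, E j0 j1, E j1 j0, E j1 j1).
by rewrite !mxE /= => [ [ [ [? ?] ?] ?] ]; apply: mx2P.
Qed.

Lemma emb31_inj B t B' t' : emb31 B t = emb31 B' t' -> B = B'.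
Proof.
move=> /matrixP E; have := (E i0 i0, E i0 i1, E i0 i2, E i1 i0, E i1 i1, E i1 i2,
  E i2 i0, E i2 i1, E i2 i2).
by rewrite !mxE /= => [ [ [ [ [ [ [ [ [? ?] ?] ?] ?] ?] ?] ?] ?] ]; apply: mx3P.
Qed.

Lemma emb22_inj P Q P' Q' : emb22 P Q = emb22 P' Q' -> P = P' /\ Q = Q'.
Proof.
move=> /matrixP E; have := (E i0 i0, E i0 i1, E i1 i0, E i1 i1,
  E i2 i2, E i2 i3, E i3 i2, E i3 i3).
by rewrite !mxE /= => [ [ [ [ [ [ [ [? ?] ?] ?] ?] ?] ?] ?] ];
  split; apply: mx2P.
Qed.

Lemma conj_perm_mx n (P B : 'M[F]_n) (s : 'S_n) i j : P \in unitmx ->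
  (perm_mx s *m P *m B *m invmx (perm_mx s *m P)) i j =
  (P *m B *m invmx P) (s i) (s j).
Proof.
move=> Pu; have ss : perm_mx s *m perm_mx s^-1 = 1%:M :> 'M[F]_n.
  by rewrite -perm_mxM mulgV perm_mx1.
have [su _] := mulmx1_unit ss.
have sV : invmx (perm_mx s) = perm_mx s^-1 :> 'M[F]_n.
  by rewrite -[RHS](mulKmx su) ss mulmx1.
rewrite invmx_mul // sV !mulmxA -[_ *m perm_mx s^-1]col_permE -!mulmxA.
by rewrite -row_permE !mxE.
Qed.

Lemma mx_neq0_col m n (A : 'M[F]_(m, n)) : A <> 0 -> exists j, col j A <> 0.
Proof.
move=> A0; apply: contrapT => no; apply: A0; apply/matrixP => i j.
have /colP /(_ i) : col j A = 0 by apply: contrapT => Aj; apply: no; exists j.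
by rewrite !mxE.
Qed.

(** The square of [x = u *m f] is the scalar [f *m u] times [x], so a nonzero [x] of square zero has
    [f] vanishing on [u]; in a basis starting with [u] this is the first entry of [f]. *)
Lemma sq0_common_image n (S : 'M[F]_n.+1 -> Prop) (u : 'cV_n.+1) :
  u != 0 -> (forall x, S x -> exists f : 'rV_n.+1, x = u *m f) ->
  (forall x, S x -> x *m x = 0) ->
  exists2 g, g \in unitmx & forall x, S x -> exists2 f : 'rV_n.+1,
    f 0 0 = 0 & x *m g = g *m (delta_mx 0 0 *m f).
Proof.
move=> u0 Su S0; have [g gu uE] := unit_first_col u0; exists g => // x Sx.
have [f xE] := Su x Sx; have [x0|x0] := pselect (x = 0).
  by exists 0; rewrite ?mxE // !mulmx0 x0 mul0mx.
exists (f *m g); last by rewrite mulmxA -uE mulmxA xE.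
have : u *m (f *m u) *m f = 0 by rewrite -(S0 x Sx) xE !mulmxA.
rewrite [f *m u]mx11_scalar mul_mx_scalar -scalemxAl -xE => /eqP.
rewrite scaler_eq0 => /orP[/eqP fu|/eqP//].
rewrite -[RHS]fu uE mulmxA [RHS]mxE (bigD1 0) //= big1 => [|i i0'].
  by rewrite [delta_mx _ _ _ _]mxE /= mulr1 addr0.
by rewrite [delta_mx _ _ _ _]mxE (negPf i0') mulr0.
Qed.

Lemma sq0_common_kernel n (S : 'M[F]_n.+1 -> Prop) (f : 'rV_n.+1) :
  f != 0 -> (forall x, S x -> exists u : 'cV_n.+1, x = u *m f) ->
  (forall x, S x -> x *m x = 0) ->
  exists2 g, g \in unitmx & forall x, S x -> exists2 u : 'cV_n.+1,
    u ord_max 0 = 0 & x *m g = g *m (u *m delta_mx 0 ord_max).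
Proof.
move=> f0 Sf S0; have [g gu fE] := unit_last_row f0; exists g => // x Sx.
have [u xE] := Sf x Sx; have [x0|x0] := pselect (x = 0).
  by exists 0; rewrite ?mxE // mul0mx mulmx0 x0 mul0mx.
exists (invmx g *m u); last by rewrite mulmxA mulKVmx // -fE mulmxA xE.
have : u *m (f *m u) *m f = 0 by rewrite -(S0 x Sx) xE !mulmxA.
rewrite [f *m u]mx11_scalar mul_mx_scalar -scalemxAl -xE => /eqP.
rewrite scaler_eq0 => /orP[/eqP fu|/eqP//].
have fuE : f *m u = delta_mx 0 ord_max *m (invmx g *m u).
  by rewrite -fE -mulmxA mulKVmx.
rewrite -[RHS]fu fuE [RHS]mxE.
rewrite (bigD1 ord_max) //= big1 => [|i im].
  by rewrite [delta_mx _ _ _ _]mxE !eqxx /= mul1r addr0.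
by rewrite [delta_mx _ _ _ _]mxE (negPf im) mul0r.
Qed.

End SmallMatrices.

(** * Commuting families of 2 x 2 and 3 x 3 matrices *)

Section CommutingFamilies.
Variable F : numClosedFieldType.

(** A member with two eigenvalues diagonalises the family. Otherwise a non-scalar member differs
    from a scalar by a nilpotent of maximal index, and everything is polynomial in it. *)
Lemma commuting2 (S : 'M[F]_2 -> Prop) :
  (forall A B, S A -> S B -> A *m B = B *m A) ->
  exists2 h, h \in unitmx &
    (forall A, S A -> exists a b, A *m h = h *m mx2 a 0 0 b) \/
    (forall A, S A -> exists a b, A *m h = h *m mx2 a b 0 a).
Proof.
move=> Sc.
have [[A [SA [P [d [Pu [i [j dij] Pd] ] ] ] ] ]|nosplit] := pselect (exists A,
    S A /\ exists P (d : 'rV[F]_2), [/\ P \in unitmx, exists i j, d 0 i != d 0 j &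
    forall B, A *m B = B *m A ->
      forall i j, d 0 i != d 0 j -> (P *m B *m invmx P) i j = 0]).
  have d01 : d 0 k0 != d 0 k1.
    by move: i j dij; do 2!apply: ord2P; rewrite ?eqxx // eq_sym.
  exists (invmx P); rewrite ?unitmx_inv //; left=> B SB.
  set C := P *m B *m invmx P; exists (C k0 k0), (C k1 k1).
  transitivity (invmx P *m C); first by rewrite !mulmxA mulVmx // mul1mx.
  by congr (_ *m _); apply: mx2P; rewrite [RHS]mxE //=; apply: Pd;
    rewrite ?(Sc A B) // eq_sym.
have nil A : S A -> exists a, (A - a%:M) ^+ 2 = 0.
  move=> SA; have [[a [Aa _] ]|sp] := spectral_split A; first by exists a.
  by case: nosplit; exists A.
have [[A [a [SA Aa A0] ] ]|sc] := pselect (exists A a,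
    [/\ S A, (A - a%:M) ^+ 2 = 0 & A - a%:M <> 0]); last first.
  exists 1%:M; rewrite ?unitmx1 //; left=> A SA; have [a Aa] := nil A SA.
  exists a, a; rewrite mulmx1 mul1mx.
  have -> : A = a%:M.
    apply/eqP; rewrite -subr_eq0; apply/eqP; apply: contrapT => A0.
    by apply: sc; exists A, a.
  by apply: mx2P; rewrite !mxE.
have [j /eqP Aj] := mx_neq0_col A0; move: Aj; rewrite colE => /eqP Aj.
have [h hu hA] := nilp_regular Aa Aj.
exists h => //; right=> B SB.
have [|u ->] := hA B; first by rewrite mulmxBl mulmxBr (Sc A B) // scalar_mxC.
exists (u k1), (u k0); congr (_ *m _); rewrite sum2 /= subn0 subnn expr1 expr0.
by apply: mx2P; rewrite !mxE /=; ring.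
Qed.

(** Numbered like [nform], of which these are the upper left blocks for 0, 1, 3, 4 and 5; form 2
    splits as 2 + 2 instead. *)
Definition nform3 k (a b c : F) : 'M[F]_3 :=
  match k with
  | 0 => mx3 a 0 0 0 b 0 0 0 c
  | 1 => mx3 a b 0 0 a 0 0 0 c
  | 3 => mx3 a b c 0 a b 0 0 a
  | 4 => mx3 a b c 0 a 0 0 0 a
  | _ => mx3 a 0 b 0 a c 0 0 a
  end.

(** A member with two eigenvalues reduces the family to [commuting2]. Otherwise the traceless parts
    are nilpotent: if one of them has nonzero square it is regular, and if all squares vanish the
    ranks are at most one and [rank1_space] applies. *)
Lemma commuting3 (S : 'M[F]_3 -> Prop) : lincomb_closed S ->
  (forall A B, S A -> S B -> A *m B = B *m A) ->
  exists h k, [/\ h \in unitmx, k \in [:: 0; 1; 3; 4; 5]%N &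
    forall A, S A -> exists a b c, A *m h = h *m nform3 k a b c].
Proof.
move=> Sl Sc.
have [[A [SA [P [d [Pu [i [j dij] Pd] ] ] ] ] ]|nosplit] := pselect (exists A,
    S A /\ exists P (d : 'rV[F]_3), [/\ P \in unitmx, exists i j, d 0 i != d 0 j &
    forall B, A *m B = B *m A ->
      forall i j, d 0 i != d 0 j -> (P *m B *m invmx P) i j = 0]).
  (* A non-constant colouring of three points has a point whose colour occurs once; this point is
     then moved to the last place. *)
  have [l lP] : exists l, forall i, i != l -> d 0 i != d 0 l.
    have [d01|d01] := eqVneq (d 0 j0) (d 0 j1).
      have d02 : d 0 j0 != d 0 j2.
        by move: i j dij; do 2!apply: ord3P; rewrite -?d01 ?eqxx // eq_sym.
      by exists j2; apply: ord3P; rewrite // -d01.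
    have [d02|d02] := eqVneq (d 0 j0) (d 0 j2).
      by exists j1; apply: ord3P; rewrite // -d02.
    by exists j0; apply: ord3P => // _; rewrite eq_sym.
  pose s := tperm l j2; pose P' := perm_mx s *m P.
  have P'u : P' \in unitmx by rewrite unitmx_mul Pu andbT unitmx_perm.
  have P'd B : S B -> forall i, i != j2 ->
      (P' *m B *m invmx P') i j2 = 0 /\ (P' *m B *m invmx P') j2 i = 0.
    move=> SB i' i'2; rewrite !conj_perm_mx // tpermR.
    have sl : s i' != l by rewrite -[X in _ != X](tpermR l j2) (inj_eq perm_inj).
    by split; apply: Pd; rewrite ?(Sc A B) ?lP // eq_sym lP.
  clearbody P'.
  have split21 B : S B -> exists Q t, B *m invmx P' = invmx P' *m emb21 Q t.
    move=> SB; set C := P' *m B *m invmx P'.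
    exists (mx2 (C j0 j0) (C j0 j1) (C j1 j0) (C j1 j1)), (C j2 j2).
    transitivity (invmx P' *m C); first by rewrite !mulmxA mulVmx // mul1mx.
    by congr (_ *m _); apply: mx3P; rewrite [RHS]mxE /= ?[mx2 _ _ _ _ _ _]mxE //;
      by have [] := P'd B SB _ (isT : j0 != j2);
         have [] := P'd B SB _ (isT : j1 != j2).
  have [|h hu hS] := @commuting2 (fun Q => exists B t,
      S B /\ B *m invmx P' = invmx P' *m emb21 Q t).
    move=> Q Q' [B [t [SB BQ] ] ] [B' [t' [SB' BQ'] ] ].
    apply: (@emb21_inj _ _ (t * t') _ (t' * t)); rewrite -!emb21M.
    have P'V : invmx P' \in unitmx by rewrite unitmx_inv.
    rewrite -[LHS](mulKmx P'V) -[RHS](mulKmx P'V); congr (_ *m _).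
    by rewrite !mulmxA -BQ -BQ' -!mulmxA -BQ -BQ' !mulmxA (Sc B B').
  have h'u : invmx P' *m emb21 h 1 \in unitmx.
    by rewrite unitmx_mul unitmx_inv P'u emb21_unit.
  have hE N Q t B : B *m invmx P' = invmx P' *m emb21 Q t -> Q *m h = h *m N ->
      B *m (invmx P' *m emb21 h 1) = invmx P' *m emb21 h 1 *m emb21 N t.
    move=> BQ QN; rewrite mulmxA BQ -!mulmxA !emb21M QN mulr1 mul1r.
    by [].
  exists (invmx P' *m emb21 h 1); case: hS => hS; [exists 0%N|exists 1%N];
    split=> // B SB; have [Q [t BQ] ] := split21 B SB;
    have [a [b Qh] ] := hS Q (ex_intro _ B (ex_intro _ t (conj SB BQ)));
    exists a, b, t; rewrite (hE _ _ _ _ BQ Qh); congr (_ *m _);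
    by apply: mx3P; rewrite !mxE.
have nil A : S A -> (A - (\tr A / 3%:R)%:M) ^+ 3 = 0.
  move=> SA; have [[a [Aa tA] ]|sp] := spectral_split A.
    by rewrite tA -[a *+ 3]mulr_natr mulfK // pnatr_eq0.
  by case: nosplit; exists A.
pose N (A : 'M[F]_3) := A - (\tr A / 3%:R)%:M.
have NE A : A = (\tr A / 3%:R)%:M + N A by rewrite addrC subrK.
have Nc A B : S A -> S B -> N A *m N B = N B *m N A.
  have sc a (x : 'M[F]_3) : GRing.comm x a%:M by exact: scalar_mxC.
  move=> SA SB; apply: commrB; last exact: sc.
  apply/commr_sym/commrB; [exact: Sc | exact: sc].
have [[A [SA A2] ]|sq0] := pselect (exists A, S A /\ N A *m N A <> 0).
  have [j /eqP Aj] := mx_neq0_col A2; move: Aj; rewrite colE => /eqP Aj.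
  have [h hu hA] := nilp_regular (nil A SA) Aj.
  exists h, 3%N; split=> // B SB; have [|u uE] := hA B.
    by rewrite mulmxBl mulmxBr (Sc A B) // scalar_mxC.
  exists (u j2), (u j1), (u j0); rewrite uE; congr (_ *m _).
  rewrite sum3 /= subn0 subnn (_ : 2 - 1 = 1)%N // expr1 expr0 expr2 -mulmxE.
  by apply: mx3P; rewrite ?mxE ?sum3 ?mxE ?sum3 ?mxE /=; ring.
have {}sq0 A : S A -> N A *m N A = 0.
  by move=> SA; apply: contrapT => A2; apply: sq0; exists A.
pose S' x := exists2 A, S A & x = N A.
have S'sq x : S' x -> x *m x = 0 by move=> [A /sq0 A0 ->].
have S'l : lincomb_closed S'.
  move=> a _ _ [A SA ->] [B SB ->]; exists (a *: A + B); first exact: Sl.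
  rewrite /N mxtraceD mxtraceZ scalerBr scale_scalar_mx mulrDl raddfD /=.
  by rewrite mulrA opprD addrACA.
have S'1 x : S' x -> mx_rank1 x.
  move=> /S'sq x2 i j k l.
  (* Square zero bounds twice the rank by 3. *)
  have : (\rank x <= 1)%N.
    have := mulmx0_rank_max x2; rewrite addnn -[3%N]/(1.*2.+1).
    by case: (\rank x) => [|[|r] ] //; rewrite !doubleS !ltnS.
  move: (col_base x) (row_base x) (mulmx_base x).
  case: (\rank x) => [|[|//] ] C R <- _; last exact: rank1_minors.
  by rewrite (flatmx0 R) mulmx0 !mxE.
have [[u u0 Su]|[f f0 Sf] ] := rank1_space S'l S'1.
  have [h hu hS] := sq0_common_image u0 Su S'sq.
  exists h, 4%N; split=> // A SA.
  have [|f f0 Ah] := hS (N A); first by exists A.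
  exists (\tr A / 3%:R), (f 0 j1), (f 0 j2).
  rewrite {1}[A]NE mulmxDl Ah -scalar_mxC -mulmxDr; congr (_ *m _).
  have fj0 : f 0 j0 = 0 by rewrite -[RHS]f0; congr (f _ _); exact: val_inj.
  by apply: mx3P; rewrite !mxE ?big_ord1 ?mxE /= ?fj0; ring.
have [h hu hS] := sq0_common_kernel f0 Sf S'sq.
exists h, 5%N; split=> // A SA.
have [|u u0 Ah] := hS (N A); first by exists A.
exists (\tr A / 3%:R), (u j0 0), (u j1 0).
rewrite {1}[A]NE mulmxDl Ah -scalar_mxC -mulmxDr; congr (_ *m _).
have uj2 : u j2 0 = 0 by rewrite -[RHS]u0; congr (u _ _); exact: val_inj.
by apply: mx3P; rewrite !mxE ?big_ord1 ?mxE /= ?uj2; ring.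
Qed.

End CommutingFamilies.

(** * Subalgebras containing an element with two eigenvalues *)

Section SplitCase.
Variable F : numClosedFieldType.

(** [d] colours the vectors of a basis in which all of [U] is block diagonal along the colour
    classes. *)
Definition split_family n (U : {vspace 'M[F]_n}) : Prop :=
  exists P (d : 'rV[F]_n), [/\ P \in unitmx, exists i j, d 0 i != d 0 j &
    forall B, B \in U -> forall i j, d 0 i != d 0 j ->
      (P *m B *m invmx P) i j = 0].

Lemma split_family_perm n (U : {vspace 'M[F]_n}) P (d : 'rV[F]_n) (s : 'S_n) :
  P \in unitmx ->
  (forall B, B \in U -> forall i j, d 0 i != d 0 j ->
      (P *m B *m invmx P) i j = 0) ->
  exists2 g, g \in unitmx & forall B, B \in U -> exists C : 'M_n,
    B *m g = g *m C /\ forall i j, d 0 (s i) != d 0 (s j) -> C i j = 0.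
Proof.
move=> Pu Pd; pose Q := perm_mx s *m P.
have Qu : Q \in unitmx by rewrite unitmx_mul Pu andbT unitmx_perm.
exists (invmx Q); rewrite ?unitmx_inv // => B BU.
exists (Q *m B *m invmx Q); split.
  by clearbody Q; rewrite -!mulmxA mulKmx.
by move=> i j dij; rewrite conj_perm_mx // Pd.
Qed.

(** If no colour occurs exactly once, four points in at least two colours form two pairs, and [s]
    puts the pair of [i0] first. The two outcomes are the splittings 3 + 1 and 2 + 2. *)
Lemma color4 (d : 'I_4 -> F) : (exists i j, d i != d j) ->
  (exists l, forall i, i != l -> d i != d l) \/
  exists s : 'S_4, [/\ d (s i0) != d (s i2), d (s i0) != d (s i3),
    d (s i1) != d (s i2) & d (s i1) != d (s i3)].
Proof.
move=> [i [j dij] ].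
have [|noiso] := pselect (exists l, forall i, i != l -> d i != d l); first by left.
right; have /existsNP[l /not_implyP[l0 /negP] ] :
    ~ forall i, i != i0 -> d i != d i0 by move=> iso; apply: noiso; exists i0.
rewrite negbK => /eqP dl.
have enum4 : forall l m k k' : 'I_4, l != i0 -> m != i0 -> m != l ->
    d l = d i0 -> d m = d i0 -> d k <> d i0 -> k' != k -> d k' = d i0.
  by do 4!apply: ord4P => //; move=> *; congruence.
have dm m : m != i0 -> m != l -> d m != d i0.
  move=> m0 ml; apply/eqP => dm.
  have dconst k : d k = d i0.
    apply: contrapT => dk; apply: noiso; exists k => k' k'k.
    by rewrite (enum4 l m k k') //; apply/eqP => /esym.
  by move: dij; rewrite !dconst eqxx.
pose s := tperm l i1; exists s.
have s0 : s i0 = i0 by rewrite tpermD // eq_sym.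
have s1 : s i1 = l by rewrite tpermR.
rewrite s0 s1 dl.
have sm k : k != i0 -> k != i1 -> d i0 != d (s k).
  move=> k0 k1; rewrite eq_sym; apply: dm.
    by rewrite -[X in _ != X]s0 (inj_eq perm_inj).
  by rewrite -[X in _ != X]s1 (inj_eq perm_inj).
by split; apply: sm.
Qed.

Lemma orbit_of_split (U : {vspace 'M[F]_4}) : Ab F 4 U -> split_family U ->
  exists2 k, (k < 14)%N & pgl_orbit (rep F k) U.
Proof.
move=> /AbP[tU dU cU] [P [d [Pu dd Pd] ] ].
have tr_conj x g M : x \in U -> g \in unitmx -> x *m g = g *m M -> \tr M = 0.
  move=> xU gu xg; rewrite -(tU x xU) -[x](mulmxK gu) xg.
  by rewrite mxtrace_mulC mulmxA mulVmx // mul1mx.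
have [[l lP]|[s [s02 s03 s12 s13] ] ] := color4 dd.
  have [g gu gU] := split_family_perm (tperm l i3) Pu Pd.
  have {}gU x : x \in U -> exists B t, x *m g = g *m emb31 B t.
    move=> xU; have [C [xg C0] ] := gU x xU.
    have Cz i : i != i3 -> C i i3 = 0 /\ C i3 i = 0.
      move=> ii3; have sl : tperm l i3 i != l.
        by rewrite -[X in _ != X](tpermR l i3) (inj_eq perm_inj).
      by split; apply: C0; rewrite tpermR ?lP // eq_sym lP.
    exists (mx3 (C i0 i0) (C i0 i1) (C i0 i2) (C i1 i0) (C i1 i1) (C i1 i2)
                (C i2 i0) (C i2 i1) (C i2 i2)), (C i3 i3).
    rewrite xg; congr (_ *m _); apply: mx4P;
      rewrite [RHS]mxE /= ?[mx3 _ _ _ _ _ _ _ _ _ _ _]mxE //;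
      by have [] := Cz _ (isT : i0 != i3); have [] := Cz _ (isT : i1 != i3);
         have [] := Cz _ (isT : i2 != i3).
  pose S B := exists x t, x \in U /\ x *m g = g *m emb31 B t.
  have Sl : lincomb_closed S.
    move=> a B B' [x [t [xU xB] ] ] [x' [t' [xU' xB'] ] ].
    exists (a *: x + x'), (a * t + t'); split; first by rewrite memvD ?memvZ.
    rewrite mulmxDl -scalemxAl xB xB' scalemxAr -mulmxDr mx4_lin.
    by congr (_ *m _); congr mx4; rewrite ?mxE; ring.
  have Sc B B' : S B -> S B' -> B *m B' = B' *m B.
    move=> [x [t [xU xB] ] ] [x' [t' [xU' xB'] ] ].
    apply: (@emb31_inj _ _ (t * t') _ (t' * t)); rewrite -!emb31M.
    rewrite -[LHS](mulKmx gu) -[RHS](mulKmx gu); congr (_ *m _).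
    by rewrite !mulmxA -xB -xB' -!mulmxA -xB -xB' !mulmxA (cU x x').
  have [h [k [hu kk hS] ] ] := commuting3 Sl Sc.
  have g'u : g *m emb31 h 1 \in unitmx by rewrite unitmx_mul gu emb31_unit.
  exists k; first by move: kk; rewrite !inE; do !case/predU1P=> [->//|]; move=> /eqP ->.
  apply: (orbit_rep_nform dU g'u) => x xU.
  have [B [t xB] ] := gU x xU; have [|a [b [c Bh] ] ] := hS B; first by exists x, t.
  exists a, b, c.
  have xg' : x *m (g *m emb31 h 1) = g *m emb31 h 1 *m emb31 (nform3 k a b c) t.
    by rewrite mulmxA xB -!mulmxA !emb31M Bh mulr1 mul1r.
  rewrite xg'; congr (_ *m _).
  have := tr_conj _ _ _ xU g'u xg'; rewrite /mxtrace sum4 !mxE /= => tr0.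
  have {tr0}tE : t = - (nform3 k a b c j0 j0 + nform3 k a b c j1 j1
      + nform3 k a b c j2 j2).
    by apply/eqP; rewrite -addr_eq0 addrC tr0.
  move: kk; rewrite tE !inE; do !case/predU1P=> [->|]; last move=> /eqP ->;
    by apply: mx4P; rewrite !mxE /= ?mxE //=; ring.
have [g gu gU] := split_family_perm s Pu Pd.
have {}gU x : x \in U -> exists Q R, x *m g = g *m emb22 Q R.
  move=> xU; have [C [xg C0] ] := gU x xU.
  exists (mx2 (C i0 i0) (C i0 i1) (C i1 i0) (C i1 i1)),
         (mx2 (C i2 i2) (C i2 i3) (C i3 i2) (C i3 i3)).
  rewrite xg; congr (_ *m _); apply: mx4P;
    rewrite [RHS]mxE /= ?[mx2 _ _ _ _ _ _]mxE //; apply: C0;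
    by rewrite // eq_sym.
have Sc x Q R x' Q' R' : x \in U -> x' \in U -> x *m g = g *m emb22 Q R ->
    x' *m g = g *m emb22 Q' R' -> Q *m Q' = Q' *m Q /\ R *m R' = R' *m R.
  move=> xU xU' xB xB'.
  apply: (@emb22_inj _ (Q *m Q') (R *m R') (Q' *m Q) (R' *m R)).
  rewrite -!emb22M -[LHS](mulKmx gu) -[RHS](mulKmx gu); congr (_ *m _).
  by rewrite !mulmxA -xB -xB' -!mulmxA -xB -xB' !mulmxA (cU x x').
have [|h hu hS] := @commuting2 F (fun Q => exists x R,
    x \in U /\ x *m g = g *m emb22 Q R).
  move=> Q Q' [x [R [xU xQ] ] ] [x' [R' [xU' xQ'] ] ].
  by have [] := Sc _ _ _ _ _ _ xU xU' xQ xQ'.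
have [|h' hu' hS'] := @commuting2 F (fun R => exists x Q,
    x \in U /\ x *m g = g *m emb22 Q R).
  move=> R R' [x [Q [xU xQ] ] ] [x' [Q' [xU' xQ'] ] ].
  by have [] := Sc _ _ _ _ _ _ xU xU' xQ xQ'.
pose g' := g *m emb22 h h'.
have g'u : g' \in unitmx by rewrite unitmx_mul gu emb22_unit.
have xg' x Q R M N : x *m g = g *m emb22 Q R -> Q *m h = h *m M ->
    R *m h' = h' *m N -> x *m g' = g' *m emb22 M N.
  by move=> xQ QM RN; rewrite mulmxA xQ -!mulmxA !emb22M QM RN.
clearbody g'.
have normal m m' :
    (forall Q, (exists x R, x \in U /\ x *m g = g *m emb22 Q R) ->
      exists a b, Q *m h = h *m m a b) ->
    (forall R, (exists x Q, x \in U /\ x *m g = g *m emb22 Q R) ->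
      exists a b, R *m h' = h' *m m' a b) ->
    forall x, x \in U -> exists a b c e : F,
      x *m g' = g' *m emb22 (m a b) (m' c e) /\ \tr (emb22 (m a b) (m' c e)) = 0.
  move=> hQ hR x xU; have [Q [R xQ] ] := gU x xU.
  have [a [b QM] ] := hQ Q (ex_intro _ x (ex_intro _ R (conj xU xQ))).
  have [c [e RN] ] := hR R (ex_intro _ x (ex_intro _ Q (conj xU xQ))).
  have xM := xg' _ _ _ _ _ xQ QM RN.
  by exists a, b, c, e; split=> //; exact: tr_conj xU g'u xM.
have nz2 : 2%:R != 0 :> F by rewrite pnatr_eq0.
case: hS hS' => hS [] hS'.
- exists 0%N => //; apply: (orbit_rep_nform dU g'u) => x xU.
  have [a [b [c [e [-> ] ] ] ] ] :=
    normal (fun a b => mx2 a 0 0 b) (fun a b => mx2 a 0 0 b) hS hS' x xU.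
  rewrite /mxtrace sum4 !mxE /= ?mxE /= => tr0; exists a, b, c; congr (_ *m _).
  have -> : e = - a - b - c by rewrite -[LHS]addr0 -[0]oppr0 -tr0; ring.
  by apply: mx4P; rewrite !mxE /= ?mxE.
(* [w] exchanges the two coordinate planes, so that the block of Jordan type comes first. *)
- pose w : 'M[F]_4 := mx4 0 0 1 0 0 0 0 1 1 0 0 0 0 1 0 0.
  have wM M N : emb22 M N *m w = w *m emb22 N M.
    by rewrite !mul_mx4; congr mx4; ring.
  have wu : g' *m w \in unitmx.
    rewrite unitmx_mul g'u; apply: (@mx4_unit _ w w).
    by rewrite mul_mx4; apply: mx4P; rewrite !mxE /=; ring.
  exists 1%N => //; apply: (orbit_rep_nform dU wu) => x xU.
  have [a [b [c [e [xM ] ] ] ] ] :=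
    normal (fun a b => mx2 a 0 0 b) (fun a b => mx2 a b 0 a) hS hS' x xU.
  rewrite /mxtrace sum4 !mxE /= ?mxE /= => tr0; exists c, e, a.
  rewrite mulmxA xM -[LHS]mulmxA wM mulmxA; congr (_ *m _).
  have -> : b = - c - c - a by rewrite -[LHS]addr0 -[0]oppr0 -tr0; ring.
  by apply: mx4P; rewrite !mxE /= ?mxE.
- exists 1%N => //; apply: (orbit_rep_nform dU g'u) => x xU.
  have [a [b [c [e [-> ] ] ] ] ] :=
    normal (fun a b => mx2 a b 0 a) (fun a b => mx2 a 0 0 b) hS hS' x xU.
  rewrite /mxtrace sum4 !mxE /= ?mxE /= => tr0; exists a, b, c; congr (_ *m _).
  have -> : e = - a - a - c by rewrite -[LHS]addr0 -[0]oppr0 -tr0; ring.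
  by apply: mx4P; rewrite !mxE /= ?mxE.
exists 2 => //; apply: (orbit_rep_nform dU g'u) => x xU.
have [a [b [c [e [-> ] ] ] ] ] :=
  normal (fun a b => mx2 a b 0 a) (fun a b => mx2 a b 0 a) hS hS' x xU.
rewrite /mxtrace sum4 !mxE /= ?mxE /= => tr0; exists a, b, e; congr (_ *m _).
(* The trace is 2a + 2c, so 2 has to be invertible. *)
have -> : c = - a.
  by apply/(mulfI nz2)/eqP; rewrite -subr_eq0 -[X in _ == X]tr0; apply/eqP; ring.
by apply: mx4P; rewrite !mxE /= ?mxE.
Qed.

End SplitCase.

(** * Nilpotent subalgebras, by nilpotency index *)

Section NilpotentCase.
Variable F : numClosedFieldType.

Definition cols4 (a b c d : 'cV[F]_4) : 'M[F]_4 :=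
  \matrix_(i, j) (nth 0 [:: a; b; c; d] j) i 0.

Lemma cols4_mul a b c d (u : 'cV_4) : cols4 a b c d *m u =
  u i0 0 *: a + u i1 0 *: b + u i2 0 *: c + u i3 0 *: d.
Proof. by apply/colP => i; rewrite !mxE sum4 !mxE /=; ring. Qed.

Lemma mul_cols4 x a b c d :
  x *m cols4 a b c d = cols4 (x *m a) (x *m b) (x *m c) (x *m d).
Proof.
by apply/matrixP => i; apply: ord4P; rewrite !mxE /= ?mxE;
  apply: eq_bigr => j _; rewrite !mxE.
Qed.

Lemma cols4_mx4 a b c d m00 m01 m02 m03 m10 m11 m12 m13 m20 m21 m22 m23
    m30 m31 m32 m33 :
  cols4 a b c d *m mx4 m00 m01 m02 m03 m10 m11 m12 m13 m20 m21 m22 m23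
    m30 m31 m32 m33 =
  cols4 (m00 *: a + m10 *: b + m20 *: c + m30 *: d)
        (m01 *: a + m11 *: b + m21 *: c + m31 *: d)
        (m02 *: a + m12 *: b + m22 *: c + m32 *: d)
        (m03 *: a + m13 *: b + m23 *: c + m33 *: d).
Proof.
by apply/matrixP => i; apply: ord4P; rewrite !mxE sum4 !mxE /= ?mxE; ring.
Qed.

Lemma mx34_kernel (M : 'M[F]_(3, 4)) : exists2 u : 'cV_4, u != 0 & M *m u = 0.
Proof.
have : kermx M^T != 0.
  by rewrite -mxrank_eq0 mxrank_ker subn_eq0 -ltnNge ltnS mxrank_tr rank_leq_row.
move=> /eqP k0; have [i ki] : exists i, row i (kermx M^T) != 0.
  apply: contrapT => no; apply: k0; apply/row_matrixP => i; rewrite row0.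
  by apply: contrapT => /eqP ki; apply: no; exists i.
exists (row i (kermx M^T))^T; first by rewrite trmx_eq0.
by apply: trmx_inj; rewrite trmx_mul trmxK -row_mul mulmx_ker row0 trmx0.
Qed.

Lemma vec2_complete (a b : F) : (a != 0) || (b != 0) ->
  exists c d, a * d - b * c = 1.
Proof.
case: (eqVneq a 0) => [-> /=|a0 _] => [b0|].
  by exists (- b^-1), 0; rewrite mulrN mulfV // opprK mul0r add0r.
by exists 0, a^-1; rewrite mulfV // mulr0 subr0.
Qed.

Lemma det0_factor (p q r s : F) : p * s = q * r ->
  [|| p != 0, q != 0, r != 0 | s != 0] ->
  exists u1 u2 v1 v2, [/\ (u1 != 0) || (u2 != 0), (v1 != 0) || (v2 != 0),
    p = u1 * v1 /\ q = u1 * v2 & r = u2 * v1 /\ s = u2 * v2].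
Proof.
move=> ps nz; have [p0|p0] := eqVneq p 0; last first.
  exists 1, (r / p), p, q; rewrite oner_eq0 p0 !mul1r mulfVK //.
  by split=> //; split=> //; rewrite mulrAC [r * q]mulrC -ps mulrC mulKf.
have [q0|q0] := eqVneq q 0; last first.
  exists 1, (s / q), p, q; rewrite oner_eq0 q0 orbT !mul1r mulfVK //.
  split=> //; split=> //; rewrite p0 mulr0.
  by move/esym/eqP: ps; rewrite p0 mul0r mulf_eq0 (negPf q0) => /eqP.
exists 0, 1, r, s; rewrite oner_eq0 orbT p0 q0 !mul0r !mul1r.
by split=> //; move: nz; rewrite p0 q0 !eqxx.
Qed.

Variable U : {vspace 'M[F]_4}.
Hypothesis UAb : Ab F 4 U.

Let tU x : x \in U -> \tr x = 0. Proof. by case/AbP: UAb => + _ _ => /[apply]. Qed.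
Let dU : \dim U = 3. Proof. by case/AbP: UAb. Qed.
Let cU x y : x \in U -> y \in U -> x *m y = y *m x.
Proof. by case/AbP: UAb => _ _ cU xU yU; exact: cU. Qed.

Lemma conj_matrix (g x : 'M[F]_4) : g \in unitmx -> x *m g = g *m (invmx g *m x *m g).
Proof. by move=> gu; rewrite !mulmxA mulmxV // mul1mx. Qed.

Lemma conj_matrixM (g x y X Y : 'M[F]_4) : g \in unitmx -> x *m g = g *m X ->
  y *m g = g *m Y -> x *m y *m g = g *m (X *m Y).
Proof. by move=> gu xX yY; rewrite -mulmxA yY !mulmxA xX. Qed.

Lemma orbit_regular x : x \in U -> (forall y, y \in U -> y ^+ 4 = 0) ->
  x ^+ 3 <> 0 -> pgl_orbit (rep F 6) U.
Proof.
move=> xU nil x3; have [j /eqP Aj] := mx_neq0_col x3.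
move: Aj; rewrite colE => /eqP Aj.
have [g gu gU] := nilp_regular (nil x xU) Aj.
apply: (orbit_rep_nform dU gu) => y yU.
have [u yg] := gU y (cU xU yU).
have J1 : jordan F 3 = mx4 0 1 0 0 0 0 1 0 0 0 0 1 0 0 0 0.
  by apply: mx4P; rewrite !mxE.
have sumE : \sum_(j < 4) u j *: jordan F 3 ^+ (3 - j) =
    mx4 (u i3) (u i2) (u i1) (u i0) 0 (u i3) (u i2) (u i1)
        0 0 (u i3) (u i2) 0 0 0 (u i3).
  rewrite sum4 /= !subSS !subn0 expr0 expr1 !exprS expr0 mulr1 J1 -!mulmxE.
  by rewrite !mul_mx4; apply: mx4P; rewrite !mxE /=; ring.
rewrite sumE in yg.
(* [u i3] is the eigenvalue of the nilpotent [y] on the first basis vector. *)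
have u3 : u i3 = 0.
  apply: (mulmx_nilp_eigen (nil y yU) (v := g *m delta_mx i0 0)).
    apply/eqP => /(congr1 (mulmx (invmx g))); rewrite mulKmx // mulmx0.
    by move=> /colP /(_ i0); rewrite !mxE /= => /eqP; rewrite oner_eq0.
  rewrite mulmxA yg -mulmxA scalemxAr; congr (_ *m _); apply/colP.
  by apply: ord4P; rewrite !mxE sum4 !mxE /=; ring.
by exists (u i2), (u i1), (u i0); rewrite yg u3.
Qed.

End NilpotentCase.

Section CubeZero.
Variable F : numClosedFieldType.
Variable U : {vspace 'M[F]_4}.
Hypothesis UAb : Ab F 4 U.

Let tU x : x \in U -> \tr x = 0. Proof. by case/AbP: UAb => + _ _ => /[apply]. Qed.
Let dU : \dim U = 3. Proof. by case/AbP: UAb. Qed.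
Let cU x y : x \in U -> y \in U -> x *m y = y *m x.
Proof. by case/AbP: UAb => _ _ cU xU yU; exact: cU. Qed.

(** [x] has Jordan type (3, 1), and in an adapted basis the elements of [U] depend on four entries
    [q], [r], [a], [b]. Commutativity of [U] confines [(a, b)] to the line of some [(al, be)]. Forms
    9, 8 and 7 arise when [be] is zero, when [al] is zero, and when neither is. *)
Lemma orbit_cube0 x : x \in U -> (forall y, y \in U -> y ^+ 3 = 0) ->
  x ^+ 2 <> 0 -> exists2 k, (k < 14)%N & pgl_orbit (rep F k) U.
Proof.
move=> xU nil x2; have [j /eqP] := mx_neq0_col x2; rewrite colE => x2v.
set v := delta_mx j 0 in x2v.
have [i xvi] : exists i, (x ^+ 2 *m v) i 0 != 0.
  apply: contrapT => no; move/eqP: x2v; apply; apply/colP => i.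
  by rewrite [RHS]mxE; apply: contrapT => /eqP xvi; apply: no; exists i.
have x3 : x *m (x *m (x *m v)) = 0.
  transitivity (x ^+ 3 *m v); last by rewrite nil // mul0mx.
  by rewrite !exprS expr0 mulr1 -!mulmxE !mulmxA.
(* As [f] is nonzero on [x ^+ 2 *m v], a nonzero common zero [w] of [f], [f *m x] and [f *m x *m x]
   is independent of the cyclic subspace of [v]. *)
pose f : 'rV[F]_4 := delta_mx 0 i.
pose M : 'M[F]_(3, 4) := \matrix_(l, m) nth 0 [:: f *m x *m x; f *m x; f] l 0 m.
have [w w0 Mw] := mx34_kernel M.
have rowM l : (nth 0 [:: f *m x *m x; f *m x; f] (l : 'I_3)) *m w = 0.
  apply/rowP => m; rewrite ord1; have /colP /(_ l) := Mw.
  rewrite !mxE => E; rewrite -[RHS]E; apply: eq_bigr => n _.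
  by rewrite [in RHS]mxE.
have f0 := rowM j2; have f1 := rowM j1; have f2 := rowM j0.
rewrite /= in f0 f1 f2.
have fx2v : (f *m (x *m (x *m v))) 0 0 != 0.
  by rewrite -rowE mxE mulmxA mulmxE -expr2.
have indep a b c d y :
    y = a *: (x *m (x *m v)) + b *: (x *m v) + c *: w + d *: v ->
    f *m y = 0 -> f *m x *m y = 0 -> f *m x *m x *m y = 0 ->
    [/\ a = 0, b = 0 & d = 0].
  move=> -> fy0 fy1 fy2.
  have kill t : t *: (f *m (x *m (x *m v))) = 0 -> t = 0.
    move=> /matrixP /(_ 0 0); rewrite !mxE => /eqP; rewrite mulf_eq0.
    by case/orP => [/eqP//|/eqP E']; move: fx2v; rewrite mxE E' eqxx.
  have d0 : d = 0.
    apply: kill; move: fy2; rewrite !mulmxDr -!scalemxAr f2 -!mulmxA x3 !mulmx0.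
    by rewrite !scaler0 !add0r.
  have b0 : b = 0.
    apply: kill; move: fy1; rewrite !mulmxDr -!scalemxAr f1 -!mulmxA x3 !mulmx0.
    by rewrite d0 !scaler0 add0r scale0r !addr0.
  split=> //; apply: kill; move: fy0; rewrite !mulmxDr -!scalemxAr f0 d0 b0.
  by rewrite !scale0r scaler0 !addr0.
pose g := cols4 (x *m (x *m v)) (x *m v) w v.
have gu : g \in unitmx.
  apply: unitmx_inj => u; rewrite cols4_mul => E.
  have [||| u0 u1 u3] := indep _ _ _ _ _ (esym E); rewrite ?mulmx0 //.
  move: E; rewrite u0 u1 u3 !scale0r !add0r addr0 => /eqP.
  rewrite scaler_eq0 (negPf w0) orbF => /eqP u2.
  by apply/colP; apply: ord4P; rewrite [RHS]mxE.
(* Since the cube of [x] vanishes, [x] preserves the common zeros of the three forms, so [w] is an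
   eigenvector of a nilpotent matrix. *)
have xw : x *m w = 0.
  pose u := invmx g *m (x *m w).
  have xwE : x *m w = u i0 0 *: (x *m (x *m v)) + u i1 0 *: (x *m v) +
      u i2 0 *: w + u i3 0 *: v by rewrite -cols4_mul mulKVmx.
  have [||| u0 u1 u3] := indep _ _ _ _ _ xwE; rewrite ?mulmxA //.
    have := congr1 (mulmx f) (congr1 (fun A => A *m w) (nil x xU)).
    by rewrite mul0mx mulmx0 !exprS expr0 mulr1 -!mulmxE !mulmxA.
  move: xwE; rewrite u0 u1 u3 !scale0r !add0r addr0 => xwE.
  by rewrite xwE (mulmx_nilp_eigen (nil x xU) w0 xwE) scale0r.
pose E : 'M[F]_4 := mx4 0 1 0 0 0 0 0 1 0 0 0 0 0 0 0 0.
have xg : x *m g = g *m E.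
  rewrite mul_cols4 cols4_mx4 x3 xw !scale0r !scale1r ?addr0 ?add0r.
  by [].
have gY y : y \in U -> exists q r a b,
    y *m g = g *m mx4 0 q a r 0 0 0 q 0 0 0 b 0 0 0 0.
  move=> yU; pose Y := invmx g *m y *m g.
  have yY : y *m g = g *m Y by exact: conj_matrix.
  have : Y *m E = E *m Y.
    rewrite -[LHS](mulKmx gu) -[RHS](mulKmx gu); congr (_ *m _).
    by rewrite -(conj_matrixM gu yY xg) -(conj_matrixM gu xg yY) (cU xU yU).
  clearbody Y; rewrite [Y]mx4E !mul_mx4 => /matrixP YE.
  have := (YE i0 i0, YE i1 i0, YE i0 i1, YE i1 i1, YE i2 i1, YE i3 i1).
  have := (YE i0 i2, YE i1 i2, YE i0 i3, YE i1 i3, YE i2 i3, YE i3 i3).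
  rewrite !mxE /= !(mul0r, mulr0, mul1r, mulr1, addr0, add0r).
  move=> [ [ [ [ [Y12 Y32] Y01] Y11] Y21] Y31].
  move=> [ [ [ [ [Y10 Y30] Y00] Y10'] Y20] Y30'].
  have YE' : Y = mx4 (Y i0 i0) (Y i0 i1) (Y i0 i2) (Y i0 i3) 0 (Y i0 i0) 0 (Y i0 i1)
      0 0 (Y i2 i2) (Y i2 i3) 0 0 0 (Y i0 i0).
    by rewrite {1}[Y]mx4E -Y10 -Y12 -Y32 Y20 Y21 Y30' Y31 -Y11 -Y00 -Y01.
  have Y0 : Y i0 i0 = 0.
    apply: (mulmx_nilp_eigen (nil y yU) (v := g *m delta_mx i0 0)).
      apply/eqP => /(congr1 (mulmx (invmx g))); rewrite mulKmx // mulmx0.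
      by move=> /colP /(_ i0); rewrite !mxE /= => /eqP; rewrite oner_eq0.
    rewrite mulmxA yY -mulmxA scalemxAr; congr (_ *m _); apply/colP.
    by apply: ord4P; rewrite YE' !mxE sum4 !mxE /=; ring.
  have tY : \tr Y = 0.
    rewrite -(tU yU) -[y](mulmxK gu) yY.
    by rewrite mxtrace_mulC mulmxA mulVmx // mul1mx.
  have Y2 : Y i2 i2 = 0.
    by rewrite -[RHS]tY YE' /mxtrace sum4 !mxE /= Y0; ring.
  exists (Y i0 i1), (Y i0 i3), (Y i0 i2), (Y i2 i3).
  by rewrite yY {1}YE' Y0 Y2.
have [al [be [albe alU] ] ] : exists al be, (al != 0) || (be != 0) /\
    forall y q r a b, y \in U ->
    y *m g = g *m mx4 0 q a r 0 0 0 q 0 0 0 b 0 0 0 0 ->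
    exists t, a = t * al /\ b = t * be.
  have [[y [q [r [al [be [yU yE ab] ] ] ] ] ]|no] := pselect (exists y q r a b,
      [/\ y \in U, y *m g = g *m mx4 0 q a r 0 0 0 q 0 0 0 b 0 0 0 0
        & (a != 0) || (b != 0)]).
    exists al, be; split=> // y' q' r' a b yU' yE'.
    (* The corner entries of the two products [y *m y'] and [y' *m y] differ by
       [al * b - a * be]. *)
    have ab' : al * b = a * be.
      have := conj_matrixM gu yE yE'; rewrite (cU yU yU').
      rewrite (conj_matrixM gu yE' yE) => /(congr1 (mulmx (invmx g))).
      rewrite !mulKmx // !mul_mx4 => /matrixP /(_ i0 i3); rewrite !mxE /= => E'.
      by apply/(addrI (q * q')); move: E'; rewrite !(mul0r, mulr0, addr0, add0r);
        rewrite [q' * q]mulrC [a * be]mulrC [al * b]mulrC => ->.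
    case/orP: ab => [a0|b0].
      by exists (a / al); rewrite mulfVK // mulrAC -ab' mulrC mulKf.
    exists (b / be); rewrite mulfVK //; split=> //.
    by rewrite mulrAC mulrC [b * _]mulrC ab' mulrC mulfK.
  (* All pairs [(a, b)] vanish here, so any line contains them. *)
  exists 1, 0; rewrite oner_eq0; split=> // y q r a b yU yE.
  exists a; rewrite mulr1 mulr0; split=> //; apply: contrapT => /eqP b0.
  by apply: no; exists y, q, r, a, b; rewrite b0 orbT.
have [be0|be0] := eqVneq be 0.
  exists 9 => //; apply: (orbit_rep_nform dU gu) => y yU.
  have [q [r [a [b yE] ] ] ] := gY y yU; have [t [aE bE] ] := alU _ _ _ _ _ yU yE.
  exists q, r, a; rewrite yE bE be0 mulr0; congr (_ *m _).
have [al0|al0] := eqVneq al 0.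
  exists 8 => //; apply: (orbit_rep_nform dU gu) => y yU.
  have [q [r [a [b yE] ] ] ] := gY y yU; have [t [aE bE] ] := alU _ _ _ _ _ yU yE.
  exists q, r, b; rewrite yE aE al0 mulr0; congr (_ *m _).
(* The square of an element has corner entry q^2 + a b. With b = - ta^2 a it factors as (q + ta a)(q
   - ta a), and the two factors become the first two parameters of form 7. *)
pose ta := sqrtC (- be / al).
have ta2 : ta * ta * al = - be by rewrite -expr2 sqrtCK mulfVK.
have ta0 : ta != 0.
  by apply: contraNneq be0 => ta0; rewrite -oppr_eq0 -ta2 ta0 !mul0r.
have nz2 : 2%:R != 0 :> F by rewrite pnatr_eq0.
pose h : 'M[F]_4 := mx4 1 0 0 0 0 1 1 0 0 ta (- ta) 0 0 0 0 2%:R.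
have hu : g *m h \in unitmx.
  rewrite unitmx_mul gu; apply: (@mx4_unit _ h (mx4 1 0 0 0
    0 2%:R^-1 (2%:R * ta)^-1 0 0 2%:R^-1 (- (2%:R * ta)^-1) 0 0 0 0 2%:R^-1)).
  rewrite mul_mx4 scalar_mx4; congr mx4; field; by rewrite ?nz2 ?ta0.
exists 7 => //; apply: (orbit_rep_nform dU hu) => y yU.
have [q [r [a [b yE] ] ] ] := gY y yU; have [t [aE bE] ] := alU _ _ _ _ _ yU yE.
exists (q + ta * a), (q - ta * a), (2%:R * r).
have {}bE : b = - (ta * ta * a) by rewrite bE aE [t * al]mulrC mulrA ta2; ring.
rewrite mulmxA yE -!mulmxA; congr (_ *m _).
by rewrite bE !mul_mx4; congr mx4; ring.
Qed.

End CubeZero.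

Section SquareZero.
Variable F : numClosedFieldType.
Variable U : {vspace 'M[F]_4}.
Hypothesis UAb : Ab F 4 U.

Let dU : \dim U = 3. Proof. by case/AbP: UAb. Qed.

(** If all ranks are at most one, the result is form 10 or 11. Otherwise an [x] of rank two has
    image and kernel equal to a plane W, and every element of [U] is a map from V/W to W, a 2 x 2
    block. As [U] has dimension 3, a linear relation [p], [q], [r], [s] holds among the four
    entries, and its determinant decides between forms 13 and 12. *)
Lemma orbit_square0 : (forall x y, x \in U -> y \in U -> x *m y = 0) ->
  exists2 k, (k < 14)%N & pgl_orbit (rep F k) U.
Proof.
move=> U0.
have Ul : lincomb_closed (fun x => x \in U).
  by move=> a x y xU yU; rewrite memvD ?memvZ.
have [U1|] := pselect (forall x, x \in U -> mx_rank1 x).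
  have [[u u0 Su]|[f f0 Sf] ] := rank1_space Ul U1.
    have [|g gu gU] := sq0_common_image u0 Su; first by move=> x xU; exact: U0.
    exists 10 => //; apply: (orbit_rep_nform dU gu) => x /gU[f f0 ->].
    have fi0 : f 0 i0 = 0 by rewrite -[RHS]f0; congr (f _ _); exact: val_inj.
    exists (f 0 i1), (f 0 i2), (f 0 i3); congr (_ *m _).
    by apply: mx4P; rewrite !mxE ?big_ord1 ?mxE /= ?fi0; ring.
  have [|g gu gU] := sq0_common_kernel f0 Sf; first by move=> x xU; exact: U0.
  exists 11 => //; apply: (orbit_rep_nform dU gu) => x /gU[u u0 ->].
  have ui3 : u i3 0 = 0 by rewrite -[RHS]u0; congr (u _ _); exact: val_inj.
  exists (u i0 0), (u i1 0), (u i2 0); congr (_ *m _).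
  by apply: mx4P; rewrite !mxE ?big_ord1 ?mxE /= ?ui3; ring.
move=> /existsNP[x /not_implyP[xU /existsNP[i /existsNP[j /existsNP[k
  /existsNP[l /eqP ijkl] ] ] ] ] ].
pose v : 'cV[F]_4 := delta_mx j 0; pose w : 'cV[F]_4 := delta_mx l 0.
have xv m : (x *m v) m 0 = x m j by rewrite -colE mxE.
have xw m : (x *m w) m 0 = x m l by rewrite -colE mxE.
have indep c d : c *: (x *m v) + d *: (x *m w) = 0 -> c = 0 /\ d = 0.
  move=> /colP E.
  have Em m : c * x m j + d * x m l = 0.
    have := E m; rewrite -xv -xw; move: (x *m v) (x *m w) => a b.
    by rewrite !mxE.
  have nz : x i j * x k l - x i l * x k j != 0 by rewrite subr_eq0.
  split; apply/(mulIf nz); rewrite mul0r.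
    transitivity ((c * x i j + d * x i l) * x k l -
      (c * x k j + d * x k l) * x i l); first ring.
    by rewrite !Em !mul0r subrr.
  transitivity ((c * x k j + d * x k l) * x i j -
    (c * x i j + d * x i l) * x k j); first ring.
  by rewrite !Em !mul0r subrr.
have xx : x *m x = 0 by exact: U0.
pose g := cols4 (x *m v) (x *m w) v w.
have gu : g \in unitmx.
  apply: unitmx_inj => u; rewrite cols4_mul => E.
  have [u2 u3] : u i2 0 = 0 /\ u i3 0 = 0.
    apply: indep; have := congr1 (mulmx x) E.
    by rewrite mulmx0 !mulmxDr -!scalemxAr !mulmxA xx !mul0mx !scaler0 !add0r.
  move: E; rewrite u2 u3 !scale0r !addr0 => /indep[u0 u1].
  by apply/colP; apply: ord4P; rewrite [RHS]mxE.
pose E : 'M[F]_4 := mx4 0 0 1 0 0 0 0 1 0 0 0 0 0 0 0 0.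
have xg : x *m g = g *m E.
  rewrite mul_cols4 cols4_mx4 !mulmxA xx !mul0mx !scale0r !scale1r ?addr0 ?add0r.
  by [].
have gY y : y \in U -> let Y := invmx g *m y *m g in y *m g = g *m Y /\
    Y = mx4 0 0 (Y i0 i2) (Y i0 i3) 0 0 (Y i1 i2) (Y i1 i3) 0 0 0 0 0 0 0 0.
  move=> yU Y; have yY : y *m g = g *m Y by exact: conj_matrix.
  split=> //; have YE : Y *m E = 0.
    by rewrite -[LHS](mulKmx gu) -(conj_matrixM gu yY xg) (U0 y x) // mul0mx mulmx0.
  have EY : E *m Y = 0.
    by rewrite -[LHS](mulKmx gu) -(conj_matrixM gu xg yY) (U0 x y) // mul0mx mulmx0.
  clearbody Y; have Ye := mx4E Y; rewrite Ye !mul_mx4 in YE; rewrite Ye !mul_mx4 in EY.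
  move/matrixP: YE => YE; move/matrixP: EY => EY.
  have := (YE i0 i2, YE i1 i2, YE i2 i2, YE i3 i2, YE i0 i3, YE i1 i3, YE i2 i3,
    YE i3 i3).
  have := (EY i0 i0, EY i0 i1, EY i0 i2, EY i0 i3, EY i1 i0, EY i1 i1, EY i1 i2,
    EY i1 i3).
  rewrite !mxE /= !(mul0r, mulr0, mul1r, mulr1, addr0, add0r).
  move=> [ [ [ [ [ [ [E0 E1] E2] E3] E4] E5] E6] E7].
  move=> [ [ [ [ [ [ [E8 E9] E10] E11] E12] E13] E14] E15].
  by rewrite {1}[Y]mx4E E0 E1 E2 E3 E4 E5 E6 E7 E8 E9 E12 E13.
clearbody g.
(* Three basis vectors impose three equations on the four coefficients of a relation. *)
have [n [n0 nU] ] : exists n : 'cV[F]_4, n != 0 /\ forall y, y \in U ->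
    let Y := invmx g *m y *m g in
    n i0 0 * Y i0 i2 + n i1 0 * Y i1 i2 + n i2 0 * Y i0 i3 + n i3 0 * Y i1 i3 = 0.
  pose co (y : 'M[F]_4) (m : nat) := let Y := invmx g *m y *m g in
    nth 0 [:: Y i0 i2; Y i1 i2; Y i0 i3; Y i1 i3] m.
  have [n n0 Mn] := mx34_kernel (\matrix_(a < 3, m < 4) co (vbasis U)`_a m).
  exists n; split=> // y yU Y.
  pose B (z : 'M[F]_4) : F := \sum_(m < 4) co z m * n m 0.
  have BE z : B z = let Y := invmx g *m z *m g in
    n i0 0 * Y i0 i2 + n i1 0 * Y i1 i2 + n i2 0 * Y i0 i3 + n i3 0 * Y i1 i3.
    by rewrite /B sum4 /co /=; ring.
  have Blin a z z' : B (a *: z + z') = a * B z + B z'.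
    rewrite !BE /= mulmxDr mulmxDl -scalemxAr -scalemxAl.
    by move: (invmx g *m z *m g) (invmx g *m z' *m g) => A A'; rewrite !mxE; ring.
  have B0 : B 0 = 0 by rewrite BE /= mulmx0 mul0mx !mxE; ring.
  rewrite -[LHS](BE y) (coord_vbasis yU).
  have : forall a : 'I_(\dim U), B (vbasis U)`_a = 0.
    move: (vbasis U) Mn; rewrite dU => b Mn a.
    have /colP /(_ a) := Mn; rewrite [RHS]mxE mxE => Ba.
    by rewrite -[RHS]Ba; apply: eq_bigr => m _; rewrite mxE.
  move=> Bb; elim/big_rec: _ => // a z _ IHz.
  by rewrite Blin Bb mulr0 add0r.
set p := n i0 0 in nU; set q := n i1 0 in nU; set r := n i2 0 in nU.
set s := n i3 0 in nU.
have nz : [|| p != 0, q != 0, r != 0 | s != 0].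
  apply: contraT; rewrite !negb_or !negbK => /and4P[/eqP p0 /eqP q0 /eqP r0 /eqP s0].
  by case/eqP: n0; apply/colP; apply: ord4P; rewrite [RHS]mxE.
have [D|D] := eqVneq (p * s) (q * r); last first.
  have D0 : p * s - q * r != 0 by rewrite subr_eq0.
  (* In this basis of W the relation becomes the equality of the two off-diagonal entries, so that
     the blocks are symmetric. *)
  pose h : 'M[F]_4 := mx4 (- q) (- s) 0 0 p r 0 0 0 0 1 0 0 0 0 1.
  have hu : g *m h \in unitmx.
    rewrite unitmx_mul gu; apply: (@mx4_unit _ h (mx4 (r / (p * s - q * r))
      (s / (p * s - q * r)) 0 0 (- p / (p * s - q * r)) (- q / (p * s - q * r)) 0 0
      0 0 1 0 0 0 0 1)).
    by rewrite mul_mx4 scalar_mx4; congr mx4; field.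
  exists 13 => //; apply: (orbit_rep_nform dU hu) => y yU.
  have [yY YE] := gY y yU; have := nU y yU; move: YE yY => /=.
  set Y := invmx g *m y *m g; clearbody Y => YE yY rel.
  exists ((r * Y i0 i2 + s * Y i1 i2) / (p * s - q * r)),
    (- (p * Y i0 i2 + q * Y i1 i2) / (p * s - q * r)),
    (- (p * Y i0 i3 + q * Y i1 i3) / (p * s - q * r)).
  have s22 : q * (p * Y i0 i2 + q * Y i1 i2) =
     - q * (r * Y i0 i3 + s * Y i1 i3).
    by apply/eqP; rewrite -subr_eq0 -[X in _ == X](mulr0 q) -rel; apply/eqP; ring.
  have s22' : p * (p * Y i0 i2 + q * Y i1 i2) =
     - p * (r * Y i0 i3 + s * Y i1 i3).
    by apply/eqP; rewrite -subr_eq0 -[X in _ == X](mulr0 p) -rel; apply/eqP; ring.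
  rewrite mulmxA yY -[RHS]mulmxA -[LHS]mulmxA; congr (_ *m _).
  rewrite {1}YE !mul_mx4; congr mx4; try ring; apply/(mulIf D0).
  - by field.
  - transitivity (q * (p * Y i0 i2 + q * Y i1 i2) + s * (p * Y i0 i3 + q * Y i1 i3)).
      by rewrite s22; ring.
    by field.
  - by field.
  - transitivity (- r * (p * Y i0 i3 + q * Y i1 i3) - p * (p * Y i0 i2 + q * Y i1 i2)).
      by rewrite s22'; ring.
    by field.
(* A degenerate relation factors and says that the block sends [(u1, u2)] into the line of
   [(- v2, v1)]. The latter is the line of the flag; the former, added to W, gives its
   hyperplane. *)
have [u1 [u2 [v1 [v2 [u0 v0 [pE qE] [rE sE] ] ] ] ] ] := det0_factor D nz.
have [t1 [t2 ut] ] := vec2_complete u0.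
have [w1 [w2 vw] ] : exists w1 w2, - v2 * w2 - v1 * w1 = 1.
  by apply: vec2_complete; rewrite oppr_eq0 orbC.
pose h : 'M[F]_4 := mx4 (- v2) w1 0 0 v1 w2 0 0 0 0 u1 t1 0 0 u2 t2.
have hu : g *m h \in unitmx.
  rewrite unitmx_mul gu; apply: (@mx4_unit _ h (mx4 w2 (- w1) 0 0 (- v1) (- v2) 0 0
    0 0 t2 (- t1) 0 0 (- u2) u1)).
  rewrite mul_mx4 scalar_mx4; congr mx4; rewrite -?vw; try ring;
  by rewrite vw -ut; ring.
exists 12 => //; apply: (orbit_rep_nform dU hu) => y yU.
have [yY YE] := gY y yU; have := nU y yU; move: YE yY => /=.
set Y := invmx g *m y *m g; clearbody Y => YE yY rel.
exists (w2 * (Y i0 i2 * u1 + Y i0 i3 * u2) - w1 * (Y i1 i2 * u1 + Y i1 i3 * u2)),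
  (w2 * (Y i0 i2 * t1 + Y i0 i3 * t2) - w1 * (Y i1 i2 * t1 + Y i1 i3 * t2)),
  (- v1 * (Y i0 i2 * t1 + Y i0 i3 * t2) - v2 * (Y i1 i2 * t1 + Y i1 i3 * t2)).
have rel' : v1 * (Y i0 i2 * u1 + Y i0 i3 * u2) =
    - v2 * (Y i1 i2 * u1 + Y i1 i3 * u2).
  apply/eqP; rewrite -subr_eq0 -[X in _ == X]rel pE qE rE sE.
  by apply/eqP; ring.
rewrite mulmxA yY -[RHS]mulmxA -[LHS]mulmxA; congr (_ *m _).
rewrite {1}YE !mul_mx4; congr mx4; try ring.
- transitivity ((Y i0 i2 * u1 + Y i0 i3 * u2) * (- v2 * w2 - v1 * w1)).
    by rewrite vw; ring.
  transitivity (- v2 * w2 * (Y i0 i2 * u1 + Y i0 i3 * u2) - w1 *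
    (v1 * (Y i0 i2 * u1 + Y i0 i3 * u2))); first ring.
  by rewrite rel'; ring.
- transitivity ((Y i0 i2 * t1 + Y i0 i3 * t2) * (- v2 * w2 - v1 * w1)).
    by rewrite vw; ring.
  ring.
- transitivity ((Y i1 i2 * u1 + Y i1 i3 * u2) * (- v2 * w2 - v1 * w1)).
    by rewrite vw; ring.
  transitivity (w2 * (- v2 * (Y i1 i2 * u1 + Y i1 i3 * u2)) - v1 * w1 *
    (Y i1 i2 * u1 + Y i1 i3 * u2)); first ring.
  by rewrite -rel'; ring.
transitivity ((Y i1 i2 * t1 + Y i1 i3 * t2) * (- v2 * w2 - v1 * w1)).
  by rewrite vw; ring.
ring.
Qed.

End SquareZero.

Theorem Ab_classification (F : numClosedFieldType) (U : {vspace 'M[F]_4}) :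
  Ab F 4 U -> exists2 k, (k < 14)%N & pgl_orbit (rep F k) U.
Proof.
move=> UAb; have /AbP[tU dU cU] := UAb.
have [sp|nsp] := pselect (split_family U); first exact: orbit_of_split.
have nil4 x : x \in U -> x ^+ 4 = 0.
  move=> xU; have [[a [xa] ]|[P [d [Pu dd Pd] ] ] ] := spectral_split x.
    rewrite tU // => /esym/eqP; rewrite mulrn_eq0 /= => /eqP a0.
    by rewrite -xa a0 raddf0 subr0.
  by case: nsp; exists P, d; split=> // B BU; apply: Pd; exact: cU.
have [[x [xU x3] ]|no3] := pselect (exists x, x \in U /\ x ^+ 3 <> 0).
  by exists 6 => //; exact: orbit_regular xU nil4 x3.
have nil3 x : x \in U -> x ^+ 3 = 0.
  by move=> xU; apply: contrapT => x3; apply: no3; exists x.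
have [[x [xU x2] ]|no2] := pselect (exists x, x \in U /\ x ^+ 2 <> 0).
  exact: orbit_cube0 xU nil3 x2.
have nil2 x : x \in U -> x *m x = 0.
  by move=> xU; apply: contrapT => x2; apply: no2; exists x.
(* Products are recovered from squares by polarisation, using commutativity and the invertibility of
   2. *)
apply: orbit_square0 => // x y xU yU.
have : (x + y) *m (x + y) = 0 by apply: nil2; rewrite memvD.
rewrite mulmxDl !mulmxDr !nil2 // add0r addr0 (cU y x) // -mulr2n => /eqP.
by rewrite -scaler_nat scaler_eq0 pnatr_eq0 /= => /eqP.
Qed.

(** * Degenerations along polynomial curves *)

Section PolynomialCurves.
Variable F : numClosedFieldType.

Definition pfun (f : F -> F) : Prop := exists p : {poly F}, forall t, f t = p.[t].

Lemma pfunC a : pfun (fun=> a).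
Proof. by exists a%:P => t; rewrite hornerC. Qed.

Lemma pfunX : pfun (fun t => t).
Proof. by exists 'X => t; rewrite hornerX. Qed.

Lemma pfunD f g : pfun f -> pfun g -> pfun (fun t => f t + g t).
Proof. by move=> [p fE] [q gE]; exists (p + q) => t; rewrite hornerD fE gE. Qed.

Lemma pfunM f g : pfun f -> pfun g -> pfun (fun t => f t * g t).
Proof. by move=> [p fE] [q gE]; exists (p * q) => t; rewrite hornerM fE gE. Qed.

Lemma pfunN f : pfun f -> pfun (fun t => - f t).
Proof. by move=> [p fE]; exists (- p) => t; rewrite hornerN fE. Qed.

Lemma pfun_sum (I : Type) (r : seq I) (P : pred I) (f : I -> F -> F) :
  (forall i, pfun (f i)) -> pfun (fun t => \sum_(i <- r | P i) f i t).
Proof.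
move=> /choice[p pE]; exists (\sum_(i <- r | P i) p i) => t.
by rewrite horner_sum; apply: eq_bigr.
Qed.

Lemma pfun_prod (I : Type) (r : seq I) (P : pred I) (f : I -> F -> F) :
  (forall i, pfun (f i)) -> pfun (fun t => \prod_(i <- r | P i) f i t).
Proof.
move=> /choice[p pE]; exists (\prod_(i <- r | P i) p i) => t.
by rewrite horner_prod; apply: eq_bigr.
Qed.

Lemma pfun_exp f n : pfun f -> pfun (fun t => f t ^+ n).
Proof. by move=> [p fE]; exists (p ^+ n) => t; rewrite horner_exp fE. Qed.

Lemma pfun_det n (f : 'I_n -> 'I_n -> F -> F) :
  (forall i j, pfun (f i j)) -> pfun (fun t => \det (\matrix_(i, j) f i j t)).
Proof.
move=> hf; have [p pE] := @pfun_sum _ (index_enum {perm 'I_n}) xpredT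
  (fun s t => (-1) ^+ s * \prod_i f i (s i) t) (fun s => pfunM (pfunC _)
    (pfun_prod _ _ (fun i => hf i (s i)))).
exists p => t; rewrite -pE; apply: eq_bigr => s _; congr (_ * _).
by apply: eq_bigr => i _; rewrite mxE.
Qed.

Lemma pfun_meval n (p : {mpoly F[n]}) (f : 'I_n -> F -> F) :
  (forall i, pfun (f i)) -> pfun (fun t => p.@[fun i => f i t]).
Proof.
move=> hf; have [q qE] := @pfun_sum _ (msupp p) xpredT
  (fun m t => p@_m * \prod_i f i t ^+ m i) (fun m => pfunM (pfunC _)
    (pfun_prod _ _ (fun i => pfun_exp _ (hf i)))).
by exists q => t; rewrite -qE mevalE.
Qed.

Lemma pfun_linear p q (w : F -> 'M[F]_(p, q)) (l : {linear 'M[F]_(p, q) -> F^o}) :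
  (forall i j, pfun (fun t => w t i j)) -> pfun (fun t => l (w t)).
Proof.
move=> hw; have [r rE] := @pfun_sum _ (index_enum 'I_p) xpredT _ (fun i =>
  @pfun_sum _ (index_enum 'I_q) xpredT _ (fun j =>
    pfunM (hw i j) (pfunC (l (delta_mx i j))))).
exists r => t; rewrite -rE [in LHS](matrix_sum_delta (w t)) linear_sum.
apply: eq_bigr => i _; rewrite linear_sum; apply: eq_bigr => j _.
by rewrite linearZ.
Qed.

Lemma pfun_eq0 f : pfun f -> (forall t, t != 0 -> f t = 0) -> f 0 = 0.
Proof.
move=> [p fE] f0; have [p0|p0] := eqVneq p 0; first by rewrite fE p0 horner0.
(* In characteristic zero the integers from 1 to [size p] would be distinct nonzero roots, one too
   many. *)
have := @max_poly_roots _ p [seq n.+1%:R : F | n <- iota 0 (size p)] p0.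
rewrite size_map size_iota ltnn => no; suff: false by [].
apply: no.
  by apply/allP => _ /mapP[n _ ->]; rewrite rootE -fE f0 // pnatr_eq0.
by rewrite map_inj_uniq ?iota_uniq // => i j /eqP; rewrite eqr_nat eqSS => /eqP.
Qed.

(** The minors of [w t] are polynomial in [t]. For nonzero [t] they are a multiple, possibly zero,
    of the Pluecker vector of a point of [Z], so the equations of [Z] vanish on them. By
    continuation they vanish at [t = 0], where the multiple is nonzero because the [w i 0] span
    [U0]. *)
Lemma curve_closed p q k (W U0 : {vspace 'M[F]_(p, q)}) Z
    (w : 'I_k -> F -> 'M[F]_(p, q)) :
  zclosed (plucker _ k) (grass _ k W) Z -> grass _ k W U0 ->
  (forall i a b, pfun (fun t => w i t a b)) ->
  (forall t, t != 0 -> exists2 U, Z U & forall i, w i t \in U) ->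
  (forall i, w i 0 \in U0) -> (forall u, u \in U0 -> u \in <<codom (fun i => w i 0%R)>>%VS) ->
  Z U0.
Proof.
move=> [S Sh ->] gU0 wp wZ w0 wsp; split=> // r Sr; have [d rd] := Sh r Sr.
pose m t (s : 'I_#|plucker_idx 'M[F]_(p, q) k|) := \det (colsub (enum_val s)
  (\matrix_(i, j) coord (vbasis {:'M[F]_(p, q)}) j (w i t))).
have hr a (v : _ -> F) : r.@[fun s => a * v s] = a ^+ d * r.@[v].
  by apply: (hpoly_scale (f := fun v => r.@[v])); exists r.
have [a [aE a0] ] := plucker_minors (proj2 gU0) w0.
have : r.@[m 0] = 0.
  apply: (@pfun_eq0 (fun t => r.@[m t])).
    apply: pfun_meval => s.
    have [z zE] := @pfun_det k (fun i j t => coord (vbasis {:'M[F]_(p, q)})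
      ((enum_val s : plucker_idx _ k) j) (w i t)) (fun i j => pfun_linear _ (wp i)).
    exists z => t; rewrite -zE; congr (\det _).
    by apply/matrixP => i j; rewrite !mxE.
  move=> t t0; have [U [gU ZU] wU] := wZ t t0.
  have [b [bE _] ] := plucker_minors (proj2 gU) wU.
  by rewrite (meval_eq r bE) hr ZU // mulr0.
rewrite (meval_eq r aE) hr => /eqP; rewrite mulf_eq0 expf_eq0.
by rewrite (negPf (a0 wsp)) andbF => /eqP.
Qed.

(* M t spans a conjugate of rep k for t != 0 and rep l for t = 0, so that rep l is
   in the closure of the orbit of rep k. *)
Definition degeneration (k l : nat) (M : F -> F -> F -> F -> 'M[F]_4) : Prop :=
  [/\ forall a b c i j, pfun (fun t => M t a b c i j),
      forall t, t != 0 -> exists2 h, h \in unitmx & forall a b c,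
        exists a' b' c', M t a b c *m h = h *m nform k a' b' c' &
      forall a b c, M 0 a b c = nform l a b c].

Lemma degeneration_closed k l M Z : degeneration k l M -> closed_in_grass Z ->
  pgl_orbit (rep F k) `<=` Z -> pgl_orbit (rep F l) `<=` Z.
Proof.
move=> [Mp Mk Ml] Zc kZ _ [g gu ->].
pose co (i : 'I_3) : F * F * F := nth (0, 0, 0)
  [:: (1, 0, 0); (0, 1, 0); (0, 0, 1)] i.
pose w (i : 'I_3) t := g *m M t (co i).1.1 (co i).1.2 (co i).2 *m invmx g.
apply: (curve_closed (w := w) Zc).
- by have [] := Ab_conj gu (rep_Ab F l).
- move=> i a b.
  have [p pE] := @pfun_sum _ (index_enum 'I_4) xpredT _ (fun m =>
    pfunM (@pfun_sum _ (index_enum 'I_4) xpredT _ (fun n =>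
      pfunM (pfunC (g a n)) (Mp (co i).1.1 (co i).1.2 (co i).2 n m)))
      (pfunC (invmx g m b))).
  exists p => t; rewrite -pE /w mxE; apply: eq_bigr => m _.
  by rewrite mxE.
- move=> t t0; have [h hu hM] := Mk t t0.
  exists (conj_act (g *m h) (rep F k)); first by apply: kZ; exists (g *m h);
    rewrite ?unitmx_mul ?gu.
  move=> i; have [a [b [c abc] ] ] := hM (co i).1.1 (co i).1.2 (co i).2.
  rewrite mem_conj ?unitmx_mul ?gu // invmx_mul // /w !mulmxA.
  rewrite mulmxKV // -[_ *m invmx g *m g]mulmxA mulVmx // mulmx1.
  by rewrite -mulmxA abc mulKmx // nform_in.
- by move=> i; apply: conj_in => //; rewrite Ml nform_in.
move=> _ /(conj_inP gu)[x /mem_rep[a [b [c ->] ] ] ->].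
have wE i : w i 0 \in <<codom (fun i => w i 0%R)>>%VS by apply/memv_span/codom_f.
rewrite nformE !mulmxDr !mulmxDl -!scalemxAr -!scalemxAl.
have := (wE j0, wE j1, wE j2); rewrite /w !Ml /co /= => [ [ [w0 w1] w2] ].
by rewrite !memvD // memvZ.
Qed.

End PolynomialCurves.

Ltac pfun_tac := repeat (first [exact: pfunC | exact: pfunX | apply: pfunD
  | apply: pfunM | apply: pfunN]).

Section Degenerations.
Variable F : numClosedFieldType.

Lemma pfun_mx4 f00 f01 f02 f03 f10 f11 f12 f13 f20 f21 f22 f23 f30 f31 f32 f33 :
  pfun f00 -> pfun f01 -> pfun f02 -> pfun f03 -> pfun f10 -> pfun f11 -> pfun
    f12 -> pfun f13 -> pfun f20 -> pfun f21 -> pfun f22 -> pfun f23 -> pfun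
    f30 -> pfun f31 -> pfun f32 -> pfun f33 ->
  forall i j, pfun (fun t : F => mx4 (f00 t) (f01 t) (f02 t) (f03 t) (f10 t)
    (f11 t) (f12 t) (f13 t) (f20 t) (f21 t) (f22 t) (f23 t) (f30 t) (f31 t)
    (f32 t) (f33 t) i j).
Proof.
do 16!move=> ?; do 2!apply: ord4P;
  match goal with |- pfun ?f => match goal with H : pfun ?g |- _ =>
    (rewrite (_ : f = g); [exact: H | by apply/funext => t; rewrite mxE]) end end.
Qed.

(** Reduces a degeneration to identities for [field] and [ring]: the columns of [h t] are the basis
    that exhibits form [k], and [h' t] is the inverse matrix. *)
Lemma degeneration_intro k l (m : F -> F -> F -> F -> 'M[F]_4)
    (h h' : F -> 'M[F]_4) (a' b' c' : F -> F -> F -> F -> F) :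
  (forall a b c i j, pfun (fun t => m t a b c i j)) ->
  (forall t, t != 0 -> h t *m h' t = 1%:M) ->
  (forall t a b c, t != 0 -> m t a b c *m h t =
     h t *m nform k (a' t a b c) (b' t a b c) (c' t a b c)) ->
  (forall a b c, m 0 a b c = nform l a b c) ->
  exists M, @degeneration F k l M.
Proof.
move=> mp hh mh m0; exists m; split=> // t t0; exists (h t).
  exact: mx4_unit (hh t t0).
by move=> a b c; exists (a' t a b c), (b' t a b c), (c' t a b c); exact: mh.
Qed.

Ltac degeneration_tac :=
  [> by intros; apply: pfun_mx4; pfun_tac
   | let t0 := fresh in intros ? t0; rewrite mul_mx4 scalar_mx4; congr mx4;
     by field; rewrite ?t0 ?pnatr_eq0
   | let t0 := fresh in intros ? ? ? ? t0; rewrite !mul_mx4; congr mx4;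
     by field; rewrite ?t0
   | by intros; congr mx4; ring].

(** The eigenvalues [a] and [a + t*b] collide, with eigenvectors (1, 0) and (1, t) in the first
    coordinate plane. *)
Lemma degeneration_0_1 : exists M, @degeneration F 0 1 M.
Proof.
apply: (@degeneration_intro 0 1
  (fun t a b c => mx4 a b 0 0 0 (a+t*b) 0 0 0 0 c 0 0 0 0 (- a - (a + t*b) - c))
  (fun t => mx4 1 1 0 0 0 t 0 0 0 0 1 0 0 0 0 1)
  (fun t => mx4 1 (- t^-1) 0 0 0 (t^-1) 0 0 0 0 1 0 0 0 0 1)
  (fun t a b c => a) (fun t a b c => a + t*b) (fun t a b c => c)); degeneration_tac.
Qed.

(** The eigenvalues [- a - t*c] and [- a + t*c] collide; their gap accounts for the factor 2 in
    [h]. *)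
Lemma degeneration_1_2 : exists M, @degeneration F 1 2 M.
Proof.
apply: (@degeneration_intro 1 2
  (fun t a b c => mx4 a b 0 0 0 a 0 0 0 0 (- a - t*c) c 0 0 0 (- a + t*c))
  (fun t => mx4 1 0 0 0 0 1 0 0 0 0 1 1 0 0 0 (2%:R*t))
  (fun t => mx4 1 0 0 0 0 1 0 0 0 0 1 (- (2%:R*t)^-1) 0 0 0 ((2%:R*t)^-1))
  (fun t a b c => a) (fun t a b c => b) (fun t a b c => - a - t*c)); degeneration_tac.
Qed.

(** The simple eigenvalue [a+t*b+t*t*c], with eigenvector (1, t, t^2), merges with the double
    eigenvalue [a]. *)
Lemma degeneration_1_3 : exists M, @degeneration F 1 3 M.
Proof.
apply: (@degeneration_intro 1 3
  (fun t a b c => mx4 a b c 0 0 a (b+t*c) 0 0 0 (a+t*b+t*t*c) 0 0 0 0 (- a - a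
    - (a+t*b+t*t*c)))
  (fun t => mx4 1 0 1 0 0 1 t 0 0 0 (t*t) 0 0 0 0 1)
  (fun t => mx4 1 0 (- (t*t)^-1) 0 0 1 (- t^-1) 0 0 0 ((t*t)^-1) 0 0 0 0 1)
  (fun t a b c => a) (fun t a b c => b) (fun t a b c => a+t*b+t*t*c)); degeneration_tac.
Qed.

(** A diagonal one-parameter group scales unwanted entries to zero. The curves ending in forms 5, 7,
    10, 11 and 12 are of the same kind. *)
Lemma degeneration_3_4 : exists M, @degeneration F 3 4 M.
Proof.
apply: (@degeneration_intro 3 4
  (fun t a b c => mx4 a b c 0 0 a (t*b) 0 0 0 a 0 0 0 0 (- a - a - a))
  (fun t => mx4 t 0 0 0 0 t 0 0 0 0 1 0 0 0 0 1)
  (fun t => mx4 (t^-1) 0 0 0 0 (t^-1) 0 0 0 0 1 0 0 0 0 1)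
  (fun t a b c => a) (fun t a b c => b) (fun t a b c => c / t)); degeneration_tac.
Qed.

Lemma degeneration_3_5 : exists M, @degeneration F 3 5 M.
Proof.
apply: (@degeneration_intro 3 5
  (fun t a b c => mx4 a (t*c) b 0 0 a c 0 0 0 a 0 0 0 0 (- a - a - a))
  (fun t => mx4 t 0 0 0 0 1 0 0 0 0 1 0 0 0 0 1)
  (fun t => mx4 (t^-1) 0 0 0 0 1 0 0 0 0 1 0 0 0 0 1)
  (fun t a b c => a) (fun t a b c => c) (fun t a b c => b / t)); degeneration_tac.
Qed.

(** With N the value at (1, 0, 0), the curve is a N + b (N^2 - t^2) + c (N^3 - t^2 N), the traceless
    polynomials in N. For nonzero t the matrix N has eigenvalues t and - t with one Jordan block of
    size two each, whose chains are the columns of [h]; at t = 0 it is a single nilpotent block. *)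
Lemma degeneration_2_6 : exists M, @degeneration F 2 6 M.
Proof.
apply: (@degeneration_intro 2 6
  (fun t a b c => mx4 0 a b c (t*t*a) 0 (a+t*t*c) b 0 0 0 a 0 0 (t*t*a) 0)
  (fun t => mx4 1 0 1 0 t 1 (- t) 1 0 (2%:R*t) 0 (- (2%:R*t)) 0 (t*t+t*t) 0 (t*t+t*t))
  (fun t => mx4 (2%:R^-1) ((2%:R*t)^-1) 0 (- (4%:R*t*t*t)^-1) 0 0
    ((4%:R*t)^-1) ((4%:R*t*t)^-1) (2%:R^-1) (- (2%:R*t)^-1) 0
    ((4%:R*t*t*t)^-1) 0 0 (- (4%:R*t)^-1) ((4%:R*t*t)^-1))
  (fun t a b c => a*t) (fun t a b c => a+(t*b+t*b)+(t*t*c+t*t*c)) (fun t a b c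
    => a-(t*b+t*b)+(t*t*c+t*t*c))); degeneration_tac.
Qed.

(** Tracelessness ties the triple eigenvalue - mu to the simple one 3 mu, where mu = t a + 4 t^2 b.
    The gap 4 mu produces the powers of 4 in the simple eigenvector (1, 4t, 0, 16 t^2). *)
Lemma degeneration_4_9 : exists M, @degeneration F 4 9 M.
Proof.
apply: (@degeneration_intro 4 9
  (fun t a b c => mx4 (- t*a - 4%:R*t*t*b) a c b 0 (- t*a - 4%:R*t*t*b) 0
    (a+4%:R*t*b) 0 0 (- t*a - 4%:R*t*t*b) 0 0 0 0 (3%:R*(t*a + 4%:R*t*t*b)))
  (fun t => mx4 1 0 0 1 0 1 0 (4%:R*t) 0 0 1 0 0 0 0 (16%:R*t*t))
  (fun t => mx4 1 0 0 (- (16%:R*t*t)^-1) 0 1 0 (- (4%:R*t)^-1) 0 0 1 0 0 0 0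
    ((16%:R*t*t)^-1))
  (fun t a b c => - t*a - 4%:R*t*t*b) (fun t a b c => a) (fun t a b c => c)); degeneration_tac.
Qed.

(** The curve from form 4 to form 9 transposed along the antidiagonal, with the two middle basis
    vectors exchanged. *)
Lemma degeneration_5_8 : exists M, @degeneration F 5 8 M.
Proof.
apply: (@degeneration_intro 5 8
  (fun t a b c => mx4 (3%:R*(t*a + 4%:R*t*t*b)) (a+4%:R*t*b) 0 b 0 (- t*a -
    4%:R*t*t*b) 0 a 0 0 (- t*a - 4%:R*t*t*b) c 0 0 0 (- t*a - 4%:R*t*t*b))
  (fun t => mx4 (- (4%:R*t)) 0 (- 1) 1 (16%:R*t*t) 0 0 0 0 (16%:R*t*t) 0 0 0 0
    (16%:R*t*t) 0)
  (fun t => mx4 0 ((16%:R*t*t)^-1) 0 0 0 0 ((16%:R*t*t)^-1) 0 0 0 0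
    ((16%:R*t*t)^-1) 1 ((4%:R*t)^-1) 0 ((16%:R*t*t)^-1))
  (fun t a b c => - t*a - 4%:R*t*t*b) (fun t a b c => a) (fun t a b c => c)); degeneration_tac.
Qed.

Lemma degeneration_6_7 : exists M, @degeneration F 6 7 M.
Proof.
apply: (@degeneration_intro 6 7
  (fun t a b c => mx4 0 a b c 0 0 (t*a) b 0 0 0 a 0 0 0 0)
  (fun t => mx4 t 0 0 0 0 t 0 0 0 0 1 0 0 0 0 1)
  (fun t => mx4 (t^-1) 0 0 0 0 (t^-1) 0 0 0 0 1 0 0 0 0 1)
  (fun t a b c => a) (fun t a b c => b / t) (fun t a b c => c / t)); degeneration_tac.
Qed.

(** The two entries [t*c] complete the map from V/W to W to a regular nilpotent, whose Jordan chain
    is given by the columns of [h]. *)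
Lemma degeneration_6_13 : exists M, @degeneration F 6 13 M.
Proof.
apply: (@degeneration_intro 6 13
  (fun t a b c => mx4 0 (t*c) a b 0 0 b c 0 0 0 0 0 0 (t*c) 0)
  (fun t => mx4 1 0 0 0 0 1 0 0 0 0 0 t 0 0 t 0)
  (fun t => mx4 1 0 0 0 0 1 0 0 0 0 0 (t^-1) 0 0 (t^-1) 0)
  (fun t a b c => t*c) (fun t a b c => t*b) (fun t a b c => t*a)); degeneration_tac.
Qed.

Lemma degeneration_7_11 : exists M, @degeneration F 7 11 M.
Proof.
apply: (@degeneration_intro 7 11
  (fun t a b c => mx4 0 (t*c) (t*b) a 0 0 0 b 0 0 0 c 0 0 0 0)
  (fun t => mx4 t 0 0 0 0 1 0 0 0 0 1 0 0 0 0 1)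
  (fun t => mx4 (t^-1) 0 0 0 0 1 0 0 0 0 1 0 0 0 0 1)
  (fun t a b c => c) (fun t a b c => b) (fun t a b c => a / t)); degeneration_tac.
Qed.

Lemma degeneration_8_11 : exists M, @degeneration F 8 11 M.
Proof.
apply: (@degeneration_intro 8 11
  (fun t a b c => mx4 0 (t*b) 0 a 0 0 0 b 0 0 0 c 0 0 0 0)
  (fun t => mx4 t 0 0 0 0 1 0 0 0 0 1 0 0 0 0 1)
  (fun t => mx4 (t^-1) 0 0 0 0 1 0 0 0 0 1 0 0 0 0 1)
  (fun t a b c => b) (fun t a b c => a / t) (fun t a b c => c)); degeneration_tac.
Qed.

Lemma degeneration_9_10 : exists M, @degeneration F 9 10 M.
Proof.
apply: (@degeneration_intro 9 10
  (fun t a b c => mx4 0 a b c 0 0 0 (t*a) 0 0 0 0 0 0 0 0)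
  (fun t => mx4 t 0 0 0 0 t 0 0 0 0 t 0 0 0 0 1)
  (fun t => mx4 (t^-1) 0 0 0 0 (t^-1) 0 0 0 0 (t^-1) 0 0 0 0 1)
  (fun t a b c => a) (fun t a b c => c / t) (fun t a b c => b)); degeneration_tac.
Qed.

Lemma degeneration_13_12 : exists M, @degeneration F 13 12 M.
Proof.
apply: (@degeneration_intro 13 12
  (fun t a b c => mx4 0 0 a b 0 0 (t*b) c 0 0 0 0 0 0 0 0)
  (fun t => mx4 1 0 0 0 0 t 0 0 0 0 1 0 0 0 0 1)
  (fun t => mx4 1 0 0 0 0 (t^-1) 0 0 0 0 1 0 0 0 0 1)
  (fun t a b c => a) (fun t a b c => b) (fun t a b c => c / t)); degeneration_tac.
Qed.

End Degenerations.

(** * Closed loci from multilinear conditions *)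

Section MultilinearConditions.
Variables (F : fieldType) (p q k : nat).
Local Notation V := 'M[F]_(p, q).
Local Notation pl := (plucker V k).

Definition lin1 (T : V -> F) : Prop :=
  forall a u v, T (a *: u + v) = a * T u + T v.

Lemma contr_lin (U : {vspace V}) (T : V -> F) : \dim U = k -> lin1 T ->
  (forall f m, T (contr (pl U) f m) = 0) -> forall u, u \in U -> T u = 0.
Proof.
move=> dU Tl; apply: contr_ind => // [|a u v Tu Tv]; last first.
  by rewrite Tl Tu Tv mulr0 addr0.
have := Tl 1 0 0; rewrite scaler0 addr0 mul1r => /(congr1 (fun t => t - T 0)).
by rewrite subrr addrK.
Qed.

Variable W : {vspace V}.
Local Notation X := (grass V k W).

(** By [contr_lin] each argument can be restricted to contractions, which are linear in the Pluecker
    coordinates. The index type [I] may be infinite, since a closed set is cut out by an arbitrary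
    set of polynomials. *)
Lemma zclosed_bi (I : Type) (d : nat) (T : I -> V -> V -> F) :
  (forall i y, lin1 (T i ^~ y)) -> (forall i x, lin1 (T i x)) ->
  (forall i w w', hmx 1 w -> hmx 1 w' -> @hpoly F #|plucker_idx V k| d
    (fun c => T i (w c) (w' c))) ->
  zclosed pl X (X `&` [set U : {vspace V} | forall i x y,
    x \in U -> y \in U -> T i x y = 0]).
Proof.
move=> T1 T2 Th.
pose J := (I * (plucker_idx V k * 'I_k) * (plucker_idx V k * 'I_k))%type.
have := @zclosed_zeros _ _ _ J pl X (fun=> d) (fun j c =>
  T j.1.1 (contr c j.1.2.1 j.1.2.2) (contr c j.2.1 j.2.2))
  (fun j => Th _ _ _ (hmx_contr _ _) (hmx_contr _ _)).
congr (zclosed _ _ _); apply/seteqP; split=> U [XU UT]; split=> //=.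
  have dU := proj2 XU => i x y xU yU; move: x xU; apply: (contr_lin dU) => // f m.
  move: y yU; apply: (contr_lin dU) => // f' m'.
  exact: (UT (i, (f, m), (f', m'))).
by move=> j; apply: UT; apply: contr_in; exact: (proj2 XU).
Qed.

Lemma zclosed_tri (I : Type) (d : nat) (T : I -> V -> V -> V -> F) :
  (forall i y z, lin1 (fun x => T i x y z)) ->
  (forall i x z, lin1 (fun y => T i x y z)) ->
  (forall i x y, lin1 (T i x y)) ->
  (forall i w w' w'', hmx 1 w -> hmx 1 w' -> hmx 1 w'' ->
    @hpoly F #|plucker_idx V k| d (fun c => T i (w c) (w' c) (w'' c))) ->
  zclosed pl X (X `&` [set U : {vspace V} | forall i x y z,
    x \in U -> y \in U -> z \in U -> T i x y z = 0]).
Proof.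
move=> T1 T2 T3 Th.
pose J := (I * (plucker_idx V k * 'I_k) * (plucker_idx V k * 'I_k) *
  (plucker_idx V k * 'I_k))%type.
have := @zclosed_zeros _ _ _ J pl X (fun=> d) (fun j c =>
  T j.1.1.1 (contr c j.1.1.2.1 j.1.1.2.2) (contr c j.1.2.1 j.1.2.2)
    (contr c j.2.1 j.2.2))
  (fun j => Th _ _ _ _ (hmx_contr _ _) (hmx_contr _ _) (hmx_contr _ _)).
congr (zclosed _ _ _); apply/seteqP; split=> U [XU UT]; split=> //=.
  have dU := proj2 XU => i x y z xU yU zU; move: x xU; apply: (contr_lin dU) => // f m.
  move: y yU; apply: (contr_lin dU) => // f' m'.
  move: z zU; apply: (contr_lin dU) => // f'' m''.
  exact: (UT (i, (f, m), (f', m'), (f'', m''))).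
by move=> j; apply: UT; apply: contr_in; exact: (proj2 XU).
Qed.

(** Six arguments allow the comparison of two values of the trilinear expression [nu]. *)
Lemma zclosed_hexa (I : Type) (d : nat) (T : I -> V -> V -> V -> V -> V -> V -> F) :
  (forall i y z x' y' z', lin1 (fun x => T i x y z x' y' z')) ->
  (forall i x z x' y' z', lin1 (fun y => T i x y z x' y' z')) ->
  (forall i x y x' y' z', lin1 (fun z => T i x y z x' y' z')) ->
  (forall i x y z y' z', lin1 (fun x' => T i x y z x' y' z')) ->
  (forall i x y z x' z', lin1 (fun y' => T i x y z x' y' z')) ->
  (forall i x y z x' y', lin1 (T i x y z x' y')) ->
  (forall i w1 w2 w3 w4 w5 w6, hmx 1 w1 -> hmx 1 w2 -> hmx 1 w3 -> hmx 1 w4 ->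
    hmx 1 w5 -> hmx 1 w6 -> @hpoly F #|plucker_idx V k| d
      (fun c => T i (w1 c) (w2 c) (w3 c) (w4 c) (w5 c) (w6 c))) ->
  zclosed pl X (X `&` [set U : {vspace V} | forall i x y z x' y' z',
    x \in U -> y \in U -> z \in U -> x' \in U -> y' \in U -> z' \in U ->
    T i x y z x' y' z' = 0]).
Proof.
move=> T1 T2 T3 T4 T5 T6 Th.
pose K := (plucker_idx V k * 'I_k)%type.
have := @zclosed_zeros _ _ _ (I * (K * K * K) * (K * K * K)) pl X (fun=> d)
  (fun j c => T j.1.1 (contr c j.1.2.1.1.1 j.1.2.1.1.2)
    (contr c j.1.2.1.2.1 j.1.2.1.2.2) (contr c j.1.2.2.1 j.1.2.2.2)
    (contr c j.2.1.1.1 j.2.1.1.2) (contr c j.2.1.2.1 j.2.1.2.2)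
    (contr c j.2.2.1 j.2.2.2))
  (fun j => Th _ _ _ _ _ _ _ (hmx_contr _ _) (hmx_contr _ _) (hmx_contr _ _)
    (hmx_contr _ _) (hmx_contr _ _) (hmx_contr _ _)).
congr (zclosed _ _ _); apply/seteqP; split=> U [XU UT]; split=> //=.
  have dU := proj2 XU => i x y z x' y' z' xU yU zU xU' yU' zU'.
  move: x xU; apply: (contr_lin dU) => // f1 m1.
  move: y yU; apply: (contr_lin dU) => // f2 m2.
  move: z zU; apply: (contr_lin dU) => // f3 m3.
  move: x' xU'; apply: (contr_lin dU) => // f4 m4.
  move: y' yU'; apply: (contr_lin dU) => // f5 m5.
  move: z' zU'; apply: (contr_lin dU) => // f6 m6.
  exact: (UT (i, ((f1, m1), (f2, m2), (f3, m3)), ((f4, m4), (f5, m5), (f6, m6)))).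
by move=> j; apply: UT; apply: contr_in; exact: (proj2 XU).
Qed.

End MultilinearConditions.

(** * Conjugation invariant conditions on subspaces *)

Section ClosedConditions.
Variable F : fieldType.
Implicit Types (f : 'rV[F]_4) (v : 'cV[F]_4) (x y z : 'M[F]_4).
Implicit Type U : {vspace 'M[F]_4}.

(** Coefficients against arbitrary [f] and [v] instead of matrix entries: conjugation only moves [f]
    and [v] ([ent_conj]), so that conditions quantified over them are invariant. *)
Definition ent f x v : F := (f *m x *m v) 0 0.

Lemma ent_lin f v : lin1 (fun x => ent f x v).
Proof.
move=> a x y; rewrite /ent mulmxDr mulmxDl -scalemxAr -scalemxAl.
by rewrite [LHS]mxE; congr (_ + _); rewrite [LHS]mxE.
Qed.

Lemma hpoly_ent n d f (w : ('I_n -> F) -> 'M_4) v :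
  hmx d w -> hpoly d (fun c => ent f (w c) v).
Proof. by move=> hw; exact: (hmxMr v (hmxMl f hw)). Qed.

Lemma ent_delta x i j : ent (delta_mx 0 i) x (delta_mx j 0) = x i j.
Proof. by rewrite /ent -rowE -colE !mxE. Qed.

Lemma ent_conj g f x v : ent f (g *m x *m invmx g) v = ent (f *m g) x (invmx g *m v).
Proof. by rewrite /ent !mulmxA. Qed.

Definition det3 (a1 a2 a3 b1 b2 b3 c1 c2 c3 : F) : F :=
  a1 * (b2 * c3 - b3 * c2) - a2 * (b1 * c3 - b3 * c1) + a3 * (b1 * c2 - b2 * c1).

(* For x, y, z in Hom(V/W, W) with \dim W = 2, a skew E on the dual of V/W and
   a skew Om on W turn the transpose of y into its adjugate, and the value is
   x adj(y) z - z adj(y) x. *)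
Definition nu (E Om x y z : 'M[F]_4) : 'M[F]_4 :=
  x *m E *m y^T *m Om *m z - z *m E *m y^T *m Om *m x.

(** The formula makes the vectors [x *m v] pairwise proportional; in [kernel_hyper] the same is
    asked of the rows [f *m x]. *)
Definition image_line U : Prop := forall f f' v v' x y, x \in U -> y \in U ->
  ent f x v * ent f' y v' - ent f' x v * ent f y v' = 0.

Definition kernel_hyper U : Prop := forall f f' v v' x y, x \in U -> y \in U ->
  ent f x v * ent f' y v' - ent f x v' * ent f' y v = 0.

Definition square_zero U : Prop := forall x y, x \in U -> y \in U -> x *m y = 0.

(** Any three of the vectors [x *m v] are dependent. The next condition says the same of the rows
    [f *m x], so that the common kernel has dimension at least two. *)
Definition image_plane U : Prop := forall f1 f2 f3 v1 v2 v3 x y z,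
  x \in U -> y \in U -> z \in U ->
  det3 (ent f1 x v1) (ent f2 x v1) (ent f3 x v1)
       (ent f1 y v2) (ent f2 y v2) (ent f3 y v2)
       (ent f1 z v3) (ent f2 z v3) (ent f3 z v3) = 0.

Definition kernel_plane U : Prop := forall f1 f2 f3 v1 v2 v3 x y z,
  x \in U -> y \in U -> z \in U ->
  det3 (ent f1 x v1) (ent f1 x v2) (ent f1 x v3)
       (ent f2 y v1) (ent f2 y v2) (ent f2 y v3)
       (ent f3 z v1) (ent f3 z v2) (ent f3 z v3) = 0.

(** The rows of the normal vector computed by [nu] are proportional. All skew [E] and [Om] are
    allowed because W varies with [U], so no fixed pair of forms is nonzero on every V/W and W. *)
Definition nu_rank1 U : Prop := forall E Om f f' v v' x y z x' y' z',
  E^T = - E -> Om^T = - Om ->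
  x \in U -> y \in U -> z \in U -> x' \in U -> y' \in U -> z' \in U ->
  ent f (nu E Om x y z) v * ent f' (nu E Om x' y' z') v' -
  ent f (nu E Om x y z) v' * ent f' (nu E Om x' y' z') v = 0.

Definition flag_type U : Prop :=
  [/\ square_zero U, image_plane U, kernel_plane U & nu_rank1 U].

Lemma nu_lin1 E Om y z a u u' :
  nu E Om (a *: u + u') y z = a *: nu E Om u y z + nu E Om u' y z.
Proof.
rewrite /nu !(mulmxDl, mulmxDr) -!(scalemxAl, scalemxAr) scalerBr opprD.
by rewrite addrACA.
Qed.

Lemma nu_lin2 E Om x z a u u' :
  nu E Om x (a *: u + u') z = a *: nu E Om x u z + nu E Om x u' z.
Proof.
rewrite /nu linearD linearZ /= !(mulmxDl, mulmxDr) -!scalemxAr -!scalemxAl.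
by rewrite scalerBr opprD addrACA.
Qed.

Lemma nu_lin3 E Om x y a u u' :
  nu E Om x y (a *: u + u') = a *: nu E Om x y u + nu E Om x y u'.
Proof.
rewrite /nu !(mulmxDl, mulmxDr) -!(scalemxAl, scalemxAr) scalerBr opprD.
by rewrite addrACA.
Qed.

Lemma hmx_nu n E Om (w1 w2 w3 : ('I_n -> F) -> 'M_4) :
  hmx 1 w1 -> hmx 1 w2 -> hmx 1 w3 -> hmx 3 (fun c => nu E Om (w1 c) (w2 c) (w3 c)).
Proof.
move=> h1 h2 h3; apply: hmxB.
  exact: (hmxM (hmxMr Om (hmxM (hmxMr E h1) (hmxT h2))) h3).
exact: (hmxM (hmxMr Om (hmxM (hmxMr E h3) (hmxT h2))) h1).
Qed.

Lemma nu_conj g E Om x y z : g \in unitmx ->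
  nu E Om (g *m x *m invmx g) (g *m y *m invmx g) (g *m z *m invmx g) =
  g *m nu (invmx g *m E *m (invmx g)^T) (g^T *m Om *m g) x y z *m invmx g.
Proof.
by move=> gu; rewrite /nu !(mulmxBr, mulmxBl) !trmx_mul !mulmxA.
Qed.

Local Notation X := (grass 'M[F]_4 3 (sl F 4)).
Local Notation pl := (plucker 'M[F]_4 3).

Lemma closed_Ab : closed_in_grass (Ab F 4).
Proof.
have := @zclosed_bi F 4 4 3 (sl F 4) ('rV[F]_4 * 'cV[F]_4)%type 2
  (fun i x y => ent i.1 (x *m y - y *m x) i.2) _ _ _.
rewrite /closed_in_grass /= => H.
have <- : X `&` [set U : {vspace 'M[F]_4} | forall (i : 'rV[F]_4 * 'cV[F]_4) x y,
    x \in U -> y \in U -> ent i.1 (x *m y - y *m x) i.2 = 0] = Ab F 4.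
  apply/seteqP; split=> U [XU UE]; split=> //=.
    by move=> x y xU yU; apply/matrixP => i j; rewrite -ent_delta [RHS]mxE;
      exact: (UE (delta_mx 0 i, delta_mx j 0)).
  by move=> i x y xU yU; rewrite [_ - _](UE x y) // /ent mulmx0 mul0mx mxE.
apply: H => [i y a u v|i x a u v|i w w' hw hw'] /=.
- by rewrite -ent_lin scalerBr !(mulmxDl, mulmxDr) -scalemxAl -scalemxAr opprD addrACA.
- by rewrite -ent_lin scalerBr !(mulmxDl, mulmxDr) -scalemxAl -scalemxAr opprD addrACA.
by apply: hpoly_ent; apply: hmxB; [exact: (hmxM hw hw')|exact: (hmxM hw' hw)].
Qed.

End ClosedConditions.

Section ConjugationInvariance.
Variable F : fieldType.
Implicit Type U : {vspace 'M[F]_4}.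

Definition trace_zero U : Prop := forall x, x \in U -> \tr (x *m x) = 0.

Definition cube_zero U : Prop := forall x, x \in U -> x *m x *m x = 0.

Definition reduced U : Prop := forall x, x \in U -> x *m x = 0 -> x = 0.

Definition nil2 U : Prop :=
  forall x, x \in U -> x *m x *m x = 0 -> x *m x = 0.

Definition sq0_image_line U : Prop := forall f f' v v' x y,
  x \in U -> y \in U -> x *m x = 0 -> y *m y = 0 ->
  ent f x v * ent f' y v' - ent f' x v * ent f y v' = 0.

Definition sq0_kernel_hyper U : Prop := forall f f' v v' x y,
  x \in U -> y \in U -> x *m x = 0 -> y *m y = 0 ->
  ent f x v * ent f' y v' - ent f x v' * ent f' y v = 0.

Variable g : 'M[F]_4.
Hypothesis gu : g \in unitmx.

Let conjM (x y : 'M[F]_4) :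
  g *m x *m invmx g *m (g *m y *m invmx g) = g *m (x *m y) *m invmx g.
Proof. by rewrite !mulmxA mulmxKV. Qed.

Let conj0 (x : 'M[F]_4) : g *m x *m invmx g = 0 -> x = 0.
Proof.
move=> /(congr1 (fun y => invmx g *m y *m g)).
by rewrite mulmx0 mul0mx !mulmxA mulVmx // mul1mx mulmxKV.
Qed.

Lemma image_line_conj U : image_line U -> image_line (conj_act g U).
Proof.
move=> UE f f' v v' _ _ /(conj_inP gu)[x xU ->] /(conj_inP gu)[y yU ->].
by rewrite !ent_conj UE.
Qed.

Lemma kernel_hyper_conj U : kernel_hyper U -> kernel_hyper (conj_act g U).
Proof.
move=> UE f f' v v' _ _ /(conj_inP gu)[x xU ->] /(conj_inP gu)[y yU ->].
by rewrite !ent_conj UE.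
Qed.

Lemma square_zero_conj U : square_zero U -> square_zero (conj_act g U).
Proof.
move=> UE _ _ /(conj_inP gu)[x xU ->] /(conj_inP gu)[y yU ->].
by rewrite conjM (UE x y) // mulmx0 mul0mx.
Qed.

Lemma image_plane_conj U : image_plane U -> image_plane (conj_act g U).
Proof.
move=> UE f1 f2 f3 v1 v2 v3 _ _ _ /(conj_inP gu)[x xU ->]
  /(conj_inP gu)[y yU ->] /(conj_inP gu)[z zU ->].
by rewrite !ent_conj UE.
Qed.

Lemma kernel_plane_conj U : kernel_plane U -> kernel_plane (conj_act g U).
Proof.
move=> UE f1 f2 f3 v1 v2 v3 _ _ _ /(conj_inP gu)[x xU ->]
  /(conj_inP gu)[y yU ->] /(conj_inP gu)[z zU ->].
by rewrite !ent_conj UE.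
Qed.

Lemma nu_rank1_conj U : nu_rank1 U -> nu_rank1 (conj_act g U).
Proof.
move=> UE E Om f f' v v' _ _ _ _ _ _ Es Os /(conj_inP gu)[x xU ->]
  /(conj_inP gu)[y yU ->] /(conj_inP gu)[z zU ->] /(conj_inP gu)[x' xU' ->]
  /(conj_inP gu)[y' yU' ->] /(conj_inP gu)[z' zU' ->].
rewrite !nu_conj // !ent_conj UE // !trmx_mul ?trmxK ?Es ?Os.
  by rewrite mulNmx mulmxN mulmxA.
by rewrite mulNmx mulmxN mulmxA.
Qed.

Lemma flag_type_conj U : flag_type U -> flag_type (conj_act g U).
Proof.
move=> [U1 U2 U3 U4]; split; [exact: square_zero_conj | exact: image_plane_conj
  | exact: kernel_plane_conj | exact: nu_rank1_conj].
Qed.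

Lemma trace_zero_conj U : trace_zero U -> trace_zero (conj_act g U).
Proof.
move=> UE _ /(conj_inP gu)[x xU ->].
by rewrite conjM mxtrace_mulC mulKmx // UE.
Qed.

Lemma cube_zero_conj U : cube_zero U -> cube_zero (conj_act g U).
Proof.
by move=> UE _ /(conj_inP gu)[x xU ->]; rewrite !conjM (UE x) // mulmx0 mul0mx.
Qed.

Lemma reduced_conj U : reduced U -> reduced (conj_act g U).
Proof.
move=> UE _ /(conj_inP gu)[x xU ->]; rewrite conjM => /conj0 /(UE x xU) ->.
by rewrite mulmx0 mul0mx.
Qed.

Lemma nil2_conj U : nil2 U -> nil2 (conj_act g U).
Proof.
move=> UE _ /(conj_inP gu)[x xU ->]; rewrite !conjM => /conj0 /(UE x xU) ->.
by rewrite mulmx0 mul0mx.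
Qed.

Lemma sq0_image_line_conj U : sq0_image_line U -> sq0_image_line (conj_act g U).
Proof.
move=> UE f f' v v' _ _ /(conj_inP gu)[x xU ->] /(conj_inP gu)[y yU ->].
by rewrite !conjM => /conj0 x2 /conj0 y2; rewrite !ent_conj UE.
Qed.

Lemma sq0_kernel_hyper_conj U :
  sq0_kernel_hyper U -> sq0_kernel_hyper (conj_act g U).
Proof.
move=> UE f f' v v' _ _ /(conj_inP gu)[x xU ->] /(conj_inP gu)[y yU ->].
by rewrite !conjM => /conj0 x2 /conj0 y2; rewrite !ent_conj UE.
Qed.

End ConjugationInvariance.

(** * Closedness of the three loci *)

Section ClosedLoci.
Variable F : fieldType.
Local Notation closed_Ab_cap P := (closed_in_grass (Ab F 4 `&` [set U | P U])).

Local Notation X := (grass 'M[F]_4 3 (sl F 4)).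

Lemma closed_Ab_and (P : {vspace 'M[F]_4} -> Prop) :
  closed_in_grass (X `&` [set U | P U]) -> closed_Ab_cap P.
Proof.
move=> /(zclosedI (@closed_Ab F)); congr (zclosed _ _ _).
by apply/seteqP; split=> U /=; [move=> [? [? ?] ] | move=> [AU PU]; split=> //;
  split=> //; have [] := AU].
Qed.

Lemma closed_image_line : closed_Ab_cap (@image_line F).
Proof.
apply: closed_Ab_and.
have := @zclosed_bi F 4 4 3 (sl F 4)
  ('rV[F]_4 * 'rV[F]_4 * 'cV[F]_4 * 'cV[F]_4)%type 2
  (fun i x y => ent i.1.1.1 x i.1.2 * ent i.1.1.2 y i.2
    - ent i.1.1.2 x i.1.2 * ent i.1.1.1 y i.2).
rewrite /closed_in_grass /=; set Z := _ `&` _; set Z' := _ `&` _ => H.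
suff -> : Z' = Z.
  apply: H => [i y a u v|i x a u v|i w w' hw hw'].
  - by rewrite !ent_lin; ring.
  - by rewrite !ent_lin; ring.
  by apply: hpolyB; apply: (@hpolyM _ _ 1 1); exact: hpoly_ent.
apply/seteqP; split=> U [XU UE]; split=> //=.
  by move=> i x y xU yU; exact: UE.
by move=> f f' v v' x y xU yU; exact: (UE (f, f', v, v') x y xU yU).
Qed.

Lemma closed_kernel_hyper : closed_Ab_cap (@kernel_hyper F).
Proof.
apply: closed_Ab_and.
have := @zclosed_bi F 4 4 3 (sl F 4)
  ('rV[F]_4 * 'rV[F]_4 * 'cV[F]_4 * 'cV[F]_4)%type 2
  (fun i x y => ent i.1.1.1 x i.1.2 * ent i.1.1.2 y i.2
    - ent i.1.1.1 x i.2 * ent i.1.1.2 y i.1.2).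
rewrite /closed_in_grass /=; set Z := _ `&` _; set Z' := _ `&` _ => H.
suff -> : Z' = Z.
  apply: H => [i y a u v|i x a u v|i w w' hw hw'].
  - by rewrite !ent_lin; ring.
  - by rewrite !ent_lin; ring.
  by apply: hpolyB; apply: (@hpolyM _ _ 1 1); exact: hpoly_ent.
apply/seteqP; split=> U [XU UE]; split=> //=.
  by move=> i x y xU yU; exact: UE.
by move=> f f' v v' x y xU yU; exact: (UE (f, f', v, v') x y xU yU).
Qed.

Lemma hpoly_det3 n (a1 a2 a3 b1 b2 b3 c1 c2 c3 : ('I_n -> F) -> F) :
  hpoly 1 a1 -> hpoly 1 a2 -> hpoly 1 a3 -> hpoly 1 b1 -> hpoly 1 b2 ->
  hpoly 1 b3 -> hpoly 1 c1 -> hpoly 1 c2 -> hpoly 1 c3 ->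
  hpoly 3 (fun v => det3 (a1 v) (a2 v) (a3 v) (b1 v) (b2 v) (b3 v)
    (c1 v) (c2 v) (c3 v)).
Proof.
move=> *; apply: hpolyD; first apply: hpolyB;
  by apply: (@hpolyM _ _ 1 2) => //; apply: hpolyB; exact: (@hpolyM _ _ 1 1).
Qed.

Let closed_square_zero : closed_in_grass (X `&` [set U | square_zero U]).
Proof.
have := @zclosed_bi F 4 4 3 (sl F 4) ('rV[F]_4 * 'cV[F]_4)%type 2
  (fun i x y => ent i.1 (x *m y) i.2).
rewrite /closed_in_grass /=; set Z := _ `&` _; set Z' := _ `&` _ => H.
suff -> : Z' = Z.
  apply: H => [i y a u v|i x a u v|i w w' hw hw'].
  - by rewrite -ent_lin mulmxDl -scalemxAl.
  - by rewrite -ent_lin mulmxDr -scalemxAr.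
  by apply: hpoly_ent; exact: (hmxM hw hw').
apply/seteqP; split=> U [XU UE]; split=> //=.
  by move=> i x y xU yU; rewrite (UE x y) // /ent mulmx0 mul0mx mxE.
move=> x y xU yU; apply/matrixP => i j; rewrite -ent_delta [RHS]mxE.
exact: (UE (delta_mx 0 i, delta_mx j 0)).
Qed.

Let closed_image_plane : closed_in_grass (X `&` [set U | image_plane U]).
Proof.
have := @zclosed_tri F 4 4 3 (sl F 4)
  ('rV[F]_4 * 'rV[F]_4 * 'rV[F]_4 * 'cV[F]_4 * 'cV[F]_4 * 'cV[F]_4)%type 3
  (fun i x y z => let: (f1, f2, f3, v1, v2, v3) := i in
    det3 (ent f1 x v1) (ent f2 x v1) (ent f3 x v1)
       (ent f1 y v2) (ent f2 y v2) (ent f3 y v2)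
       (ent f1 z v3) (ent f2 z v3) (ent f3 z v3)).
rewrite /closed_in_grass /=; set Z := _ `&` _; set Z' := _ `&` _ => H.
suff -> : Z' = Z.
  apply: H => [ [ [ [ [ [f1 f2] f3] v1] v2] v3] y z a u v
    |[ [ [ [ [f1 f2] f3] v1] v2] v3] x z a u v
    |[ [ [ [ [f1 f2] f3] v1] v2] v3] x y a u v
    |[ [ [ [ [f1 f2] f3] v1] v2] v3] w w' w'' hw hw' hw''].
  - by rewrite /det3 !ent_lin; ring.
  - by rewrite /det3 !ent_lin; ring.
  - by rewrite /det3 !ent_lin; ring.
  by apply: hpoly_det3; exact: hpoly_ent.
apply/seteqP; split=> U [XU UE]; split=> //=.
  by move=> [ [ [ [ [f1 f2] f3] v1] v2] v3] x y z xU yU zU; exact: UE.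
by move=> f1 f2 f3 v1 v2 v3 x y z; exact: (UE (f1, f2, f3, v1, v2, v3)).
Qed.

Let closed_kernel_plane : closed_in_grass (X `&` [set U | kernel_plane U]).
Proof.
have := @zclosed_tri F 4 4 3 (sl F 4)
  ('rV[F]_4 * 'rV[F]_4 * 'rV[F]_4 * 'cV[F]_4 * 'cV[F]_4 * 'cV[F]_4)%type 3
  (fun i x y z => let: (f1, f2, f3, v1, v2, v3) := i in
    det3 (ent f1 x v1) (ent f1 x v2) (ent f1 x v3)
       (ent f2 y v1) (ent f2 y v2) (ent f2 y v3)
       (ent f3 z v1) (ent f3 z v2) (ent f3 z v3)).
rewrite /closed_in_grass /=; set Z := _ `&` _; set Z' := _ `&` _ => H.
suff -> : Z' = Z.
  apply: H => [ [ [ [ [ [f1 f2] f3] v1] v2] v3] y z a u v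
    |[ [ [ [ [f1 f2] f3] v1] v2] v3] x z a u v
    |[ [ [ [ [f1 f2] f3] v1] v2] v3] x y a u v
    |[ [ [ [ [f1 f2] f3] v1] v2] v3] w w' w'' hw hw' hw''].
  - by rewrite /det3 !ent_lin; ring.
  - by rewrite /det3 !ent_lin; ring.
  - by rewrite /det3 !ent_lin; ring.
  by apply: hpoly_det3; exact: hpoly_ent.
apply/seteqP; split=> U [XU UE]; split=> //=.
  by move=> [ [ [ [ [f1 f2] f3] v1] v2] v3] x y z xU yU zU; exact: UE.
by move=> f1 f2 f3 v1 v2 v3 x y z; exact: (UE (f1, f2, f3, v1, v2, v3)).
Qed.

Let closed_nu_rank1 : closed_in_grass (X `&` [set U | nu_rank1 U]).
Proof.
(* Skewness restricts the equations and not [U], hence it is moved into the index type. *)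
pose skew := {E : 'M[F]_4 | E^T = - E}.
have := @zclosed_hexa F 4 4 3 (sl F 4)
  (skew * skew * 'rV[F]_4 * 'rV[F]_4 * 'cV[F]_4 * 'cV[F]_4)%type 6
  (fun i x y z x' y' z' => let: (E, Om, f, f', v, v') := i in
  ent f (nu (sval E) (sval Om) x y z) v * ent f' (nu (sval E) (sval Om) x' y' z') v' -
  ent f (nu (sval E) (sval Om) x y z) v' * ent f' (nu (sval E) (sval Om) x' y' z') v).
rewrite /closed_in_grass /=; set Z := _ `&` _; set Z' := _ `&` _ => H.
suff -> : Z' = Z.
  apply: H => [ [ [ [ [ [E Om] f] f'] v] v'] ? ? ? ? ? a u u'
    |[ [ [ [ [E Om] f] f'] v] v'] ? ? ? ? ? a u u'
    |[ [ [ [ [E Om] f] f'] v] v'] ? ? ? ? ? a u u'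
    |[ [ [ [ [E Om] f] f'] v] v'] ? ? ? ? ? a u u'
    |[ [ [ [ [E Om] f] f'] v] v'] ? ? ? ? ? a u u'
    |[ [ [ [ [E Om] f] f'] v] v'] ? ? ? ? ? a u u'
    |[ [ [ [ [E Om] f] f'] v] v'] w1 w2 w3 w4 w5 w6 h1 h2 h3 h4 h5 h6].
  - by rewrite nu_lin1 !ent_lin; ring.
  - by rewrite nu_lin2 !ent_lin; ring.
  - by rewrite nu_lin3 !ent_lin; ring.
  - by rewrite nu_lin1 !ent_lin; ring.
  - by rewrite nu_lin2 !ent_lin; ring.
  - by rewrite nu_lin3 !ent_lin; ring.
  by apply: hpolyB; apply: (@hpolyM _ _ 3 3); apply: hpoly_ent; exact: hmx_nu.
apply/seteqP; split=> U [XU UE]; split=> //=.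
  by move=> [ [ [ [ [ [E Es] [Om Os] ] f] f'] v] v'] *; exact: UE.
move=> E Om f f' v v' x y z x' y' z' Es Os.
exact: (UE (exist _ E Es, exist _ Om Os, f, f', v, v')).
Qed.

Lemma closed_flag_type : closed_Ab_cap (@flag_type F).
Proof.
apply: closed_Ab_and.
have := zclosedI (zclosedI closed_square_zero closed_image_plane)
  (zclosedI closed_kernel_plane closed_nu_rank1).
congr (zclosed _ _ _); apply/seteqP; split=> U /=.
  by move=> [ [ [XU U1] [_ U2] ] [ [_ U3] [_ U4] ] ].
by move=> [XU [U1 U2 U3 U4] ]; split; split; split.
Qed.

End ClosedLoci.

(** * Evaluation of the conditions on the normal forms *)

Section Witnesses.
Variable F : fieldType.
Implicit Type U : {vspace 'M[F]_4}.

Lemma image_lineN U x y i j p q : x \in U -> y \in U ->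
  x i p * y j q - x j p * y i q = 1 -> ~ image_line U.
Proof.
move=> xU yU + UE.
have := UE (delta_mx 0 i) (delta_mx 0 j) (delta_mx p 0) (delta_mx q 0) x y xU yU.
by rewrite !ent_delta => -> /esym/eqP; rewrite oner_eq0.
Qed.

Lemma kernel_hyperN U x y i j p q : x \in U -> y \in U ->
  x i p * y j q - x i q * y j p = 1 -> ~ kernel_hyper U.
Proof.
move=> xU yU + UE.
have := UE (delta_mx 0 i) (delta_mx 0 j) (delta_mx p 0) (delta_mx q 0) x y xU yU.
by rewrite !ent_delta => -> /esym/eqP; rewrite oner_eq0.
Qed.

Lemma square_zeroN U x y i j : x \in U -> y \in U ->
  (x *m y) i j = 1 -> ~ square_zero U.
Proof.
move=> xU yU + UE; rewrite (UE x y) // mxE => /esym/eqP.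
by rewrite oner_eq0.
Qed.

Lemma image_planeN U x y z p q r : x \in U -> y \in U -> z \in U ->
  det3 (x i0 p) (x i1 p) (x i2 p) (y i0 q) (y i1 q) (y i2 q)
    (z i0 r) (z i1 r) (z i2 r) = 1 -> ~ image_plane U.
Proof.
move=> xU yU zU + UE.
have := UE (delta_mx 0 i0) (delta_mx 0 i1) (delta_mx 0 i2) (delta_mx p 0)
  (delta_mx q 0) (delta_mx r 0) x y z xU yU zU.
by rewrite !ent_delta => -> /esym/eqP; rewrite oner_eq0.
Qed.

Lemma kernel_planeN U x y z i j k : x \in U -> y \in U -> z \in U ->
  det3 (x i i1) (x i i2) (x i i3) (y j i1) (y j i2) (y j i3)
    (z k i1) (z k i2) (z k i3) = 1 -> ~ kernel_plane U.
Proof.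
move=> xU yU zU + UE.
have := UE (delta_mx 0 i) (delta_mx 0 j) (delta_mx 0 k) (delta_mx i1 0)
  (delta_mx i2 0) (delta_mx i3 0) x y z xU yU zU.
by rewrite !ent_delta => -> /esym/eqP; rewrite oner_eq0.
Qed.

Lemma sq0_image_lineN U x y i j p q : x \in U -> y \in U ->
  x *m x = 0 -> y *m y = 0 ->
  x i p * y j q - x j p * y i q = 1 -> ~ sq0_image_line U.
Proof.
move=> xU yU xx yy + UE.
have := UE (delta_mx 0 i) (delta_mx 0 j) (delta_mx p 0) (delta_mx q 0) x y xU yU
  xx yy.
by rewrite !ent_delta => -> /esym/eqP; rewrite oner_eq0.
Qed.

Lemma sq0_kernel_hyperN U x y i j p q : x \in U -> y \in U ->
  x *m x = 0 -> y *m y = 0 ->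
  x i p * y j q - x i q * y j p = 1 -> ~ sq0_kernel_hyper U.
Proof.
move=> xU yU xx yy + UE.
have := UE (delta_mx 0 i) (delta_mx 0 j) (delta_mx p 0) (delta_mx q 0) x y xU yU
  xx yy.
by rewrite !ent_delta => -> /esym/eqP; rewrite oner_eq0.
Qed.

End Witnesses.

Section FailedConditions.
Variable F : numClosedFieldType.
Local Notation rep := (rep F).
Local Notation e1 k := (nform k (1 : F) 0 0).
Local Notation e2 k := (nform k (0 : F) 1 0).
Local Notation e3 k := (nform k (0 : F) 0 1).

Ltac wit := rewrite ?nform_in // /det3 ?mxE ?sum4 ?mxE /=; ring.

(** One choice of entries refutes [image_line] and [kernel_hyper] together. Forms 10 and 11 satisfy
    one of them each and get separate witnesses. *)
Lemma rank2_rep k : (k < 14)%N -> k != 10 -> k != 11 -> exists x y i j p q,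
  [/\ x \in rep k, y \in rep k, x i p * y j q - x j p * y i q = 1 &
      x i p * y j q - x i q * y j p = 1].
Proof.
do 14?[case: k => [|k] ] => // _ _ _.
- by exists (e1 0), (e2 0), i0, i1, i0, i1; split; wit.
- by exists (e1 1), (e1 1), i0, i1, i0, i1; split; wit.
- by exists (e1 2), (e1 2), i0, i1, i0, i1; split; wit.
- by exists (e1 3), (e1 3), i0, i1, i0, i1; split; wit.
- by exists (e1 4), (e1 4), i0, i1, i0, i1; split; wit.
- by exists (e1 5), (e1 5), i0, i1, i0, i1; split; wit.
- by exists (e1 6), (e1 6), i0, i1, i1, i2; split; wit.
- by exists (e1 7), (e1 7), i0, i2, i1, i3; split; wit.
- by exists (e1 8), (e1 8), i0, i1, i1, i3; split; wit.
- by exists (e1 9), (e1 9), i0, i1, i1, i3; split; wit.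
- by exists (e1 12), (e3 12), i0, i1, i2, i3; split; wit.
by exists (e1 13), (e3 13), i0, i1, i2, i3; split; wit.
Qed.

Lemma not_image_line k : (k < 14)%N -> k != 10 -> ~ image_line (rep k).
Proof.
move=> k14 k10; have [->|k11] := eqVneq k 11.
  by apply: (@image_lineN _ _ (e1 11) (e2 11) i0 i1 i3 i3); wit.
have [x [y [i [j [p [q [xU yU + _] ] ] ] ] ] ] := rank2_rep k14 k10 k11.
exact: image_lineN.
Qed.

Lemma not_kernel_hyper k : (k < 14)%N -> k != 11 -> ~ kernel_hyper (rep k).
Proof.
move=> k14 k11; have [->|k10] := eqVneq k 10.
  by apply: (@kernel_hyperN _ _ (e1 10) (e2 10) i0 i0 i1 i2); wit.
have [x [y [i [j [p [q [xU yU _] ] ] ] ] ] ] := rank2_rep k14 k10 k11.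
exact: kernel_hyperN.
Qed.

Lemma not_square_zero k : (k < 10)%N -> ~ square_zero (rep k).
Proof.
do 10?[case: k => [|k] ] => // _.
- by apply: (@square_zeroN _ _ (e1 0) (e1 0) i0 i0); wit.
- by apply: (@square_zeroN _ _ (e1 1) (e1 1) i0 i0); wit.
- by apply: (@square_zeroN _ _ (e1 2) (e1 2) i0 i0); wit.
- by apply: (@square_zeroN _ _ (e1 3) (e1 3) i0 i0); wit.
- by apply: (@square_zeroN _ _ (e1 4) (e1 4) i0 i0); wit.
- by apply: (@square_zeroN _ _ (e1 5) (e1 5) i0 i0); wit.
- by apply: (@square_zeroN _ _ (e1 6) (e1 6) i0 i2); wit.
- by apply: (@square_zeroN _ _ (e1 7) (e2 7) i0 i3); wit.
- by apply: (@square_zeroN _ _ (e1 8) (e1 8) i0 i3); wit.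
by apply: (@square_zeroN _ _ (e1 9) (e1 9) i0 i3); wit.
Qed.

Lemma skew_mx4 (E : 'M[F]_4) : E^T = - E -> exists a b c d e f,
  E = mx4 0 a b c (- a) 0 d e (- b) (- d) 0 f (- c) (- e) (- f) 0.
Proof.
move=> /matrixP Es.
have Eij i j : E i j = - E j i by have := Es j i; rewrite !mxE.
have Eii i : E i i = 0.
  apply/eqP; have /eqP := Eij i i; rewrite -addr_eq0 -mulr2n mulrn_eq0.
  by [].
exists (E i0 i1), (E i0 i2), (E i0 i3), (E i1 i2), (E i1 i3), (E i2 i3).
by rewrite {1}[E]mx4E !Eii -!Eij.
Qed.

Definition ublock (a b c d : F) : 'M[F]_4 :=
  mx4 0 0 a b 0 0 c d 0 0 0 0 0 0 0 0.

(** On 2 x 2 blocks only the coefficient [E i2 i3] survives, and in [lblock_skew_ublock] only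
    [Om i0 i1]. Together they show that [nu] is, up to sign, the product of these two scalars with x
    adj(y) z - z adj(y) x. *)
Lemma ublock_skew_tr (E : 'M[F]_4) a b c d a' b' c' d' : E^T = - E ->
  ublock a b c d *m E *m (ublock a' b' c' d')^T =
  mx4 (E i2 i3 * (a * b' - b * a')) (E i2 i3 * (a * d' - b * c')) 0 0
      (E i2 i3 * (c * b' - d * a')) (E i2 i3 * (c * d' - d * c')) 0 0
      0 0 0 0 0 0 0 0.
Proof.
move=> /skew_mx4[e [e' [e'' [h [h' [h'' ->] ] ] ] ] ]; rewrite tr_mx4 !mul_mx4.
by apply: mx4P; rewrite !mxE /=; ring.
Qed.

Lemma lblock_skew_ublock (Om : 'M[F]_4) p q r s a b c d : Om^T = - Om ->
  mx4 p q 0 0 r s 0 0 0 0 0 0 0 0 0 0 *m Om *m ublock a b c d =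
  ublock (Om i0 i1 * (p * c - q * a)) (Om i0 i1 * (p * d - q * b))
         (Om i0 i1 * (r * c - s * a)) (Om i0 i1 * (r * d - s * b)).
Proof.
move=> /skew_mx4[e [e' [e'' [h [h' [h'' ->] ] ] ] ] ]; rewrite !mul_mx4.
by apply: mx4P; rewrite !mxE /=; ring.
Qed.

Lemma not_flag_type k : (k < 14)%N -> k != 12 -> ~ flag_type (rep k).
Proof.
move=> k14 k12 [U1 U2 U3 U4]; have [k10|] := ltnP k 10.
  exact: (not_square_zero k10).
move: k14 k12 U1 U2 U3 U4; do 14?[case: k => [|k] ] => // _ _ _ U2 U3 U4 _.
- by move: U3; apply: (@kernel_planeN _ _ (e1 10) (e2 10) (e3 10) i0 i0 i0); wit.
- by move: U2; apply: (@image_planeN _ _ (e1 11) (e2 11) (e3 11) i3 i3 i3); wit.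
(* With these standard skew forms [nu] returns the skew block, which is normal to the symmetric
   blocks of form 13 and has rank two. *)
pose E : 'M[F]_4 := mx4 0 0 0 0 0 0 0 0 0 0 0 1 0 0 (- 1) 0.
pose Om : 'M[F]_4 := mx4 0 1 0 0 (- 1) 0 0 0 0 0 0 0 0 0 0 0.
have Es : E^T = - E by rewrite tr_mx4; apply: mx4P; rewrite !mxE /=; ring.
have Os : Om^T = - Om by rewrite tr_mx4; apply: mx4P; rewrite !mxE /=; ring.
have nuE : nu E Om (e1 13) (e3 13) (e2 13) =
    mx4 0 0 0 (- 1) 0 0 1 0 0 0 0 0 0 0 0 0.
  rewrite -/(ublock 1 0 0 0) -/(ublock 0 0 0 1) -/(ublock 0 1 1 0).
  rewrite /nu !ublock_skew_tr // !lblock_skew_ublock // !mxE /=.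
  by apply: mx4P; rewrite !mxE /=; ring.
have in13 a b c : nform 13 a b c \in rep 13 by exact: nform_in.
have := U4 E Om (delta_mx 0 i0) (delta_mx 0 i1) (delta_mx i3 0) (delta_mx i2 0)
  _ _ _ _ _ _ Es Os (in13 1 0 0) (in13 0 0 1) (in13 0 1 0)
  (in13 1 0 0) (in13 0 0 1) (in13 0 1 0).
rewrite nuE !ent_delta !mxE /= mulr1 mul0r subr0 => /eqP.
by rewrite oppr_eq0 oner_eq0.
Qed.

End FailedConditions.

Section RepEvaluations.
Variable F : numClosedFieldType.
Local Notation rep := (rep F).
Local Notation e1 k := (nform k (1 : F) 0 0).
Local Notation e2 k := (nform k (0 : F) 1 0).
Local Notation e3 k := (nform k (0 : F) 0 1).

Lemma ent4 (f : 'rV[F]_4) (x : 'M_4) v : ent f x v =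
  f 0 i0 * (x i0 i0 * v i0 0 + x i0 i1 * v i1 0 + x i0 i2 * v i2 0 + x i0 i3 * v i3 0) +
  f 0 i1 * (x i1 i0 * v i0 0 + x i1 i1 * v i1 0 + x i1 i2 * v i2 0 + x i1 i3 * v i3 0) +
  f 0 i2 * (x i2 i0 * v i0 0 + x i2 i1 * v i1 0 + x i2 i2 * v i2 0 + x i2 i3 * v i3 0) +
  f 0 i3 * (x i3 i0 * v i0 0 + x i3 i1 * v i1 0 + x i3 i2 * v i2 0 + x i3 i3 * v i3 0).
Proof. by rewrite /ent -mulmxA mxE sum4; do 4?congr (_ + _); rewrite mxE sum4. Qed.

Lemma image_line_rep : image_line (rep 10).
Proof.
move=> f f' v v' _ _ /mem_rep[a [b [c ->] ] ] /mem_rep[a' [b' [c' ->] ] ].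
by rewrite !ent4 !mxE /=; ring.
Qed.

Lemma kernel_hyper_rep : kernel_hyper (rep 11).
Proof.
move=> f f' v v' _ _ /mem_rep[a [b [c ->] ] ] /mem_rep[a' [b' [c' ->] ] ].
by rewrite !ent4 !mxE /=; ring.
Qed.

Lemma image_plane_rows (U : {vspace 'M[F]_4}) : (forall x, x \in U -> exists s t : 'cV[F]_4 -> F,
    forall f v, ent f x v = f 0 i0 * s v + f 0 i1 * t v) -> image_plane U.
Proof.
move=> UE f1 f2 f3 v1 v2 v3 x y z /UE[s1 [t1 xE] ] /UE[s2 [t2 yE] ] /UE[s3 [t3 zE] ].
by rewrite !xE !yE !zE /det3; ring.
Qed.

Lemma kernel_plane_cols (U : {vspace 'M[F]_4}) p q : (forall x, x \in U -> exists s t : 'rV[F]_4 -> F,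
    forall f v, ent f x v = s f * v p 0 + t f * v q 0) -> kernel_plane U.
Proof.
move=> UE f1 f2 f3 v1 v2 v3 x y z /UE[s1 [t1 xE] ] /UE[s2 [t2 yE] ] /UE[s3 [t3 zE] ].
by rewrite !xE !yE !zE /det3; ring.
Qed.

Lemma image_plane_rep k : k \in [:: 9; 12]%N -> image_plane (rep k).
Proof.
rewrite !inE => /orP[] /eqP ->; apply: image_plane_rows;
  move=> _ /mem_rep[a [b [c ->] ] ];
  [exists (fun v => a * v i1 0 + c * v i2 0 + b * v i3 0), (fun v => a * v i3 0)
  |exists (fun v => a * v i2 0 + b * v i3 0), (fun v => c * v i3 0)];
  by move=> f v; rewrite ent4 !mxE /=; ring.
Qed.

Lemma kernel_plane_rep k : k \in [:: 8; 12]%N -> kernel_plane (rep k).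
Proof.
rewrite !inE => /orP[] /eqP ->.
  apply: (@kernel_plane_cols _ i1 i3) => _ /mem_rep[a [b [c ->] ] ].
  exists (fun f => f 0 i0 * a), (fun f => f 0 i0 * b + f 0 i1 * a + f 0 i2 * c).
  by move=> f v; rewrite ent4 !mxE /=; ring.
apply: (@kernel_plane_cols _ i2 i3) => _ /mem_rep[a [b [c ->] ] ].
exists (fun f => f 0 i0 * a), (fun f => f 0 i0 * b + f 0 i1 * c).
by move=> f v; rewrite ent4 !mxE /=; ring.
Qed.

Lemma nu_nform12 E Om x y z : E^T = - E -> Om^T = - Om ->
  x \in rep 12 -> y \in rep 12 -> z \in rep 12 ->
  exists n, nu E Om x y z = mx4 0 0 0 n 0 0 0 0 0 0 0 0 0 0 0 0.
Proof.
move=> Es Os /mem_rep[a1 [b1 [c1 ->] ] ] /mem_rep[a2 [b2 [c2 ->] ] ].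
move=> /mem_rep[a3 [b3 [c3 ->] ] ].
(* The last factor is the determinant of the three parameter triples, as [nu] is alternating. The
   corner position is the normal to the upper triangular blocks. *)
exists (E i2 i3 * Om i0 i1 * (- a1 * c2 * b3 + a1 * b2 * c3 - b1 * a2 * c3
  + a3 * c2 * b1 - a3 * b2 * c1 + b3 * a2 * c1)).
rewrite -/(ublock a1 b1 0 c1) -/(ublock a2 b2 0 c2) -/(ublock a3 b3 0 c3).
rewrite /nu !ublock_skew_tr // !lblock_skew_ublock //.
by apply: mx4P; rewrite !mxE /=; ring.
Qed.

Lemma flag_type_rep : flag_type (rep 12).
Proof.
split.
- move=> _ _ /mem_rep[a [b [c ->] ] ] /mem_rep[a' [b' [c' ->] ] ].
  by rewrite mul_mx4; apply: mx4P; rewrite !mxE /=; ring.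
- exact: image_plane_rep.
- exact: kernel_plane_rep.
move=> E Om f f' v v' x y z x' y' z' Es Os xU yU zU xU' yU' zU'.
have [n ->] := nu_nform12 Es Os xU yU zU.
have [n' ->] := nu_nform12 Es Os xU' yU' zU'.
by rewrite !ent4 !mxE /=; ring.
Qed.

End RepEvaluations.

(** * Separation of the fourteen orbits *)

Section OrbitIndex.
Variable F : numClosedFieldType.
Local Notation rep := (rep F).
Local Notation e1 k := (nform k (1 : F) 0 0).
Local Notation e2 k := (nform k (0 : F) 1 0).
Local Notation e3 k := (nform k (0 : F) 0 1).
Implicit Type U : {vspace 'M[F]_4}.

Ltac wit := rewrite ?nform_in // /det3 ?mxE ?sum4 ?mxE /=; ring.
Ltac sq0 := by rewrite mul_mx4; apply: mx4P; rewrite !mxE /=; ring.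

Lemma sqr_eq0 (a : F) : a * a = 0 -> a = 0.
Proof. by move=> /eqP; rewrite mulf_eq0 orbb => /eqP. Qed.

Lemma trace_zero_rep k : (6 <= k < 10)%N -> trace_zero (rep k).
Proof.
do 10?[case: k => [|k] ] => // _ _ /mem_rep[a [b [c ->] ] ];
  by rewrite mul_mx4 /mxtrace sum4 !mxE /=; ring.
Qed.

Lemma not_trace_zero k : (k < 6)%N -> ~ trace_zero (rep k).
Proof.
move=> k6 /(_ (e1 k) (nform_in k 1 0 0)) /eqP; apply/negP.
(* The trace is a positive integer, nonzero in characteristic zero. *)
suff [m ->] : exists m, \tr (e1 k *m e1 k) = m.+1%:R by rewrite pnatr_eq0.
move: k6; do 6?[case: k => [|k] ] => // _; rewrite mul_mx4 /mxtrace sum4 !mxE /=.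
- by exists 1%N; ring.
- by exists 5%N; ring.
- by exists 3%N; ring.
- by exists 11%N; ring.
- by exists 11%N; ring.
by exists 11%N; ring.
Qed.

Lemma not_image_plane k : (6 <= k < 9)%N -> ~ image_plane (rep k).
Proof.
do 9?[case: k => [|k] ] => // _.
- by apply: (@image_planeN _ _ (e1 6) (e1 6) (e1 6) i1 i2 i3); wit.
- by apply: (@image_planeN _ _ (e1 7) (e2 7) (e1 7) i1 i3 i3); wit.
by apply: (@image_planeN _ _ (e1 8) (e1 8) (e3 8) i1 i3 i3); wit.
Qed.

Lemma not_kernel_plane k : (6 <= k < 8)%N -> ~ kernel_plane (rep k).
Proof.
do 8?[case: k => [|k] ] => // _.
- by apply: (@kernel_planeN _ _ (e1 6) (e1 6) (e1 6) i0 i1 i2); wit.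
by apply: (@kernel_planeN _ _ (e1 7) (e2 7) (e1 7) i0 i0 i2); wit.
Qed.

Lemma cube_zero_rep : cube_zero (rep 7).
Proof.
move=> _ /mem_rep[a [b [c ->] ] ].
by rewrite !mul_mx4; apply: mx4P; rewrite !mxE /=; ring.
Qed.

Lemma not_cube_zero : ~ cube_zero (rep 6).
Proof.
move=> /(_ (e1 6) (nform_in 6 1 0 0)) /matrixP /(_ i0 i3).
rewrite !mul_mx4 !mxE /= !(mul0r, mulr0, addr0, add0r, mul1r) => /eqP.
by rewrite oner_eq0.
Qed.

Lemma square_zero_rep : square_zero (rep 13).
Proof.
move=> _ _ /mem_rep[a [b [c ->] ] ] /mem_rep[a' [b' [c' ->] ] ]; sq0.
Qed.

Lemma reduced_rep : reduced (rep 0).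
Proof.
move=> _ /mem_rep[a [b [c ->] ] ]; rewrite mul_mx4 => /matrixP E.
have := (E i0 i0, E i1 i1, E i2 i2); rewrite !mxE /=.
rewrite !(mul0r, mulr0, addr0, add0r).
move=> [ [/sqr_eq0 -> /sqr_eq0 ->] /sqr_eq0 ->].
by apply: mx4P; rewrite !mxE /=; ring.
Qed.

Lemma not_reduced k : (0 < k < 6)%N -> ~ reduced (rep k).
Proof.
move=> k6 red.
suff [a [b [c [xx bc] ] ] ] : exists a b c : F, nform k a b c *m nform k a b c = 0 /\
    (b != 0 \/ c != 0).
  have /nform_eq0[_ b0 c0] := red _ (nform_in k a b c) xx.
  by case: bc => /eqP.
move: k6 {red}; do 6?[case: k => [|k] ] => // _;
  [exists 0, 1, 0|exists 0, 1, 0|exists 0, 0, 1|exists 0, 1, 0|exists 0, 1, 0];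
  (split; [sq0 | rewrite oner_eq0; by [left|right] ]).
Qed.

(** In forms 1 and 3 the elements of square zero form a line spanned by a rank-one matrix, which
    settles both [sq0] conditions at once. *)
Lemma sq0_multiple k : k \in [:: 1; 3]%N -> exists n : 'M[F]_4,
  (forall f f' v v', ent f n v * ent f' n v' = ent f n v' * ent f' n v) /\
  forall x, x \in rep k -> x *m x = 0 -> exists t, x = t *: n.
Proof.
rewrite !inE => /orP[] /eqP ->; [exists (nform 1 0 1 0) | exists (nform 3 0 0 1)];
  (split; first by move=> f f' v v'; rewrite !ent4 !mxE /=; ring);
  move=> _ /mem_rep[a [b [c ->] ] ]; rewrite mul_mx4 => /matrixP E;
  [exists b | exists c].
- have := (E i0 i0, E i2 i2); rewrite !mxE /= !(mul0r, mulr0, addr0, add0r).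
  by move=> [/sqr_eq0 -> /sqr_eq0 ->]; apply: mx4P; rewrite !mxE /=; ring.
have := E i0 i0; rewrite !mxE /= !(mul0r, mulr0, addr0, add0r) => /sqr_eq0 a0.
have := E i0 i2; rewrite a0 !mxE /= !(mul0r, mulr0, addr0, add0r) => /sqr_eq0 ->.
by apply: mx4P; rewrite !mxE /=; ring.
Qed.

Lemma entZ f t (x : 'M[F]_4) v : ent f (t *: x) v = t * ent f x v.
Proof. by rewrite /ent -scalemxAr -scalemxAl mxE. Qed.

Lemma sq0_rank1_rep k : k \in [:: 1; 3]%N ->
  sq0_image_line (rep k) /\ sq0_kernel_hyper (rep k).
Proof.
move=> /sq0_multiple[n [nE kn] ]; split=> f f' v v' x y xU yU;
  move=> /(kn x xU)[t ->] /(kn y yU)[s ->]; rewrite !entZ.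
  by rewrite mulrACA nE; ring.
by rewrite mulrACA nE; ring.
Qed.

Lemma sq0_image_line_rep : sq0_image_line (rep 4).
Proof.
move=> f f' v v' _ _ /mem_rep[a [b [c ->] ] ] /mem_rep[a' [b' [c' ->] ] ].
rewrite !mul_mx4 => /matrixP /(_ i0 i0) E /matrixP /(_ i0 i0).
move: E; rewrite !mxE /= !(mul0r, mulr0, addr0, add0r).
by move=> /sqr_eq0 -> /sqr_eq0 ->; rewrite !ent4 !mxE /=; ring.
Qed.

Lemma sq0_kernel_hyper_rep : sq0_kernel_hyper (rep 5).
Proof.
move=> f f' v v' _ _ /mem_rep[a [b [c ->] ] ] /mem_rep[a' [b' [c' ->] ] ].
rewrite !mul_mx4 => /matrixP /(_ i0 i0) E /matrixP /(_ i0 i0).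
move: E; rewrite !mxE /= !(mul0r, mulr0, addr0, add0r).
by move=> /sqr_eq0 -> /sqr_eq0 ->; rewrite !ent4 !mxE /=; ring.
Qed.

Lemma not_sq0_image_line k : k \in [:: 2; 5]%N -> ~ sq0_image_line (rep k).
Proof.
rewrite !inE => /orP[] /eqP ->.
  apply: (@sq0_image_lineN _ _ (e2 2) (e3 2) i0 i2 i1 i3);
    rewrite ?nform_in //; [sq0 | sq0 | wit].
apply: (@sq0_image_lineN _ _ (e2 5) (e3 5) i0 i1 i2 i2);
  rewrite ?nform_in //; [sq0 | sq0 | wit].
Qed.

Lemma not_sq0_kernel_hyper k : k \in [:: 2; 4]%N -> ~ sq0_kernel_hyper (rep k).
Proof.
rewrite !inE => /orP[] /eqP ->.
  apply: (@sq0_kernel_hyperN _ _ (e2 2) (e3 2) i0 i2 i1 i3);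
    rewrite ?nform_in //; [sq0 | sq0 | wit].
apply: (@sq0_kernel_hyperN _ _ (e2 4) (e3 4) i0 i0 i1 i2);
  rewrite ?nform_in //; [sq0 | sq0 | wit].
Qed.

Lemma nil2_rep : nil2 (rep 1).
Proof.
move=> _ /mem_rep[a [b [c ->] ] ]; rewrite !mul_mx4 => /matrixP E.
have := (E i0 i0, E i2 i2); rewrite !mxE /= !(mul0r, mulr0, addr0, add0r).
have cu0 (t : F) : t * t * t = 0 -> t = 0.
  by move=> /eqP; rewrite !mulf_eq0 !orbb => /eqP.
move=> [/cu0 -> /cu0 ->]; apply: mx4P; rewrite !mxE /=; ring.
Qed.

Lemma not_nil2 : ~ nil2 (rep 3).
Proof.
move=> /(_ (e2 3) (nform_in 3 0 1 0)) H.
have /H /matrixP /(_ i0 i2) : e2 3 *m e2 3 *m e2 3 = 0.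
  by rewrite !mul_mx4; apply: mx4P; rewrite !mxE /=; ring.
rewrite !mul_mx4 !mxE /= !(mul0r, mulr0, addr0, add0r, mul1r) => /eqP.
by rewrite oner_eq0.
Qed.

(** A decision tree of invariant tests. Once 10 to 13 are recognised, [trace_zero] separates the
    nilpotent forms 6 to 9 from 0 to 5. The latter are told apart by their elements of square zero,
    except that 1 and 3 differ by the index of their nilpotent elements. *)
Definition orbit_index U : nat :=
  if `[< image_line U >] then 10 else
  if `[< kernel_hyper U >] then 11 else
  if `[< flag_type U >] then 12 else
  if `[< square_zero U >] then 13 else
  if `[< trace_zero U >] then
    if `[< image_plane U >] then 9 else
    if `[< kernel_plane U >] then 8 else
    if `[< cube_zero U >] then 7 else 6
  else
  if `[< reduced U >] then 0 else
  if `[< sq0_image_line U >] then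
    if `[< sq0_kernel_hyper U >] then
      if `[< nil2 U >] then 1 else 3
    else 4
  else if `[< sq0_kernel_hyper U >] then 5 else 2.

Lemma asbool_conj (P : {vspace 'M[F]_4} -> Prop) g U : g \in unitmx ->
  (forall h V, h \in unitmx -> P V -> P (conj_act h V)) ->
  `[< P (conj_act g U) >] = `[< P U >].
Proof.
move=> gu Pc; apply: asbool_equiv_eq; split; last exact: Pc.
by move=> /(Pc (invmx g)); rewrite unitmx_inv conj_actK //; apply.
Qed.

Lemma orbit_index_conj g U : g \in unitmx ->
  orbit_index (conj_act g U) = orbit_index U.
Proof.
move=> gu; rewrite /orbit_index.
rewrite !(asbool_conj _ gu (fun h V hu => @image_line_conj F h hu V)).
rewrite !(asbool_conj _ gu (fun h V hu => @kernel_hyper_conj F h hu V)).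
rewrite !(asbool_conj _ gu (fun h V hu => @flag_type_conj F h hu V)).
rewrite !(asbool_conj _ gu (fun h V hu => @square_zero_conj F h hu V)).
rewrite !(asbool_conj _ gu (fun h V hu => @trace_zero_conj F h hu V)).
rewrite !(asbool_conj _ gu (fun h V hu => @image_plane_conj F h hu V)).
rewrite !(asbool_conj _ gu (fun h V hu => @kernel_plane_conj F h hu V)).
rewrite !(asbool_conj _ gu (fun h V hu => @cube_zero_conj F h hu V)).
rewrite !(asbool_conj _ gu (fun h V hu => @reduced_conj F h hu V)).
rewrite !(asbool_conj _ gu (fun h V hu => @sq0_image_line_conj F h hu V)).
rewrite !(asbool_conj _ gu (fun h V hu => @sq0_kernel_hyper_conj F h hu V)).
by rewrite !(asbool_conj _ gu (fun h V hu => @nil2_conj F h hu V)).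
Qed.

Lemma orbit_index_rep k : (k < 14)%N -> orbit_index (rep k) = k.
Proof.
move=> k14; rewrite /orbit_index.
have [->|k10] := eqVneq k 10; first by rewrite (asboolT (@image_line_rep F)).
rewrite (asboolF (not_image_line k14 k10)).
have [->|k11] := eqVneq k 11; first by rewrite (asboolT (@kernel_hyper_rep F)).
rewrite (asboolF (not_kernel_hyper k14 k11)).
have [->|k12] := eqVneq k 12; first by rewrite (asboolT (@flag_type_rep F)).
rewrite (asboolF (not_flag_type k14 k12)).
have [->|k13] := eqVneq k 13; first by rewrite (asboolT (@square_zero_rep)).
have kl10 : (k < 10)%N by move: k14 k10 k11 k12 k13; do 14?[case: k => [|k] ].
rewrite (asboolF (not_square_zero kl10)).
have [k6|k6] := leqP 6 k.
  rewrite (asboolT (@trace_zero_rep k _)) ?k6 //.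
  have [->|k9] := eqVneq k 9; first by rewrite (asboolT (@image_plane_rep F 9 isT)).
  have k9' : (k < 9)%N by rewrite ltn_neqAle k9 -ltnS.
  rewrite (asboolF (@not_image_plane k _)) ?k6 //.
  have [->|k8] := eqVneq k 8; first by rewrite (asboolT (@kernel_plane_rep F 8 isT)).
  have k8' : (k < 8)%N by rewrite ltn_neqAle k8 -ltnS.
  rewrite (asboolF (@not_kernel_plane k _)) ?k6 //.
  have [->|k7] := eqVneq k 7; first by rewrite (asboolT (@cube_zero_rep)).
  have -> : k = 6 by apply/eqP; rewrite eqn_leq k6 -ltnS ltn_neqAle k7 -ltnS k8'.
  by rewrite (asboolF not_cube_zero).
rewrite (asboolF (not_trace_zero k6)).
have [->|k0] := posnP k; first by rewrite (asboolT (@reduced_rep)).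
rewrite (asboolF (@not_reduced k _)) ?k0 //.
have [h1 h1'] := @sq0_rank1_rep 1 isT; have [h3 h3'] := @sq0_rank1_rep 3 isT.
move: k6 k0 {k14 k10 k11 k12 k13 kl10}; do 6?[case: k => [|k] ] => // _ _.
- by rewrite (asboolT h1) (asboolT h1') (asboolT nil2_rep).
- by rewrite (asboolF (@not_sq0_image_line 2 isT)) (asboolF (@not_sq0_kernel_hyper 2 isT)).
- by rewrite (asboolT h3) (asboolT h3') (asboolF not_nil2).
- by rewrite (asboolT sq0_image_line_rep) (asboolF (@not_sq0_kernel_hyper 4 isT)).
by rewrite (asboolF (@not_sq0_image_line 5 isT)) (asboolT sq0_kernel_hyper_rep).
Qed.

Lemma orbit_rep_inj k l : (k < 14)%N -> (l < 14)%N ->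
  pgl_orbit (rep k) (rep l) -> k = l.
Proof.
move=> k14 l14 [g gu /(congr1 orbit_index)].
by rewrite orbit_index_conj // !orbit_index_rep.
Qed.

End OrbitIndex.

(** * The orbits in Ab(4) and the closed ones *)

Section Orbits.
Variable F : numClosedFieldType.
Local Notation rep := (rep F).

Lemma orbits_in_closure (Z : set {vspace 'M[F]_4}) k :
  closed_in_grass Z -> pgl_orbit (rep 0) `<=` Z -> (k < 14)%N ->
  pgl_orbit (rep k) `<=` Z.
Proof.
move=> Zc Z0.
have step i j (ij : exists M, @degeneration F i j M) :
    pgl_orbit (rep i) `<=` Z -> pgl_orbit (rep j) `<=` Z.
  by case: ij => M ij; exact: degeneration_closed ij Zc.
have Z1 := step _ _ (degeneration_0_1 F) Z0.
have Z2 := step _ _ (degeneration_1_2 F) Z1.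
have Z3 := step _ _ (degeneration_1_3 F) Z1.
have Z4 := step _ _ (degeneration_3_4 F) Z3.
have Z5 := step _ _ (degeneration_3_5 F) Z3.
have Z6 := step _ _ (degeneration_2_6 F) Z2.
have Z7 := step _ _ (degeneration_6_7 F) Z6.
have Z8 := step _ _ (degeneration_5_8 F) Z5.
have Z9 := step _ _ (degeneration_4_9 F) Z4.
have Z10 := step _ _ (degeneration_9_10 F) Z9.
have Z11 := step _ _ (degeneration_8_11 F) Z8.
have Z13 := step _ _ (degeneration_6_13 F) Z6.
have Z12 := step _ _ (degeneration_13_12 F) Z13.
by do 14?[case: k => [|k] ].
Qed.

Lemma Red_Ab : Red F 4 = Ab F 4.
Proof.
apply/seteqP; split.
  apply: smallest_sub; first exact: closed_Ab.
  by rewrite cartan_orbit => U; exact: Ab_orbit_rep.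
move=> U /Ab_classification[k k14 kU] Z [Zc cZ].
by apply: (orbits_in_closure Zc _ k14) => //; rewrite -cartan_orbit.
Qed.

Lemma pgl_orbits_AbE :
  pgl_orbits (Ab F 4) = (fun k => pgl_orbit (rep k)) @` `I_14.
Proof.
apply/seteqP; split=> [_ [U /Ab_classification[k k14 kU] <-]|_ [k k14 <-] ].
  by exists k => //; rewrite (pgl_orbitE kU).
by exists (rep k) => //; exact: rep_Ab.
Qed.

Lemma pgl_orbit_rep_inj k l : (k < 14)%N -> (l < 14)%N ->
  pgl_orbit (rep k) = pgl_orbit (rep l) -> k = l.
Proof.
move=> k14 l14 kl; apply: (@orbit_rep_inj F) => //.
by rewrite kl; exact: pgl_orbit_refl.
Qed.

Lemma card_pgl_orbits_Ab : (pgl_orbits (Ab F 4) #= `I_14)%card.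
Proof.
rewrite pgl_orbits_AbE; apply: inj_card_eq => k l.
rewrite !inE => k14 l14; exact: pgl_orbit_rep_inj.
Qed.

(** Identifies a locus with a single orbit, so that closedness passes from the locus to the
    orbit. *)
Lemma orbit_locus (P : {vspace 'M[F]_4} -> Prop) k : (k < 14)%N ->
  (forall g U, g \in unitmx -> P U -> P (conj_act g U)) ->
  (forall l, (l < 14)%N -> l != k -> ~ P (rep l)) -> P (rep k) ->
  Ab F 4 `&` [set U | P U] = pgl_orbit (rep k).
Proof.
move=> k14 Pc Pn Pk; apply/seteqP; split=> U.
  move=> [/Ab_classification[l l14 [g gu UE] ] /= PU].
  have [<-|lk] := eqVneq l k; first by exists g.
  case: (Pn l l14 lk); rewrite -(conj_actK (rep l) gu) -UE.
  by apply: Pc => //; rewrite unitmx_inv.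
by move=> kU; split; [exact: Ab_orbit_rep kU|move: kU => [g gu ->]; exact: Pc].
Qed.

Lemma orbit10E : Ab F 4 `&` [set U | image_line U] = pgl_orbit (rep 10).
Proof.
apply: orbit_locus => //; [by move=> g U gu; exact: image_line_conj
  | exact: not_image_line | exact: image_line_rep].
Qed.

Lemma orbit11E : Ab F 4 `&` [set U | kernel_hyper U] = pgl_orbit (rep 11).
Proof.
apply: orbit_locus => //; [by move=> g U gu; exact: kernel_hyper_conj
  | exact: not_kernel_hyper | exact: kernel_hyper_rep].
Qed.

Lemma orbit12E : Ab F 4 `&` [set U | flag_type U] = pgl_orbit (rep 12).
Proof.
apply: orbit_locus => //; [by move=> g U gu; exact: flag_type_conj
  | exact: not_flag_type | exact: flag_type_rep].
Qed.

Lemma closed_orbitsE : [set O | pgl_orbits (Ab F 4) O /\ closed_in_grass O] =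
  [set pgl_orbit (rep 10); pgl_orbit (rep 11); pgl_orbit (rep 12)].
Proof.
apply/seteqP; split=> O.
  rewrite pgl_orbits_AbE => [ [ [k k14 <-] kc] ].
  have degN l : (l < 14)%N -> k <> l -> ~ exists M, @degeneration F k l M.
    move=> l14 kl [M /degeneration_closed /(_ kc)] kkl; apply: kl.
    by apply: (@orbit_rep_inj F) => //; apply: (kkl) => //; exact: pgl_orbit_refl.
  move: k k14 kc degN; do 14?[case=> [|] ] => //; move=> _ _ degN.
  - by case: (degN 1) => //; exact: degeneration_0_1.
  - by case: (degN 2) => //; exact: degeneration_1_2.
  - by case: (degN 6) => //; exact: degeneration_2_6.
  - by case: (degN 4) => //; exact: degeneration_3_4.
  - by case: (degN 9) => //; exact: degeneration_4_9.
  - by case: (degN 8) => //; exact: degeneration_5_8.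
  - by case: (degN 7) => //; exact: degeneration_6_7.
  - by case: (degN 11) => //; exact: degeneration_7_11.
  - by case: (degN 11) => //; exact: degeneration_8_11.
  - by case: (degN 10) => //; exact: degeneration_9_10.
  - by left; left.
  - by left; right.
  - by right.
  by case: (degN 12) => //; exact: degeneration_13_12.
have inA k : (k < 14)%N -> pgl_orbits (Ab F 4) (pgl_orbit (rep k)).
  by move=> k14; rewrite pgl_orbits_AbE; exists k.
move=> [ [->|->]|->]; split; try exact: inA.
- by rewrite -orbit10E; exact: closed_image_line.
- by rewrite -orbit11E; exact: closed_kernel_hyper.
by rewrite -orbit12E; exact: closed_flag_type.
Qed.

End Orbits.

(** * Equivariant isomorphisms between orbits *)

Section EquivariantIsomorphisms.
Variable F : fieldType.

(** [R] is the graph of the isomorphism. Both sides are single orbits, so existence and uniqueness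
    of partners need checking only at the base points. The two maps come from the axiom of choice,
    hence regularity is asked of every function with graph in [R]. *)
Lemma pgl_iso_of_orbits k (T T' : Type) n m (c : T -> 'I_n -> F)
    (act : 'M[F]_k -> T -> T) (X : set T) (c' : T' -> 'I_m -> F)
    (act' : 'M[F]_k -> T' -> T') (Y : set T') (x0 : T) (y0 : T')
    (R : T -> T' -> Prop) :
  (forall g x, g \in unitmx -> act (invmx g) (act g x) = x) ->
  (forall g y, g \in unitmx -> act' (invmx g) (act' g y) = y) ->
  (forall g x, g \in unitmx -> X x -> X (act g x)) ->
  (forall g y, g \in unitmx -> Y y -> Y (act' g y)) ->
  (forall x, X x -> exists2 g, g \in unitmx & x = act g x0) ->
  (forall y, Y y -> exists2 g, g \in unitmx & y = act' g y0) ->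
  (forall g x y, g \in unitmx -> R x y -> R (act g x) (act' g y)) ->
  X x0 -> Y y0 -> R x0 y0 ->
  (forall y, Y y -> R x0 y -> y = y0) -> (forall x, X x -> R x y0 -> x = x0) ->
  (forall f, set_fun X Y f -> (forall x, X x -> R x (f x)) ->
    locally_poly c X c' f) ->
  (forall f, set_fun Y X f -> (forall y, Y y -> R (f y) y) ->
    locally_poly c' Y c f) ->
  pgl_isomorphic c act X c' act' Y.
Proof.
move=> actK actK' actX actY Xorb Yorb Ract X0 Y0 R0 Yuniq Xuniq regf regg.
have uniqY x y y' : X x -> Y y -> Y y' -> R x y -> R x y' -> y = y'.
  move=> Xx Yy Yy' xy xy'; have [g gu xE] := Xorb x Xx.
  have back z : Y z -> R x z -> act' (invmx g) z = y0.
    move=> Yz xz; have gVu : invmx g \in unitmx by rewrite unitmx_inv.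
    by apply: Yuniq; [exact: actY | rewrite -(actK g x0) // -xE; exact: Ract].
  have gVu : invmx g \in unitmx by rewrite unitmx_inv.
  by rewrite -(actK' (invmx g) y) // -(actK' (invmx g) y') // !back.
have uniqX x x' y : X x -> X x' -> Y y -> R x y -> R x' y -> x = x'.
  move=> Xx Xx' Yy xy xy'; have [g gu yE] := Yorb y Yy.
  have back z : X z -> R z y -> act (invmx g) z = x0.
    move=> Xz zy; have gVu : invmx g \in unitmx by rewrite unitmx_inv.
    by apply: Xuniq; [exact: actX | rewrite -(actK' g y0) // -yE; exact: Ract].
  have gVu : invmx g \in unitmx by rewrite unitmx_inv.
  by rewrite -(actK (invmx g) x) // -(actK (invmx g) x') // !back.
(* The function has to be total: outside [X] it takes the default value [y0]. *)
have /choice[f fP] : forall x, exists y, X x -> Y y /\ R x y.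
  move=> x; have [Xx|] := pselect (X x); last by exists y0.
  have [g gu ->] := Xorb x Xx; exists (act' g y0) => _.
  by split; [exact: actY | exact: Ract].
have /choice[h hP] : forall y, exists x, Y y -> X x /\ R x y.
  move=> y; have [Yy|] := pselect (Y y); last by exists x0.
  have [g gu ->] := Yorb y Yy; exists (act g x0) => _.
  by split; [exact: actX | exact: Ract].
have fXY : set_fun X Y f by move=> x /fP[].
have hYX : set_fun Y X h by move=> y /hP[].
have fR x : X x -> R x (f x) by move=> /fP[].
have hR y : Y y -> R (h y) y by move=> /hP[].
exists f; split; last first.
  move=> g x gu Xx; apply: (@uniqY (act g x)); first exact: actX.
  - by apply: fXY; exact: actX.
  - by apply: actY => //; exact: fXY.
  - by apply: fR; exact: actX.
  by apply: Ract => //; exact: fR.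
split; first by apply: locally_poly_regular => //; exact: regf.
exists h; split.
- by apply: locally_poly_regular => //; exact: regg.
- move=> x Xx; apply: (@uniqX _ _ (f x)) => //.
  + by apply: hYX; exact: fXY.
  + exact: fXY.
  + by apply: hR; exact: fXY.
  exact: fR.
move=> y Yy; apply: (@uniqY (h y)) => //.
- exact: hYX.
- by apply: fXY; exact: hYX.
- by apply: fR; exact: hYX.
exact: hR.
Qed.

Lemma skew_quad n (E : 'M[F]_n) (v : 'cV_n) : 2%:R != 0 :> F -> E^T = - E ->
  v^T *m E *m v = 0.
Proof.
move=> nz2 Es; rewrite [LHS]mx11_scalar; set t := (_ : 'M_1) 0 0.
suff -> : t = 0 by rewrite raddf0.
apply: (mulfI nz2); rewrite mulr0 mulr_natl mulr2n.
have : (v^T *m E *m v)^T = - (v^T *m E *m v).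
  by rewrite !trmx_mul trmxK Es mulNmx mulmxN mulmxA.
by move=> /matrixP /(_ 0 0); rewrite [LHS]mxE [RHS]mxE -/t => {1}->; rewrite addNr.
Qed.

(** Exactness of a Koszul complex: every form vanishing on [l] is the contraction of [l] with a skew
    form. Thus [l *m (l^T *m E)], quadratic in [l], runs through all maps [l *m f] with
    [f *m l = 0]. *)
Lemma skew_delta_row n (l : 'cV[F]_n) (f : 'rV_n) : l != 0 -> f *m l = 0 ->
  exists2 E : 'M_n, E^T = - E & l^T *m E = f.
Proof.
move=> l0 fl; have [i li] : exists i, l i 0 != 0.
  apply: contrapT => no; move/eqP: l0; apply; apply/colP => i.
  by rewrite mxE; apply: contrapT => /eqP li; apply: no; exists i.
pose d : 'cV[F]_n := delta_mx i 0.
exists ((l i 0)^-1 *: (d *m f - f^T *m d^T)).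
  by rewrite linearZ /= linearB /= !trmx_mul !trmxK -scalerN opprB.
rewrite -scalemxAr mulmxBr !mulmxA.
have -> : l^T *m d = (l i 0)%:M.
  by rewrite /d -colE; apply/matrixP => a b; rewrite !ord1 !mxE.
have -> : l^T *m f^T = 0 by rewrite -trmx_mul fl trmx0.
by rewrite mul0mx subr0 mul_scalar_mx scalerA mulVf // scale1r.
Qed.

Lemma line_span n m (L : {vspace 'M[F]_(n, m)}) v :
  \dim L = 1 -> v \in L -> v != 0 -> L = <[v]>%VS.
Proof.
move=> dL vL v0; apply/esym/eqP; rewrite eqEdim dL dim_vline v0 leqnn andbT.
by rewrite -memvE.
Qed.

Lemma mem_proj_act n g (L : {vspace 'cV[F]_n}) v : g \in unitmx ->
  (v \in proj_act g L) = (invmx g *m v \in L).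
Proof.
move=> gu; apply/memv_imgP/idP => [ [u uL ->]|vL].
  by rewrite lfunE /= mulKmx.
by exists (invmx g *m v); rewrite // lfunE /= mulKVmx.
Qed.

Lemma mem_dual_proj_act n g (L : {vspace 'rV[F]_n}) f : g \in unitmx ->
  (f \in dual_proj_act g L) = (f *m g \in L).
Proof.
move=> gu; apply/memv_imgP/idP => [ [u uL ->]|vL].
  by rewrite lfunE /= mulmxKV.
by exists (f *m g); rewrite // lfunE /= mulmxK.
Qed.

Lemma proj_actK n g (L : {vspace 'cV[F]_n}) : g \in unitmx ->
  proj_act (invmx g) (proj_act g L) = L.
Proof.
by move=> gu; apply/vspaceP => v; rewrite !mem_proj_act ?unitmx_inv // invmxK mulKmx.
Qed.

Lemma dual_proj_actK n g (L : {vspace 'rV[F]_n}) : g \in unitmx ->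
  dual_proj_act (invmx g) (dual_proj_act g L) = L.
Proof.
by move=> gu; apply/vspaceP => v; rewrite !mem_dual_proj_act ?unitmx_inv // mulmxKV.
Qed.

Lemma dim_proj_act n g (L : {vspace 'cV[F]_n}) : g \in unitmx ->
  \dim (proj_act g L) = \dim L.
Proof.
move=> gu; rewrite limg_dim_eq //; apply/eqP; rewrite -subv0.
apply/subvP => x; rewrite memv_cap memv_ker lfunE /= memv0 => /andP[_ /eqP E].
by rewrite -[x](mulKmx gu) E mulmx0.
Qed.

Lemma dim_dual_proj_act n g (L : {vspace 'rV[F]_n}) : g \in unitmx ->
  \dim (dual_proj_act g L) = \dim L.
Proof.
move=> gu; rewrite limg_dim_eq //; apply/eqP; rewrite -subv0.
apply/subvP => x; rewrite memv_cap memv_ker lfunE /= memv0 => /andP[_ /eqP E].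
by rewrite -[x](mulmxKV gu) E mul0mx.
Qed.

Lemma contr_mem n m k (U : {vspace 'M[F]_(n, m)}) p q (S : {vspace 'M[F]_(p, q)})
    (h : 'M[F]_(n, m) -> 'M[F]_(p, q)) :
  \dim U = k -> (forall a u v, h (a *: u + v) = a *: h u + h v) ->
  (forall f i, h (contr (plucker _ k U) f i) \in S) -> forall u, u \in U -> h u \in S.
Proof.
move=> dU hl; apply: contr_ind => // [|a u v hu hv].
  have -> : h 0 = 0.
    by have := hl 1 0 0; rewrite scaler0 addr0 scale1r => /eqP; rewrite -subr_eq0
      opprD addrA subrr sub0r oppr_eq0 => /eqP.
  exact: mem0v.
by rewrite hl memvD // memvZ.
Qed.

Lemma contr_neq0 n m k (L : {vspace 'M[F]_(n, m)}) v : \dim L = k -> v \in L ->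
  v != 0 -> exists p i, contr (plucker _ k L) p i != 0.
Proof.
move=> dL vL v0; apply: contrapT => no; move/eqP: v0; apply.
move: v vL; apply: (contr_ind dL) => // [a u w -> ->|p i].
  by rewrite scaler0 addr0.
by apply: contrapT => /eqP pi0; apply: no; exists p, i.
Qed.

End EquivariantIsomorphisms.

(** * Orbit 10 and projective space *)

Section ProjectiveSpaces.
Variable F : numClosedFieldType.
Local Notation rep := (rep F).
Implicit Types (U : {vspace 'M[F]_4}) (l : 'cV[F]_4) (f : 'rV[F]_4).

Local Notation d0 := (delta_mx i0 0 : 'cV[F]_4).
Local Notation r3 := (delta_mx 0 i3 : 'rV[F]_4).

Let nz2 : 2%:R != 0 :> F. Proof. by rewrite pnatr_eq0. Qed.

Lemma dim_orbit k U : pgl_orbit (rep k) U -> \dim U = 3.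
Proof. by move=> [g gu ->]; rewrite dim_conj ?dim_rep. Qed.

Lemma orbit_conj_closed k g U : g \in unitmx -> pgl_orbit (rep k) U ->
  pgl_orbit (rep k) (conj_act g U).
Proof.
move=> gu [h hu ->]; exists (g *m h); first by rewrite unitmx_mul gu.
by rewrite conj_act_comp.
Qed.

Lemma mem_rep10 (x : 'M[F]_4) : x \in rep 10 <->
  exists2 f : 'rV_4, f *m d0 = 0 & x = d0 *m f.
Proof.
split=> [/mem_rep[a [b [c ->] ] ]|[f f0 ->] ].
  exists (\row_j nth 0 [:: 0; a; b; c] j).
    by rewrite -colE; apply/matrixP => i j; rewrite !mxE.
  by apply: mx4P; rewrite !mxE big_ord1 !mxE /=; ring.
apply/mem_rep; exists (f 0 i1), (f 0 i2), (f 0 i3).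
have fi0 : f 0 i0 = 0 by have /matrixP /(_ 0 0) := f0; rewrite -colE !mxE.
by apply: mx4P; rewrite !mxE big_ord1 !mxE /= ?fi0; ring.
Qed.

Lemma mem_rep11 (x : 'M[F]_4) : x \in rep 11 <->
  exists2 l : 'cV_4, r3 *m l = 0 & x = l *m r3.
Proof.
split=> [/mem_rep[a [b [c ->] ] ]|[l l0 ->] ].
  exists (\col_j nth 0 [:: a; b; c; 0] j).
    by rewrite -rowE; apply/matrixP => i j; rewrite !mxE.
  by apply: mx4P; rewrite !mxE big_ord1 !mxE /=; ring.
apply/mem_rep; exists (l i0 0), (l i1 0), (l i2 0).
have li3 : l i3 0 = 0 by have /matrixP /(_ 0 0) := l0; rewrite -rowE !mxE.
by apply: mx4P; rewrite !mxE big_ord1 !mxE /= ?li3; ring.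
Qed.

Lemma delta_neq0 m n i j : (delta_mx i j : 'M[F]_(m, n)) != 0.
Proof.
apply/eqP => /matrixP /(_ i j); rewrite !mxE !eqxx => /eqP.
by rewrite oner_eq0.
Qed.

Lemma orbit10_mem U : pgl_orbit (rep 10) U -> exists l : 'cV_4,
  [/\ l != 0, exists (f : 'rV_4) (v : 'cV_4), f *m l = 0 /\ f *m v = 1%:M &
  forall x, x \in U <-> exists2 f : 'rV_4, f *m l = 0 & x = l *m f].
Proof.
move=> [g gu ->]; exists (g *m d0); split.
- apply: contraNneq (delta_neq0 i0 (0 : 'I_1)) => /(congr1 (mulmx (invmx g))).
  by rewrite mulKmx // mulmx0 => ->.
- exists (delta_mx 0 i1 *m invmx g), (g *m delta_mx i1 0).
  rewrite -!mulmxA !mulKmx //.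
  by split; rewrite -rowE; apply/matrixP => i j; rewrite !ord1 !mxE.
move=> x; rewrite mem_conj //; split.
  move=> /mem_rep10[f f0 xE]; exists (f *m invmx g).
    by rewrite -mulmxA mulKmx.
  by rewrite -mulmxA [_ *m (f *m _)]mulmxA -xE -!mulmxA mulKVmx // mulmxV // mulmx1.
move=> [f f0 ->]; apply/mem_rep10; exists (f *m g); first by rewrite -mulmxA.
by rewrite -!mulmxA mulKmx.
Qed.

Lemma orbit11_mem U : pgl_orbit (rep 11) U -> exists f : 'rV_4,
  [/\ f != 0, exists (l : 'cV_4) (v : 'rV_4), f *m l = 0 /\ v *m l = 1%:M &
  forall x, x \in U <-> exists2 l : 'cV_4, f *m l = 0 & x = l *m f].
Proof.
move=> [g gu ->]; exists (r3 *m invmx g); split.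
- apply: contraNneq (delta_neq0 (0 : 'I_1) i3) => /(congr1 (mulmx^~ g)).
  by rewrite /= mulmxKV // mul0mx => ->.
- exists (g *m delta_mx i1 0), (delta_mx 0 i1 *m invmx g).
  rewrite -!mulmxA !mulKmx //.
  by split; rewrite -rowE; apply/matrixP => i j; rewrite !ord1 !mxE.
move=> x; rewrite mem_conj //; split.
  move=> /mem_rep11[l l0 xE]; exists (g *m l).
    by rewrite -mulmxA mulKmx.
  by rewrite -mulmxA [l *m (_ *m _)]mulmxA -xE -!mulmxA mulKVmx // mulmxV // mulmx1.
move=> [l l0 ->]; apply/mem_rep11; exists (invmx g *m l); first by rewrite mulmxA.
by rewrite !mulmxA mulmxKV.
Qed.

(** A member [U] of the orbit consists of the maps [l *m f] with [f *m l = 0]. The line of [l] has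
    the sections [x *m v] with [x] in [U]; conversely [U] has the quadratic sections provided by
    [skew_delta_row]. *)
Lemma orbit10_iso : pgl_isomorphic (plucker _ 3) (@conj_act _ 4)
  (pgl_orbit (rep 10)) (plucker _ 1) (@proj_act _ 4) (proj_space F 4).
Proof.
pose R U (L : {vspace 'cV[F]_4}) := forall x (v : 'cV_4), x \in U -> x *m v \in L.
have lineR U L l : R U L -> \dim L = 1 -> l != 0 ->
    (exists (f : 'rV_4) (v : 'cV_4), f *m l = 0 /\ f *m v = 1%:M) ->
    (forall x, x \in U <-> exists2 f : 'rV_4, f *m l = 0 & x = l *m f) -> L = <[l]>%VS.
  move=> UL dL l0 [f [v [fl fv] ] ] Ul; apply: line_span => //.
  have : l *m f *m v \in L by apply/UL/Ul; exists f.
  by rewrite -mulmxA fv mulmx1.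
have mem_lines U l : (forall x, x \in U <-> exists2 f : 'rV_4, f *m l = 0 & x = l *m f) ->
    R U <[l]>%VS.
  move=> Ul x v /Ul[f _ ->]; rewrite -mulmxA [f *m v]mx11_scalar mul_mx_scalar.
  by rewrite memvZ ?memv_line.
have rep10l x : x \in rep 10 <-> exists2 f : 'rV_4, f *m d0 = 0 &
    x = d0 *m f by exact: mem_rep10.
apply: (@pgl_iso_of_orbits _ _ _ _ _ _ _ _ _ _ _ _ (rep 10)
  <[d0]>%VS R).
- by move=> g U gu; exact: conj_actK.
- by move=> g L gu; exact: proj_actK.
- by move=> g U gu; exact: orbit_conj_closed.
- by move=> g L gu [_ dL]; split; rewrite ?subvf ?dim_proj_act.
- by [].
- move=> L [_ dL]; have l0 : vpick L != 0 by rewrite vpick0 -dimv_eq0 dL.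
  have [g gu lE] := unit_first_col l0; exists g => //.
  rewrite (line_span dL (memv_pick L) l0) lE /proj_act limg_line lfunE /=.
  by congr <[_ *m delta_mx _ _]>%VS; exact: val_inj.
- move=> g U L gu UL _ v /(conj_inP gu)[x xU ->].
  by rewrite mem_proj_act // -!mulmxA mulKmx // UL.
- exact: pgl_orbit_refl.
- by split; rewrite ?subvf // dim_vline delta_neq0.
- exact: mem_lines.
- move=> L [_ dL] UL; apply: lineR UL dL _ _ rep10l; first exact: delta_neq0.
  exists (delta_mx 0 i1), (delta_mx i1 0).
  by split; rewrite -rowE; apply/matrixP => i j; rewrite !ord1 !mxE.
- move=> U XU UL; have [l [l0 lf Ul] ] := orbit10_mem XU.
  have lE : l \in <[d0]>%VS.
    by rewrite (lineR _ _ _ UL _ l0 lf Ul) ?memv_line // dim_vline delta_neq0.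
  have [a lE'] := vlineP _ _ lE.
  have a0 : a != 0 by apply: contraNneq l0 => a0; rewrite lE' a0 scale0r.
  apply/eqP; rewrite eqEdim (dim_orbit XU) dim_rep leqnn andbT.
  apply/subvP => x /Ul[f fl ->]; apply/mem_rep10; exists (a *: f).
    by rewrite -scalemxAl scalemxAr -lE'.
  by rewrite lE' -scalemxAl scalemxAr.
- move=> f fXY fR; apply: generated_locally_poly => [U /fXY[] //|U XU S Ssec].
  have [l [l0 [h [v [hl hv] ] ] Ul] ] := orbit10_mem XU.
  rewrite (lineR _ _ _ (fR _ XU) (proj2 (fXY _ XU)) l0 _ Ul); last by exists h, v.
  suff US x : x \in U -> x *m v \in S.
    by rewrite -memvE -[l]mulmx1 -hv mulmxA US //; apply/Ul; exists h.
  move: x; apply: (contr_mem (dim_orbit XU)) => [a x y|p i].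
    by rewrite mulmxDl scalemxAl.
  apply: (Ssec (fun c => contr c p i *m v)); exists 1%N; split.
    by apply: hmxMr; exact: hmx_contr.
  by move=> V XV; apply: fR => //; apply: contr_in; exact: dim_orbit XV.
move=> f fYX fR; apply: generated_locally_poly => [L /fYX/dim_orbit //|L YL S Ssec].
have [_ dL] := YL.
have secP E L' l' : proj_space F 4 L' -> E^T = - E -> l' \in L' ->
    l' *m (l'^T *m E) \in f L'.
  move=> YL' Es; have XU := fYX _ YL'.
  have [l [l0 lf Ul] ] := orbit10_mem XU.
  rewrite {1}(lineR _ _ _ (fR _ YL') (proj2 YL') l0 lf Ul) => /vlineP[a l'E].
  apply/Ul; exists (a *: (l'^T *m E)); last by rewrite l'E -scalemxAl scalemxAr.
  by rewrite -scalemxAl scalemxAr -l'E skew_quad.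
have [l [l0 lf Ul] ] := orbit10_mem (fYX _ YL).
have LE := lineR _ _ _ (fR _ YL) dL l0 lf Ul.
have lL : l \in L by rewrite LE memv_line.
have [p [i pi0] ] := contr_neq0 dL lL l0.
set l' := contr _ p i in pi0.
have [a l'E] : exists a, l' = a *: l.
  by apply/vlineP; rewrite -LE; exact: contr_in.
have a0 : a != 0 by apply: contraNneq pi0 => a0; rewrite l'E a0 scale0r.
apply/subvP => _ /Ul[h hl ->].
have hl' : h *m l' = 0 by rewrite l'E -scalemxAr hl scaler0.
have [E Es EE] := skew_delta_row pi0 hl'.
have -> : l *m h = a^-1 *: (l' *m (l'^T *m E)).
  by rewrite EE l'E -scalemxAl scalerA mulVf // scale1r.
apply: memvZ; apply: (Ssec (fun c => contr c p i *m ((contr c p i)^T *m E))).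
exists (1 + 1)%N; split; last first.
  by move=> L' YL'; apply: secP => //; apply: contr_in; have [] := YL'.
by apply: hmxM; [exact: hmx_contr | apply/hmxMr/hmxT; exact: hmx_contr].
Qed.

End ProjectiveSpaces.

(** * Orbit 11 and the dual projective space *)

Section DualProjectiveSpace.
Variable F : numClosedFieldType.
Local Notation rep := (rep F).
Local Notation r3 := (delta_mx 0 i3 : 'rV[F]_4).
Implicit Types (U : {vspace 'M[F]_4}) (l : 'cV[F]_4) (f : 'rV[F]_4).

Let nz2 : 2%:R != 0 :> F. Proof. by rewrite pnatr_eq0. Qed.

(** The transpose of the argument for orbit 10: here [f] is fixed in the maps [l *m f], and the
    sections of [U] are [E *m f^T *m f] with [E] skew. *)
Lemma orbit11_iso : pgl_isomorphic (plucker _ 3) (@conj_act _ 4)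
  (pgl_orbit (rep 11)) (plucker _ 1) (@dual_proj_act _ 4) (dual_proj_space F 4).
Proof.
pose R U (L : {vspace 'rV[F]_4}) := forall x (v : 'rV_4), x \in U -> v *m x \in L.
have lineR U L f : R U L -> \dim L = 1 -> f != 0 ->
    (exists (l : 'cV_4) (v : 'rV_4), f *m l = 0 /\ v *m l = 1%:M) ->
    (forall x, x \in U <-> exists2 l : 'cV_4, f *m l = 0 & x = l *m f) ->
    L = <[f]>%VS.
  move=> UL dL f0 [l [v [fl vl] ] ] Uf; apply: line_span => //.
  have : v *m (l *m f) \in L by apply/UL/Uf; exists l.
  by rewrite mulmxA vl mul1mx.
have mem_lines U f :
    (forall x, x \in U <-> exists2 l : 'cV_4, f *m l = 0 & x = l *m f) ->
    R U <[f]>%VS.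
  move=> Uf x v /Uf[l _ ->]; rewrite mulmxA [v *m l]mx11_scalar mul_scalar_mx.
  by rewrite memvZ ?memv_line.
have rep11f x : x \in rep 11 <-> exists2 l : 'cV_4, r3 *m l = 0 & x = l *m r3.
  exact: mem_rep11.
apply: (@pgl_iso_of_orbits _ _ _ _ _ _ _ _ _ _ _ _ (rep 11) <[r3]>%VS R).
- by move=> g U gu; exact: conj_actK.
- by move=> g L gu; exact: dual_proj_actK.
- by move=> g U gu; exact: orbit_conj_closed.
- by move=> g L gu [_ dL]; split; rewrite ?subvf ?dim_dual_proj_act.
- by [].
- move=> L [_ dL]; have l0 : vpick L != 0 by rewrite vpick0 -dimv_eq0 dL.
  have [g gu lE] := unit_last_row l0; exists g => //.
  rewrite (line_span dL (memv_pick L) l0) /dual_proj_act limg_line lfunE /=.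
  rewrite -[vpick L](mulmxK gu) lE.
  by congr <[delta_mx _ _ *m _]>%VS; exact: val_inj.
- move=> g U L gu UL _ v /(conj_inP gu)[x xU ->].
  by rewrite mem_dual_proj_act // !mulmxA mulmxKV // UL.
- exact: pgl_orbit_refl.
- by split; rewrite ?subvf // dim_vline delta_neq0.
- exact: mem_lines.
- move=> L [_ dL] UL; apply: lineR UL dL _ _ rep11f; first exact: delta_neq0.
  exists (delta_mx i1 0), (delta_mx 0 i1).
  by split; rewrite -rowE; apply/matrixP => i j; rewrite !ord1 !mxE.
- move=> U XU UL; have [f [f0 fl Uf] ] := orbit11_mem XU.
  have fE : f \in <[r3]>%VS.
    by rewrite (lineR _ _ _ UL _ f0 fl Uf) ?memv_line // dim_vline delta_neq0.
  have [a fE'] := vlineP _ _ fE.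
  have a0 : a != 0 by apply: contraNneq f0 => a0; rewrite fE' a0 scale0r.
  apply/eqP; rewrite eqEdim (dim_orbit XU) dim_rep leqnn andbT.
  apply/subvP => x /Uf[l fl0 ->]; apply/mem_rep11; exists (a *: l).
    by rewrite -scalemxAr scalemxAl -fE'.
  by rewrite fE' -scalemxAr scalemxAl.
- move=> h hXY hR; apply: generated_locally_poly => [U /hXY[] //|U XU S Ssec].
  have [f [f0 [l [v [fl vl] ] ] Uf] ] := orbit11_mem XU.
  rewrite (lineR _ _ _ (hR _ XU) (proj2 (hXY _ XU)) f0 _ Uf); last by exists l, v.
  suff US x : x \in U -> v *m x \in S.
    by rewrite -memvE -[f]mul1mx -vl -mulmxA US //; apply/Uf; exists l.
  move: x; apply: (contr_mem (dim_orbit XU)) => [a x y|p i].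
    by rewrite mulmxDr scalemxAr.
  apply: (Ssec (fun c => v *m contr c p i)); exists 1%N; split.
    by apply: hmxMl; exact: hmx_contr.
  by move=> V XV; apply: hR => //; apply: contr_in; exact: dim_orbit XV.
move=> h hYX hR; apply: generated_locally_poly => [L /hYX/dim_orbit //|L YL S Ssec].
have [_ dL] := YL.
have secP E L' f' : dual_proj_space F 4 L' -> E^T = - E -> f' \in L' ->
    E *m f'^T *m f' \in h L'.
  move=> YL' Es; have XU := hYX _ YL'.
  have [f [f0 fl Uf] ] := orbit11_mem XU.
  rewrite {1}(lineR _ _ _ (hR _ YL') (proj2 YL') f0 fl Uf) => /vlineP[a f'E].
  apply/Uf; exists (a *: (E *m f'^T)); last by rewrite f'E -scalemxAr scalemxAl.
  have := skew_quad f'^T nz2 Es; rewrite trmxK -mulmxA => <-.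
  by rewrite -scalemxAr scalemxAl -f'E.
have [f [f0 fl Uf] ] := orbit11_mem (hYX _ YL).
have LE := lineR _ _ _ (hR _ YL) dL f0 fl Uf.
have fL : f \in L by rewrite LE memv_line.
have [p [i pi0] ] := contr_neq0 dL fL f0; set f' := contr _ p i in pi0.
have [a f'E] : exists a, f' = a *: f.
  by apply/vlineP; rewrite -LE; exact: contr_in.
have a0 : a != 0 by apply: contraNneq pi0 => a0; rewrite f'E a0 scale0r.
apply/subvP => _ /Uf[l fl0 ->].
have [||E Es EE] := @skew_delta_row F 4 f'^T l^T; first by rewrite trmx_eq0.
  by rewrite -trmx_mul f'E -scalemxAl fl0 scaler0 trmx0.
have {}EE : l = (- E) *m f'^T.
  by apply: trmx_inj; rewrite trmx_mul linearN /= Es opprK -EE.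
have -> : l *m f = a^-1 *: ((- E) *m f'^T *m f').
  by rewrite -EE f'E -scalemxAr scalerA mulVf // scale1r.
apply: memvZ; apply: (Ssec (fun c => (- E) *m (contr c p i)^T *m contr c p i)).
exists (1 + 1)%N; split; last first.
  move=> L' YL'; apply: secP => //; first by rewrite linearN /= Es.
  by apply: contr_in; have [] := YL'.
by apply: hmxM; [apply/hmxMl/hmxT; exact: hmx_contr | exact: hmx_contr].
Qed.

End DualProjectiveSpace.

(** * Complete flags and their relation to orbit 12 *)

Section Flags.
Variable F : numClosedFieldType.
Local Notation rep := (rep F).
Local Notation e_ i := (delta_mx i 0 : 'cV[F]_4).
Implicit Types (U : {vspace 'M[F]_4}) (E : flag4_type F).

(* The Hodge star on the second exterior power: star (a ^ b) is the skew form
   det(a, b, -, -). *)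
Definition star (A : 'M[F]_4) : 'M[F]_4 :=
  mx4 0 (A i2 i3) (- A i1 i3) (A i1 i2)
      (- A i2 i3) 0 (A i0 i3) (- A i0 i2)
      (A i1 i3) (- A i0 i3) 0 (A i0 i1)
      (- A i1 i2) (A i0 i2) (- A i0 i1) 0.

Definition wedge (a b : 'cV[F]_4) : 'M[F]_4 := a *m b^T - b *m a^T.

Lemma wedgeE a b i j : wedge a b i j = a i 0 * b j 0 - b i 0 * a j 0.
Proof. by rewrite !mxE !big_ord1 !mxE. Qed.

Lemma star_wedge_mul a b : star (wedge a b) *m a = 0 /\ star (wedge a b) *m b = 0.
Proof.
by split; apply/colP; apply: ord4P; rewrite [RHS]mxE mxE sum4 ![star _ _ _]mxE /=
  !wedgeE; ring.
Qed.

Lemma tr_star A : (star A)^T = - star A.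
Proof. by rewrite tr_mx4; apply: mx4P; rewrite !mxE /=; ring. Qed.

Lemma star_lin a A B : star (a *: A + B) = a *: star A + star B.
Proof. by rewrite mx4_lin; congr mx4; rewrite ?mxE; ring. Qed.

Lemma star_eq0 A : A^T = - A -> star A = 0 -> A = 0.
Proof.
move=> /skew_mx4[a [b [c [d [e [f ->] ] ] ] ] ] /matrixP sE.
have := (sE i0 i1, sE i0 i2, sE i0 i3, sE i1 i2, sE i3 i1, sE i2 i3).
rewrite !mxE /= => [ [ [ [ [ [f0 e0] d0] c0] b0] a0] ].
have {}e0 : e = 0 by apply: oppr_inj; rewrite e0 oppr0.
by rewrite a0 b0 c0 d0 e0 f0; apply: mx4P; rewrite !mxE /= ?oppr0.
Qed.

Lemma tr_wedge a b : (wedge a b)^T = - wedge a b.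
Proof. by rewrite linearB /= !trmx_mul !trmxK opprB. Qed.

Lemma wedge_mul (g : 'M[F]_4) a b :
  wedge (g *m a) (g *m b) = g *m wedge a b *m g^T.
Proof. by rewrite /wedge !trmx_mul mulmxBr mulmxBl !mulmxA. Qed.

Definition J23 : 'M[F]_4 := mx4 0 0 0 0 0 0 0 0 0 0 0 1 0 0 (- 1) 0.

(** Read in the frame [g], the star is a skew form whose kernel contains the first two basis
    vectors, which leaves a multiple of [J23]. The multiple is nonzero because [star] is injective
    on skew matrices and the wedge of two basis vectors is nonzero. *)
Lemma star_wedge_frame (g : 'M[F]_4) : g \in unitmx -> exists2 t : F, t != 0 &
  star (wedge (g *m e_ i0) (g *m e_ i1)) = t *: ((invmx g)^T *m J23 *m invmx g).
Proof.
move=> gu; set S := star _; pose M := g^T *m S *m g.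
have [S0 S1] := star_wedge_mul (g *m e_ i0) (g *m e_ i1).
have Ms : M^T = - M.
  by rewrite !trmx_mul trmxK tr_star mulNmx mulmxN mulmxA.
have gTu : g^T \in unitmx by rewrite unitmx_tr.
have SE : S = (invmx g)^T *m M *m invmx g.
  by rewrite trmx_inv /M !mulmxA mulVmx // mul1mx mulmxK.
have Mcol i : S *m (g *m e_ i) = 0 -> forall k, M k i = 0.
  move=> Si k; have : M *m e_ i = 0 by rewrite /M -!mulmxA Si mulmx0.
  by rewrite -colE => /colP /(_ k); rewrite !mxE.
have M0 := Mcol _ S0; have M1 := Mcol _ S1.
have ME : M = M i2 i3 *: J23.
  move: Ms M0 M1 => /skew_mx4; move: (M) => A [a [b [c [d [e [f ->] ] ] ] ] ].
  move=> A0 A1; have := (A0 i1, A0 i2, A0 i3, A1 i2, A1 i3).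
  rewrite !mxE /=; do 4![case]; do 5![move=> /eqP; rewrite oppr_eq0 => /eqP ->].
  by apply: mx4P; rewrite !mxE /= ?oppr0; ring.
exists (M i2 i3); last by rewrite SE {1}ME -scalemxAr -scalemxAl.
apply/eqP => t0; have Sz : S = 0 by rewrite SE ME t0 scale0r mulmx0 mul0mx.
have := star_eq0 (tr_wedge _ _) Sz; rewrite wedge_mul => W0.
have : wedge (e_ i0) (e_ i1) = 0.
  rewrite -[LHS](mulKmx gu) -[_ *m wedge _ _](mulmxK gTu).
  by rewrite W0 !(mul0mx, mulmx0).
move=> /matrixP /(_ i0 i1); rewrite wedgeE !mxE /= mulr1 mulr0 subr0 => /eqP.
by rewrite oner_eq0.
Qed.

Definition line0 : {vspace 'cV[F]_4} := <<[:: e_ i0]>>%VS.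
Definition plane0 : {vspace 'cV[F]_4} := <<[:: e_ i0; e_ i1]>>%VS.
Definition hyper0 : {vspace 'cV[F]_4} := <<[:: e_ i0; e_ i1; e_ i2]>>%VS.
Definition flag0 : flag4_type F := (line0, plane0, hyper0).

Lemma cV4E (v : 'cV[F]_4) : v = v i0 0 *: e_ i0 + v i1 0 *: e_ i1 +
  v i2 0 *: e_ i2 + v i3 0 *: e_ i3.
Proof. by apply/colP; apply: ord4P; rewrite !mxE /=; ring. Qed.

Let free3 : free [:: e_ i0; e_ i1; e_ i2].
Proof.
apply/(@freeP _ _ 3 [tuple e_ i0; e_ i1; e_ i2]) => a.
rewrite !big_ord_recl big_ord0 /= addr0 => /colP aE.
have := (aE i0, aE i1, aE i2); rewrite !mxE /=.
rewrite !(mulr0, mulr1, addr0, add0r) => [ [ [a0 a1] a2] ] [ [|[|[|//] ] ] Hi].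
- by rewrite -a0; congr a; exact: val_inj.
- by rewrite -a1; congr a; exact: val_inj.
- by rewrite -a2; congr a; exact: val_inj.
Qed.

Lemma dim_hyper0 : \dim hyper0 = 3.
Proof. by apply/eqP. Qed.

Lemma dim_plane0 : \dim plane0 = 2.
Proof.
apply/eqP; apply: (@catl_free _ _ [:: e_ i2]); exact: free3.
Qed.

Lemma dim_line0 : \dim line0 = 1.
Proof.
by rewrite /line0 span_seq1 dim_vline delta_neq0.
Qed.

Lemma mem_line0 v : v \in line0 -> v = v i0 0 *: e_ i0.
Proof.
rewrite /line0 span_seq1 => /vlineP[a ->].
by apply/colP; apply: ord4P; rewrite !mxE /=; ring.
Qed.

Lemma mem_plane0 v : v \in plane0 -> v = v i0 0 *: e_ i0 + v i1 0 *: e_ i1.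
Proof.
rewrite /plane0 span_cons span_seq1 => /memv_addP[_ /vlineP[a ->] [_ /vlineP[b ->] ->] ].
by apply/colP; apply: ord4P; rewrite !mxE /=; ring.
Qed.

Lemma mem_hyper0 v : v \in hyper0 <-> v i3 0 = 0.
Proof.
rewrite /hyper0 !span_cons span_nil addv0; split.
  move=> /memv_addP[_ /vlineP[a ->] [_ /memv_addP[_ /vlineP[b ->]
    [_ /vlineP[c ->] ->] ] ->] ].
  by rewrite !mxE /=; ring.
move=> v3; rewrite [v]cV4E v3 scale0r addr0 -addrA.
by rewrite !memv_add // memvZ ?memv_line.
Qed.

Lemma flag4_flag0 : flag4 F flag0.
Proof.
rewrite /flag4 /= dim_line0 dim_plane0 dim_hyper0; split=> //.
apply/andP; split; apply/span_subvP => v; rewrite !inE.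
  by move=> /eqP ->; apply/memv_span; rewrite inE eqxx.
by move=> /orP[] /eqP ->; apply/memv_span; rewrite !inE eqxx ?orbT.
Qed.

Lemma flag4_actK g E : g \in unitmx -> flag4_act (invmx g) (flag4_act g E) = E.
Proof.
by move=> gu; case: E => [ [L W] H]; rewrite /flag4_act /= !proj_actK.
Qed.

Lemma proj_act_sub g (A B : {vspace 'cV[F]_4}) : g \in unitmx ->
  (A <= B)%VS -> (proj_act g A <= proj_act g B)%VS.
Proof. by move=> gu AB; exact: limgS. Qed.

Lemma flag4_act_flag4 g E : g \in unitmx -> flag4 F E -> flag4 F (flag4_act g E).
Proof.
move=> gu [dL dW dH /andP[LW WH] ]; split; rewrite /= ?dim_proj_act //.
by rewrite !proj_act_sub.
Qed.

Lemma vspace_notin (V : vectType F) (A B : {vspace V}) :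
  (\dim A < \dim B)%N -> exists2 v, v \in B & v \notin A.
Proof.
move=> AB; apply: contrapT => no; have /dimvS : (B <= A)%VS.
  by apply/subvP => v vB; apply: contrapT => /negP vA; apply: no; exists v.
by rewrite leqNgt AB.
Qed.

Lemma flag4_transitive E : flag4 F E ->
  exists2 g, g \in unitmx & E = flag4_act g flag0.
Proof.
case: E => [ [L W] H] [/= dL dW dH /andP[/subvP LW /subvP WH] ].
have [|l lL l0] := @vspace_notin _ 0%VS L; first by rewrite dimv0 dL.
have [|w wW wL] := @vspace_notin _ L W; first by rewrite dL dW.
have [|h hH hW] := @vspace_notin _ W H; first by rewrite dW dH.
have [|m _ mH] := @vspace_notin _ H fullv; first by rewrite dH dimvf /dim /=.
have comb (A : {vspace 'cV[F]_4}) u v a : u \in A -> v \notin A ->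
    u + a *: v = 0 -> a = 0.
  move=> uA vA uv; apply: contrapT => /eqP a0; case/negP: vA.
  have -> : v = - a^-1 *: u.
    have -> : u = - (a *: v) by apply/eqP; rewrite -addr_eq0 uv.
    by rewrite scalerN scaleNr opprK scalerA mulVf // scale1r.
  exact: memvZ.
pose g := cols4 l w h m.
have gu : g \in unitmx.
  apply: unitmx_inj => u; rewrite cols4_mul => E0.
  have u3 : u i3 0 = 0.
    by apply: comb mH E0; rewrite !memvD ?memvZ // ?(WH _ wW) ?WH ?LW.
  move: E0; rewrite u3 scale0r addr0 => E0.
  have u2 : u i2 0 = 0 by apply: comb hW E0; rewrite !memvD ?memvZ // LW.
  move: E0; rewrite u2 scale0r addr0 => E0.
  have u1 : u i1 0 = 0 by apply: comb wL E0; rewrite memvZ.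
  have u0 : u i0 0 = 0.
    by apply: (comb 0%VS 0 l) => //; rewrite ?mem0v // add0r -[RHS]E0 u1 scale0r addr0.
  by apply/colP; apply: ord4P; rewrite [RHS]mxE.
have ge : [/\ g *m e_ i0 = l, g *m e_ i1 = w & g *m e_ i2 = h].
  by split; rewrite cols4_mul !mxE /= ?(scale0r, scale1r, addr0, add0r).
have [g0 g1 g2] := ge; exists g => //.
have mem_img (A B : {vspace 'cV[F]_4}) : \dim A = \dim B ->
    (forall v, v \in A -> g *m v \in B) -> B = proj_act g A.
  move=> dAB AB; apply/esym/eqP; rewrite eqEdim dim_proj_act // dAB leqnn andbT.
  by apply/subvP => v; rewrite mem_proj_act // => /AB; rewrite mulKVmx.
congr (_, _, _); apply: mem_img; rewrite ?dim_line0 ?dim_plane0 ?dim_hyper0 //.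
- by move=> v /mem_line0 ->; rewrite -scalemxAr g0 memvZ.
- by move=> v /mem_plane0 ->; rewrite mulmxDr -!scalemxAr g0 g1 memvD ?memvZ // LW.
move=> v /mem_hyper0 v3; rewrite [v]cV4E v3 scale0r addr0.
by rewrite !mulmxDr -!scalemxAr g0 g1 g2 !memvD ?memvZ // ?(WH _ wW) ?WH ?LW.
Qed.

(** Every [x] induces a map from V/W to W that sends H/W into the line, W and H being the plane and
    the hyperplane of [E]. On orbit 12 this relation is the graph of the isomorphism. *)
Definition flag_rel U E : Prop := forall x, x \in U ->
  [/\ forall v : 'cV_4, x *m v \in E.1.2, forall v, v \in E.1.2 -> x *m v = 0 &
      forall v, v \in E.2 -> x *m v \in E.1.1].

Lemma flag_rel_act g U E : g \in unitmx ->
  flag_rel U E -> flag_rel (conj_act g U) (flag4_act g E).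
Proof.
move=> gu UE _ /(conj_inP gu)[x /UE[x1 x2 x3] ->]; split=> v /=;
  rewrite !mem_proj_act // -!mulmxA ?mulKmx //.
  by move=> /x2 ->; rewrite mulmx0.
exact: x3.
Qed.

Lemma nform12_mul a b c (v : 'cV_4) : nform 12 a b c *m v =
  (a * v i2 0 + b * v i3 0) *: e_ i0 + (c * v i3 0) *: e_ i1.
Proof. by apply/colP; apply: ord4P; rewrite !mxE ?sum4 !mxE /=; ring. Qed.

Lemma e0_line0 : e_ i0 \in line0. Proof. by apply/memv_span; rewrite inE. Qed.

Lemma e0_plane0 : e_ i0 \in plane0. Proof. by apply/memv_span; rewrite inE eqxx. Qed.

Lemma e1_plane0 : e_ i1 \in plane0.
Proof. by apply/memv_span; rewrite !inE eqxx orbT. Qed.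

Lemma flag_rel_rep : flag_rel (rep 12) flag0.
Proof.
move=> _ /mem_rep[a [b [c ->] ] ]; split=> v /=; rewrite nform12_mul.
- by rewrite memvD // memvZ // ?e0_plane0 ?e1_plane0.
- move=> /mem_plane0 ->; rewrite !mxE /= !(mulr0, addr0) !scale0r.
  by rewrite addr0.
by move=> /mem_hyper0 ->; rewrite !mulr0 scale0r !addr0 memvZ // e0_line0.
Qed.

Lemma flag_rel_rep_uniq E : flag4 F E -> flag_rel (rep 12) E -> E = flag0.
Proof.
case: E => [ [L W] H] [/= dL dW dH /andP[LW WH] ] UE.
have UE' a b c := UE _ (nform_in 12 a b c).
have e0W : e_ i0 \in W.
  have [/(_ (e_ i2)) + _ _] := UE' 1 0 0.
  by rewrite nform12_mul !mxE /= !(mulr0, mulr1, mul0r, addr0) scale1r scale0r addr0.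
have e1W : e_ i1 \in W.
  have [/(_ (e_ i3)) + _ _] := UE' 0 0 1.
  by rewrite nform12_mul !mxE /= !(mulr0, mulr1, mul0r, addr0) scale1r scale0r add0r.
have WE : W = plane0.
  apply/esym/eqP; rewrite eqEdim dim_plane0 dW leqnn andbT.
  by apply/span_subvP => v; rewrite !inE => /orP[] /eqP ->.
have HE : H = hyper0.
  apply/eqP; rewrite eqEdim dim_hyper0 dH leqnn andbT.
  (* A vector of [H] outside [hyper0] would put both [e_ i0] and [e_ i1] on the line [L]. *)
  apply/subvP => v vH; apply/mem_hyper0; apply: contrapT => /eqP v3.
  have e0L : e_ i0 \in L.
    have [_ _ /(_ v vH)] := UE' 0 1 0.
    rewrite nform12_mul !(mul0r, mul1r, add0r) scale0r addr0.
    by move=> /(memvZ (v i3 0)^-1); rewrite scalerA mulVf // scale1r.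
  have e1L : e_ i1 \in L.
    have [_ _ /(_ v vH)] := UE' 0 0 1.
    rewrite nform12_mul !(mul0r, mul1r, add0r) scale0r add0r.
    by move=> /(memvZ (v i3 0)^-1); rewrite scalerA mulVf // scale1r.
  have /dimvS : (plane0 <= L)%VS.
    by apply/span_subvP => u; rewrite !inE => /orP[] /eqP ->.
  by rewrite dim_plane0 dL.
have LE : L = line0.
  rewrite /line0 span_seq1; apply: line_span; rewrite ?delta_neq0 //.
  have [_ _ /(_ (e_ i2))] := UE' 1 0 0.
  rewrite nform12_mul !mxE /= !(mulr0, mulr1, mul0r, addr0) scale1r scale0r addr0.
  by apply; rewrite HE; apply/mem_hyper0; rewrite mxE.
by rewrite LE WE HE.
Qed.

Lemma flag_rel_flag0 U : pgl_orbit (rep 12) U -> flag_rel U flag0 -> U = rep 12.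
Proof.
move=> XU UE; apply/eqP; rewrite eqEdim (dim_orbit XU) dim_rep leqnn andbT.
apply/subvP => x xU; have [/= x1 x2 x3] := UE x xU.
have xcol i j : x i j = (x *m e_ j) i 0 by rewrite -colE mxE.
have x23 j : x i2 j = 0 /\ x i3 j = 0.
  by rewrite !xcol (mem_plane0 (x1 _)) !mxE /= !mulr0 addr0.
have x0 i : x i i0 = 0 by rewrite xcol x2 ?e0_plane0 // mxE.
have x1' i : x i i1 = 0 by rewrite xcol x2 ?e1_plane0 // mxE.
have x12 : x i1 i2 = 0.
  rewrite xcol (mem_line0 (x3 (e_ i2) _)) ?mxE /= ?mulr0 //.
  by apply/mem_hyper0; rewrite mxE.
apply/mem_rep; exists (x i0 i2), (x i0 i3), (x i1 i3).
rewrite {1}[x]mx4E !x0 !x1' x12.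
by have [-> ->] := x23 i2; have [-> ->] := x23 i3.
Qed.

(** One matrix [g] adapted to both sides reduces the later computations to the base pair. *)
Lemma flag_frame U E : pgl_orbit (rep 12) U -> flag4 F E -> flag_rel U E ->
  exists g, [/\ g \in unitmx, U = conj_act g (rep 12) & E = flag4_act g flag0].
Proof.
move=> XU /flag4_transitive[g gu EE] UE; exists g; split=> //.
have gVu : invmx g \in unitmx by rewrite unitmx_inv.
rewrite -(conj_actK U gVu) invmxK; congr conj_act.
apply: flag_rel_flag0; first exact: orbit_conj_closed.
by rewrite -(flag4_actK flag0 gu) -EE; exact: flag_rel_act.
Qed.

End Flags.

(** * Sections over orbit 12 and over the flag variety *)

Section FlagVariety.
Variable F : numClosedFieldType.
Local Notation rep := (rep F).
Local Notation e_ i := (delta_mx i 0 : 'cV[F]_4).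
Local Notation V := 'cV[F]_4.
Local Notation fc := (@flag4_coord F).
Implicit Types (U : {vspace 'M[F]_4}) (E : flag4_type F).

Lemma flag_locally_poly (T : Type) n (c : T -> 'I_n -> F) (X : set T)
    (f : T -> flag4_type F) :
  locally_poly c X (plucker _ 1) (fun x => (f x).1.1) ->
  locally_poly c X (plucker _ 2) (fun x => (f x).1.2) ->
  locally_poly c X (plucker _ 3) (fun x => (f x).2) ->
  locally_poly c X fc f.
Proof.
move=> f1 f2 f3 x Xx.
have [d1 [q1 [h1 [s1 x1] y1] ] ] := f1 x Xx.
have [d2 [q2 [h2 [s2 x2] y2] ] ] := f2 x Xx.
have [d3 [q3 [h3 [s3 x3] y3] ] ] := f3 x Xx.
exists (d1 + d2 + d3)%N, (fun s v => q1 (enum_val s).1.1 v *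
  q2 (enum_val s).1.2 v * q3 (enum_val s).2 v); split.
- by move=> s; do 2?apply: hpolyM.
- by exists (enum_rank ((s1, s2, s3) : flag4_idx F)); rewrite enum_rankK /= !mulf_neq0.
move=> y Xy [s]; rewrite !mulf_eq0 !negb_or => /andP[/andP[z1 z2] z3].
have [a1 a10 a1E] := y1 y Xy (ex_intro (fun j => is_true (q1 j (c y) != 0)) _ z1).
have [a2 a20 a2E] := y2 y Xy (ex_intro (fun j => is_true (q2 j (c y) != 0)) _ z2).
have [a3 a30 a3E] := y3 y Xy (ex_intro (fun j => is_true (q3 j (c y) != 0)) _ z3).
exists (a1 * a2 * a3) => [|t]; first by rewrite !mulf_neq0.
by rewrite /flag4_coord a1E a2E a3E; ring.
Qed.

Lemma contr_scale k (c : 'I_#|plucker_idx V k| -> F) a p i :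
  contr (fun s => a * c s) p i = a *: contr c p i.
Proof.
by rewrite /contr scaler_sumr; apply: eq_bigr => j _; rewrite scalerA.
Qed.

(** With two of the three Segre indices fixed, the coordinates are a common multiple of the Pluecker
    coordinates of one step of the flag. *)
Definition line_coord s2 s3 (s : 'I_#|plucker_idx V 1|) : 'I_#|flag4_idx F| :=
  enum_rank ((s, s2, s3) : flag4_idx F).
Definition plane_coord s1 s3 (s : 'I_#|plucker_idx V 2|) : 'I_#|flag4_idx F| :=
  enum_rank ((s1, s, s3) : flag4_idx F).
Definition hyper_coord s1 s2 (s : 'I_#|plucker_idx V 3|) : 'I_#|flag4_idx F| :=
  enum_rank ((s1, s2, s) : flag4_idx F).

Lemma contr_line E s2 s3 p i : contr (fc E \o line_coord s2 s3) p i =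
  (plucker _ 2 E.1.2 s2 * plucker _ 3 E.2 s3) *: contr (plucker _ 1 E.1.1) p i.
Proof.
have -> : fc E \o line_coord s2 s3 = fun s => (plucker _ 2 E.1.2 s2 * plucker _ 3 E.2 s3) * plucker _ 1 E.1.1 s.
  by apply/funext => s; rewrite /= /flag4_coord enum_rankK /=; ring.
exact: contr_scale.
Qed.

Lemma contr_plane E s1 s3 p i : contr (fc E \o plane_coord s1 s3) p i =
  (plucker _ 1 E.1.1 s1 * plucker _ 3 E.2 s3) *: contr (plucker _ 2 E.1.2) p i.
Proof.
have -> : fc E \o plane_coord s1 s3 = fun s => (plucker _ 1 E.1.1 s1 * plucker _ 3 E.2 s3) * plucker _ 2 E.1.2 s.
  by apply/funext => s; rewrite /= /flag4_coord enum_rankK /=; ring.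
exact: contr_scale.
Qed.

Lemma contr_hyper E s1 s2 p i : contr (fc E \o hyper_coord s1 s2) p i =
  (plucker _ 1 E.1.1 s1 * plucker _ 2 E.1.2 s2) *: contr (plucker _ 3 E.2) p i.
Proof.
have -> : fc E \o hyper_coord s1 s2 = fun s => (plucker _ 1 E.1.1 s1 * plucker _ 2 E.1.2 s2) * plucker _ 3 E.2 s.
  by apply/funext => s; rewrite /= /flag4_coord enum_rankK /=; ring.
exact: contr_scale.
Qed.

Lemma memv_unscale m n (S : {vspace 'M[F]_(m, n)}) a u :
  a != 0 -> a *: u \in S -> u \in S.
Proof.
by move=> a0 /(memvZ a^-1); rewrite scalerA mulVf // scale1r.
Qed.

Section FlagSections.
Variables (E : flag4_type F) (S : {vspace 'M[F]_4}) (h : V -> 'M[F]_4).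
Hypotheses (EF : flag4 F E)
  (hl : forall a u v, h (a *: u + v) = a *: h u + h v).

Let hZ a u : h (a *: u) = a *: h u.
Proof.
have h0 : h 0 = 0.
  by have := hl 1 0 0; rewrite scaler0 addr0 scale1r => /eqP; rewrite -subr_eq0
    opprD addrA subrr sub0r oppr_eq0 => /eqP.
by have := hl a u 0; rewrite !addr0 h0 addr0.
Qed.

(** The fixed indices are chosen where the other two Pluecker factors are nonzero, so that the
    scalar can be cancelled. *)
Lemma line_sections : (forall p i s2 s3, h (contr (fc E \o line_coord s2 s3) p i) \in S) ->
  forall u, u \in E.1.1 -> h u \in S.
Proof.
have [dL dW dH _] := EF; have [s2 z2] := plucker_neq0 dW.
have [s3 z3] := plucker_neq0 dH.
move=> hS; apply: (contr_mem dL hl) => p i; have := hS p i s2 s3.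
by rewrite contr_line hZ; apply: memv_unscale; rewrite mulf_neq0.
Qed.

Lemma plane_sections : (forall p i s1 s3, h (contr (fc E \o plane_coord s1 s3) p i) \in S) ->
  forall u, u \in E.1.2 -> h u \in S.
Proof.
have [dL dW dH _] := EF; have [s1 z1] := plucker_neq0 dL.
have [s3 z3] := plucker_neq0 dH.
move=> hS; apply: (contr_mem dW hl) => p i; have := hS p i s1 s3.
by rewrite contr_plane hZ; apply: memv_unscale; rewrite mulf_neq0.
Qed.

Lemma hyper_sections : (forall p i s1 s2, h (contr (fc E \o hyper_coord s1 s2) p i) \in S) ->
  forall u, u \in E.2 -> h u \in S.
Proof.
have [dL dW dH _] := EF; have [s1 z1] := plucker_neq0 dL.
have [s2 z2] := plucker_neq0 dW.
move=> hS; apply: (contr_mem dH hl) => p i; have := hS p i s1 s2.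
by rewrite contr_hyper hZ; apply: memv_unscale; rewrite mulf_neq0.
Qed.

End FlagSections.

Lemma hmx_star n d (A : ('I_n -> F) -> 'M_4) : hmx d A -> hmx d (fun c => star (A c)).
Proof.
move=> hA; do 2!apply: ord4P;
  (rewrite /star; under eq_fun do rewrite mxE /=);
  first [exact: hpoly0 | exact: hA | by apply: hpolyN; exact: hA].
Qed.

Lemma hmx_wedge n d (a b : ('I_n -> F) -> V) : hmx d a -> hmx d b ->
  hmx (d + d) (fun c => wedge (a c) (b c)).
Proof. by move=> ha hb; apply: hmxB; apply: hmxM => //; apply: hmxT. Qed.

Lemma wedge_lin1 a (u u' v : V) : wedge (a *: u + u') v = a *: wedge u v + wedge u' v.
Proof. by apply/matrixP => i j; rewrite !mxE !big_ord1 !mxE; ring. Qed.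

Lemma wedge_lin2 a (u v v' : V) : wedge u (a *: v + v') = a *: wedge u v + wedge u v'.
Proof. by apply/matrixP => i j; rewrite !mxE !big_ord1 !mxE; ring. Qed.

Section Frame.
Variable g : 'M[F]_4.
Hypothesis gu : g \in unitmx.

Definition unit_frame i j : 'M[F]_4 := g *m delta_mx i j *m invmx g.

Lemma conj_nform12 a b c : g *m nform 12 a b c *m invmx g =
  a *: unit_frame i0 i2 + b *: unit_frame i0 i3 + c *: unit_frame i1 i3.
Proof.
have -> : nform 12 a b c =
    a *: delta_mx i0 i2 + b *: delta_mx i0 i3 + c *: delta_mx i1 i3.
  by apply: mx4P; rewrite !mxE /=; ring.
by rewrite !mulmxDr !mulmxDl -!scalemxAr -!scalemxAl.
Qed.

Lemma unit_frame_mul i j k : unit_frame i j *m (g *m e_ k) = (j == k)%:R *: (g *m e_ i).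
Proof.
rewrite /unit_frame -!mulmxA mulKmx // mul_delta_mx_cond.
by rewrite -scaler_nat scalemxAr.
Qed.

(** The map [unit_frame g i0 i3] has the line of the flag as image and its hyperplane as kernel;
    values of [nu] therefore determine both. *)
Lemma nu_frame A B x y z : A^T = - A -> B^T = - B ->
  x \in conj_act g (rep 12) -> y \in conj_act g (rep 12) ->
  z \in conj_act g (rep 12) -> exists n, nu A B x y z = n *: unit_frame i0 i3.
Proof.
move=> As Bs /(conj_inP gu)[x' xU ->] /(conj_inP gu)[y' yU ->] /(conj_inP gu)[z' zU ->].
pose A' := invmx g *m A *m (invmx g)^T; pose B' := g^T *m B *m g.
rewrite nu_conj // -/A' -/B'.
have A's : A'^T = - A'.
  by rewrite /A' !trmx_mul trmxK As mulNmx mulmxN mulmxA.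
have B's : B'^T = - B'.
  by rewrite /B' !trmx_mul trmxK Bs mulNmx mulmxN mulmxA.
have [n ->] := nu_nform12 A's B's xU yU zU; exists n.
rewrite /unit_frame scalemxAl scalemxAr; congr (_ *m _ *m _).
by apply: mx4P; rewrite !mxE /= ?mulr0 ?mulr1.
Qed.

Lemma nu_frame_onto : exists A B x y z, [/\ A^T = - A, B^T = - B,
  x \in conj_act g (rep 12), y \in conj_act g (rep 12) &
  z \in conj_act g (rep 12)] /\ nu A B x y z = unit_frame i0 i3.
Proof.
pose B0 : 'M[F]_4 := mx4 0 1 0 0 (- 1) 0 0 0 0 0 0 0 0 0 0 0.
(* The standard skew forms transported by [g], so that [nu_conj] turns them back into the standard
   ones. *)
exists (g *m J23 F *m g^T), ((invmx g)^T *m B0 *m invmx g).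
exists (g *m nform 12 1 0 0 *m invmx g), (g *m nform 12 0 1 0 *m invmx g),
  (g *m nform 12 0 0 1 *m invmx g).
have Js : (J23 F)^T = - J23 F by rewrite tr_mx4; apply: mx4P; rewrite !mxE /=; ring.
have Bs : B0^T = - B0 by rewrite tr_mx4; apply: mx4P; rewrite !mxE /=; ring.
split; first split.
- by rewrite !trmx_mul trmxK Js mulNmx mulmxN mulmxA.
- by rewrite !trmx_mul trmxK Bs mulNmx mulmxN mulmxA.
- by apply: conj_in => //; exact: nform_in.
- by apply: conj_in => //; exact: nform_in.
- by apply: conj_in => //; exact: nform_in.
have gTu : g^T \in unitmx by rewrite unitmx_tr.
rewrite nu_conj // /unit_frame; congr (_ *m _ *m _).
rewrite !mulmxA mulVmx // mul1mx trmx_inv mulmxK // mulmxV // mul1mx mulmxKV //.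
rewrite -/(ublock 1 0 0 0) -/(ublock 0 1 0 0) -/(ublock 0 0 0 1).
rewrite /nu !ublock_skew_tr // !lblock_skew_ublock // !mxE /=.
by apply: mx4P; rewrite !mxE /=; ring.
Qed.

Lemma rank1_frame (u v : V) : (g *m u) *m ((g *m v)^T *m ((invmx g)^T *m J23 F *m invmx g))
  = g *m (u *m (v^T *m J23 F)) *m invmx g.
Proof.
have gTu : g^T \in unitmx by rewrite unitmx_tr.
by rewrite trmx_mul trmx_inv !mulmxA mulmxK.
Qed.

End Frame.

End FlagVariety.

Section FlagOrbit.
Variable F : numClosedFieldType.
Local Notation rep := (rep F).
Local Notation e_ i := (delta_mx i 0 : 'cV[F]_4).
Local Notation V := 'cV[F]_4.
Local Notation fc := (@flag4_coord F).
Implicit Types (U : {vspace 'M[F]_4}) (E : flag4_type F).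

Section Frame.
Variable g : 'M[F]_4.
Hypothesis gu : g \in unitmx.
Local Notation K := ((invmx g)^T *m J23 F *m invmx g).

Lemma delta_mulv i j (v : V) : delta_mx i j *m v = v j 0 *: e_ i.
Proof.
apply/colP => k; rewrite mxE (bigD1 j) //= big1 ?addr0 => [|m mj];
  rewrite [delta_mx _ _ _ _]mxE ?eqxx ?andbT ?(negPf mj) ?andbF ?mul0r //.
by rewrite [RHS]mxE [delta_mx _ _ _ _]mxE eqxx andbT mulrC.
Qed.

Lemma unit_frame_mulv i j (v : V) :
  unit_frame g i j *m v = (invmx g *m v) j 0 *: (g *m e_ i).
Proof. by rewrite /unit_frame -!mulmxA delta_mulv -scalemxAr. Qed.

Lemma tr_unit_frame_mulv i j (v : V) :
  (unit_frame g i j)^T *m v = (g^T *m v) i 0 *: ((invmx g)^T *m e_ j).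
Proof. by rewrite !trmx_mul trmx_delta -!mulmxA delta_mulv -scalemxAr. Qed.

Lemma proj_act_in (A : {vspace V}) u : u \in A -> g *m u \in proj_act g A.
Proof. by move=> uA; rewrite mem_proj_act // mulKmx. Qed.

Lemma proj_act_inP (A : {vspace V}) v : v \in proj_act g A ->
  exists2 u, u \in A & v = g *m u.
Proof.
by rewrite mem_proj_act // => vA; exists (invmx g *m v); rewrite ?mulKVmx.
Qed.

Lemma star_wedge_plane u v : u \in proj_act g (plane0 F) ->
  v \in proj_act g (plane0 F) -> exists d, star (wedge u v) = d *: K.
Proof.
move=> /proj_act_inP[u' /mem_plane0 uE ->] /proj_act_inP[v' /mem_plane0 vE ->].
have [t _ tE] := star_wedge_frame gu.
exists ((u' i0 0 * v' i1 0 - v' i0 0 * u' i1 0) * t).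
have star0 a A : star (a *: A) = a *: star A.
  have := star_lin a A 0; rewrite addr0 => ->; rewrite [star 0](_ : _ = 0) ?addr0 //.
  by apply: mx4P; rewrite !mxE /= ?oppr0.
rewrite -scalerA -tE -star0; congr star.
rewrite !wedge_mul scalemxAl scalemxAr; congr (_ *m _ *m _).
by apply/matrixP => i j; rewrite [RHS]mxE !wedgeE uE vE !mxE /=; ring.
Qed.

(** [h^T *m star (wedge u v)] is the form det(u, v, h, -), which kills the plane. The resulting map
    sends the hyperplane into the line, either because [w] is on the line or because [h] in the
    hyperplane makes the form kill it. *)
Lemma section_frame w h u v : w \in proj_act g (plane0 F) ->
  u \in proj_act g (plane0 F) -> v \in proj_act g (plane0 F) ->
  w \in proj_act g (line0 F) \/ h \in proj_act g (hyper0 F) ->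
  w *m (h^T *m star (wedge u v)) \in conj_act g (rep 12).
Proof.
move=> /proj_act_inP[w' /mem_plane0 wE ->] uW vW wh.
have [d ->] := star_wedge_plane uW vW.
have [h' hE] : exists h', h = g *m h' by exists (invmx g *m h); rewrite mulKVmx.
have wh0 : w' i1 0 * h' i3 0 = 0.
  case: wh => [/proj_act_inP[w'' /mem_line0 w''E]|].
    move=> /(congr1 (mulmx (invmx g))); rewrite !mulKmx // => ->.
    by rewrite w''E !mxE /=; ring.
  by rewrite hE mem_proj_act // mulKmx // => /mem_hyper0 ->; rewrite mulr0.
rewrite -!scalemxAr memvZ // hE rank1_frame //; apply: conj_in => //.
apply/mem_rep; exists (- (w' i0 0 * h' i3 0)), (w' i0 0 * h' i2 0), (w' i1 0 * h' i2 0).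
have hJ : h'^T *m J23 F = \row_j nth 0 [:: 0; 0; - h' i3 0; h' i2 0] j.
  by apply/rowP; apply: ord4P; rewrite !mxE sum4 !mxE /=; ring.
have wh0' : w' i1 0 * - h' i3 0 = 0 by rewrite mulrN wh0 oppr0.
by rewrite hJ wE; apply: mx4P; rewrite mxE big_ord1 !mxE /= ?wh0 ?mulr0 ?mulr1
  ?addr0 ?add0r ?mul0r ?mulrN ?wh0 ?oppr0.
Qed.

(** With [u] and [v] the first two basis vectors, the index pairs (0, 2), (0, 3) and (1, 2) for [w]
    and [h] give nonzero multiples of the three generators. *)
Lemma section_frame_onto (S : {vspace 'M[F]_4}) :
  (forall l a u v, l \in proj_act g (line0 F) -> u \in proj_act g (plane0 F) ->
    v \in proj_act g (plane0 F) -> l *m (a^T *m star (wedge u v)) \in S) ->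
  (forall w h u v, w \in proj_act g (plane0 F) -> h \in proj_act g (hyper0 F) ->
    u \in proj_act g (plane0 F) -> v \in proj_act g (plane0 F) ->
    w *m (h^T *m star (wedge u v)) \in S) ->
  (conj_act g (rep 12) <= S)%VS.
Proof.
move=> lS wS; have [t t0 tE] := star_wedge_frame gu.
have gL : g *m e_ i0 \in proj_act g (line0 F) by apply: proj_act_in; exact: e0_line0.
have gW0 : g *m e_ i0 \in proj_act g (plane0 F).
  by apply: proj_act_in; exact: e0_plane0.
have gW1 : g *m e_ i1 \in proj_act g (plane0 F).
  by apply: proj_act_in; exact: e1_plane0.
have gH : g *m e_ i2 \in proj_act g (hyper0 F).
  by apply: proj_act_in; apply/mem_hyper0; rewrite mxE.
have uf i j k c : e_ i *m ((e_ j)^T *m J23 F) = c *: delta_mx i k ->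
    (g *m e_ i) *m ((g *m e_ j)^T *m star (wedge (g *m e_ i0) (g *m e_ i1))) =
    (t * c) *: unit_frame g i k.
  move=> E; rewrite tE -!scalemxAr rank1_frame // E /unit_frame -scalerA.
  by rewrite -scalemxAr -scalemxAl.
have S03 : unit_frame g i0 i3 \in S.
  apply: (@memv_unscale _ _ _ _ (t * 1)); first by rewrite mulr1.
  rewrite -(uf i0 i2 i3 1); first exact: lS.
  by apply: mx4P; rewrite !mxE !big_ord1 !mxE ?sum4 !mxE /=; ring.
have S02 : unit_frame g i0 i2 \in S.
  apply: (@memv_unscale _ _ _ _ (t * (- 1))).
    by rewrite mulf_neq0 // oppr_eq0 oner_eq0.
  rewrite -(uf i0 i3 i2 (- 1)); first exact: lS.
  by apply: mx4P; rewrite !mxE !big_ord1 !mxE ?sum4 !mxE /=; ring.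
have S13 : unit_frame g i1 i3 \in S.
  apply: (@memv_unscale _ _ _ _ (t * 1)); first by rewrite mulr1.
  rewrite -(uf i1 i2 i3 1); first exact: wS.
  by apply: mx4P; rewrite !mxE !big_ord1 !mxE ?sum4 !mxE /=; ring.
apply/subvP => _ /(conj_inP gu)[x /mem_rep[a [b [c ->] ] ] ->].
by rewrite conj_nform12 !memvD // memvZ.
Qed.

(** The transposed factor sends [v] to a multiple of the form defining the hyperplane, and a skew
    matrix sends a form to a vector on which that form vanishes. *)
Lemma skew_nu_frame A n (v : V) : A^T = - A ->
  A *m (n *: unit_frame g i0 i3)^T *m v \in proj_act g (hyper0 F).
Proof.
move=> As; pose A' := invmx g *m A *m (invmx g)^T.
have A's : A'^T = - A' by rewrite !trmx_mul trmxK As mulNmx mulmxN mulmxA.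
have A'33 : A' i3 i3 = 0.
  apply/eqP; have /matrixP /(_ i3 i3) := A's; rewrite mxE [RHS]mxE => /eqP.
  by rewrite -addr_eq0 -mulr2n mulrn_eq0.
rewrite mem_proj_act //; apply/mem_hyper0.
rewrite linearZ /= -scalemxAr -scalemxAl -mulmxA tr_unit_frame_mulv.
rewrite -!scalemxAr !mulmxA -/A'; clearbody A'.
by rewrite -colE !mxE A'33 !mulr0.
Qed.

End Frame.

Lemma contr_line_in E s2 s3 p i : flag4 F E ->
  contr (fc E \o line_coord s2 s3) p i \in E.1.1.
Proof. by move=> [dL _ _ _]; rewrite contr_line memvZ // contr_in. Qed.

Lemma contr_plane_in E s1 s3 p i : flag4 F E ->
  contr (fc E \o plane_coord s1 s3) p i \in E.1.2.
Proof. by move=> [_ dW _ _]; rewrite contr_plane memvZ // contr_in. Qed.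

Lemma contr_hyper_in E s1 s2 p i : flag4 F E ->
  contr (fc E \o hyper_coord s1 s2) p i \in E.2.
Proof. by move=> [_ _ dH _]; rewrite contr_hyper memvZ // contr_in. Qed.

(** The line has the sections N v with N a value of [nu], the plane has the sections [x *m v], and
    the hyperplane has the sections D N^T v with D skew. *)
Lemma orbit12_flag_locally_poly f : set_fun (pgl_orbit (rep 12)) (flag4 F) f ->
  (forall U, pgl_orbit (rep 12) U -> flag_rel U (f U)) ->
  locally_poly (plucker _ 3) (pgl_orbit (rep 12)) fc f.
Proof.
move=> fXY fR.
have frame U (XU : pgl_orbit (rep 12) U) := flag_frame XU (fXY _ XU) (fR _ XU).
have nuS (n m : nat) (h : 'M[F]_4 -> 'M[F]_(n, m)) (S : {vspace 'M[F]_(n, m)}) A B U :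
    (forall a x y, h (a *: x + y) = a *: h x + h y) -> \dim U = 3 ->
    (forall p1 k1 p2 k2 p3 k3, h (nu A B (contr (plucker _ 3 U) p1 k1)
      (contr (plucker _ 3 U) p2 k2) (contr (plucker _ 3 U) p3 k3)) \in S) ->
    forall x y z, x \in U -> y \in U -> z \in U -> h (nu A B x y z) \in S.
  move=> hl dU hS x y z xU yU zU; move: x xU.
  apply: (contr_mem dU (h := fun x => h (nu A B x y z))) => [a x x'|p1 k1].
    by rewrite nu_lin1 hl.
  move: y yU.
  apply: (contr_mem dU (h := fun y => h (nu A B _ y z))) => [a x x'|p2 k2].
    by rewrite nu_lin2 hl.
  move: z zU.
  by apply: (contr_mem dU (h := fun z => h (nu A B _ _ z))) => [a x x'|p3 k3];
    rewrite ?nu_lin3 ?hl.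
apply: flag_locally_poly.
- apply: generated_locally_poly => [U /fXY[] //|U XU S Ssec].
  have [g [gu UE EE] ] := frame U XU; rewrite EE /=.
  have [A [B [x [y [z [ [As Bs xU yU zU] nuE] ] ] ] ] ] := nu_frame_onto gu.
  apply/subvP => _ /(proj_act_inP gu)[u /mem_line0 -> ->].
  rewrite -scalemxAr memvZ //.
  have -> : g *m e_ i0 = nu A B x y z *m (g *m e_ i3).
    by rewrite nuE (unit_frame_mul gu) eqxx scale1r.
  apply: (nuS _ _ (fun N => N *m (g *m e_ i3)) S A B U); rewrite ?UE //.
  + by move=> a N N'; rewrite mulmxDl scalemxAl.
  + by rewrite dim_conj ?dim_rep.
  move=> p1 k1 p2 k2 p3 k3; rewrite -UE.
  apply: (Ssec (fun c => nu A B (contr c p1 k1) (contr c p2 k2) (contr c p3 k3)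
    *m (g *m e_ i3))); exists 3; split.
    by apply/hmxMr/hmx_nu; exact: hmx_contr.
  move=> U' XU'; have [g' [gu' UE' EE'] ] := frame U' XU'; rewrite EE' /=.
  have inU p k : contr (plucker _ 3 U') p k \in conj_act g' (rep 12).
    by rewrite -UE' contr_in // (dim_orbit XU').
  have [n ->] := nu_frame gu' As Bs (inU p1 k1) (inU p2 k2) (inU p3 k3).
  rewrite -scalemxAl unit_frame_mulv !memvZ //; apply: proj_act_in => //.
  exact: e0_line0.
- apply: generated_locally_poly => [U /fXY[] //|U XU S Ssec].
  have [g [gu UE EE] ] := frame U XU; rewrite EE /=.
  have US (v : V) x : x \in U -> x *m v \in S.
    move: x; apply: (contr_mem (dim_orbit XU) (h := fun x => x *m v)) => [a x y|p k].
      by rewrite mulmxDl scalemxAl.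
    apply: (Ssec (fun c => contr c p k *m v)); exists 1%N; split.
      by apply: hmxMr; exact: hmx_contr.
    move=> U' XU'; have [] := fR U' XU' (contr (plucker _ 3 U') p k) _ => //.
    by apply: contr_in; exact: dim_orbit XU'.
  have inU a b c : a *: unit_frame g i0 i2 + b *: unit_frame g i0 i3 +
      c *: unit_frame g i1 i3 \in U.
    by rewrite -conj_nform12 UE; apply: conj_in => //; exact: nform_in.
  apply/subvP => _ /(proj_act_inP gu)[u /mem_plane0 -> ->].
  rewrite mulmxDr -!scalemxAr memvD // memvZ //.
    have := US (g *m e_ i2) _ (inU 1 0 0).
    by rewrite scale1r !scale0r !addr0 (unit_frame_mul gu) eqxx scale1r.
  have := US (g *m e_ i3) _ (inU 0 0 1).
  by rewrite scale1r !scale0r !add0r (unit_frame_mul gu) eqxx scale1r.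
apply: generated_locally_poly => [U /fXY[] //|U XU S Ssec].
have [g [gu UE EE] ] := frame U XU; rewrite EE /=.
have [A [B [x [y [z [ [As Bs xU yU zU] nuE] ] ] ] ] ] := nu_frame_onto gu.
apply/subvP => _ /(proj_act_inP gu)[u /mem_hyper0 u3 ->].
(* [D] is skew and sends the form of the hyperplane, obtained from [v0], to the prescribed vector
   [g *m u]. *)
pose D := g *m wedge u (e_ i3) *m g^T.
have Ds : D^T = - D by rewrite !trmx_mul trmxK tr_wedge mulNmx mulmxN mulmxA.
pose v0 := (invmx g)^T *m e_ i0.
have -> : g *m u = D *m (nu A B x y z)^T *m v0.
  have gTu : g^T \in unitmx by rewrite unitmx_tr.
  rewrite nuE -mulmxA tr_unit_frame_mulv /v0 trmx_inv mulKVmx // mxE /= scale1r.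
  rewrite /D -!mulmxA mulKVmx //; congr (_ *m _).
  rewrite /wedge mulmxBl -!mulmxA trmx_delta mul_delta_mx.
  have -> : u^T *m e_ i3 = 0.
    by rewrite -colE; apply/matrixP => i j; rewrite !mxE !ord1 u3.
  rewrite mulmx0 subr0; apply/colP => i.
  by rewrite mxE big_ord1 mxE /= mulr1 ord1.
apply: (nuS _ _ (fun N => D *m N^T *m v0) S A B U); rewrite ?UE //.
- by move=> a N N'; rewrite linearD linearZ /= mulmxDr mulmxDl -scalemxAr -scalemxAl.
- by rewrite dim_conj ?dim_rep.
move=> p1 k1 p2 k2 p3 k3; rewrite -UE.
apply: (Ssec (fun c => D *m (nu A B (contr c p1 k1) (contr c p2 k2)
  (contr c p3 k3))^T *m v0)); exists 3; split.
  by apply/hmxMr/hmxMl/hmxT/hmx_nu; exact: hmx_contr.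
move=> U' XU'; have [g' [gu' UE' EE'] ] := frame U' XU'; rewrite EE' /=.
have inU p k : contr (plucker _ 3 U') p k \in conj_act g' (rep 12).
  by rewrite -UE' contr_in // (dim_orbit XU').
have [n ->] := nu_frame gu' As Bs (inU p1 k1) (inU p2 k2) (inU p3 k3).
exact: skew_nu_frame.
Qed.

End FlagOrbit.

(** * Orbit 12 and the flag variety *)

Section FlagOrbitIsomorphism.
Variable F : numClosedFieldType.
Local Notation rep := (rep F).
Local Notation V := 'cV[F]_4.
Local Notation fc := (@flag4_coord F).
Implicit Types (U : {vspace 'M[F]_4}) (E : flag4_type F).

(** The map sending x to det(u, v, h, x) w. *)
Definition rank1_form (w h u v : V) : 'M[F]_4 := w *m (h^T *m star (wedge u v)).

Lemma rank1_form_lin1 h u v a w w' : rank1_form (a *: w + w') h u v =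
  a *: rank1_form w h u v + rank1_form w' h u v.
Proof. by rewrite /rank1_form mulmxDl scalemxAl. Qed.

Lemma rank1_form_lin2 w u v a h h' : rank1_form w (a *: h + h') u v =
  a *: rank1_form w h u v + rank1_form w h' u v.
Proof. by rewrite /rank1_form linearP mulmxDl mulmxDr -scalemxAl -scalemxAr. Qed.

Lemma rank1_form_lin3 w h v a u u' : rank1_form w h (a *: u + u') v =
  a *: rank1_form w h u v + rank1_form w h u' v.
Proof.
by rewrite /rank1_form wedge_lin1 star_lin !mulmxDr -!scalemxAr.
Qed.

Lemma rank1_form_lin4 w h u a v v' : rank1_form w h u (a *: v + v') =
  a *: rank1_form w h u v + rank1_form w h u v'.
Proof.
by rewrite /rank1_form wedge_lin2 star_lin !mulmxDr -!scalemxAr.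
Qed.

Lemma hmx_rank1_form n d (w h u v : ('I_n -> F) -> V) :
  hmx 1 w -> hmx d h -> hmx 1 u -> hmx 1 v ->
  hmx (1 + (d + (1 + 1))) (fun c => rank1_form (w c) (h c) (u c) (v c)).
Proof.
move=> hw hh hu hv; apply: hmxM hw _; apply: hmxM (hmxT hh) _.
by apply/hmx_star; exact: hmx_wedge.
Qed.

Lemma plane_pair_sections E (S : {vspace 'M[F]_4}) w h : flag4 F E ->
  (forall p i s1 s3 q j r1 r3, rank1_form w h
     (contr (fc E \o plane_coord s1 s3) p i)
     (contr (fc E \o plane_coord r1 r3) q j) \in S) ->
  forall u v, u \in E.1.2 -> v \in E.1.2 -> rank1_form w h u v \in S.
Proof.
move=> EF hS u v uW vW; move: u uW.
apply: (plane_sections EF (h := fun u => rank1_form w h u v)) => [a u u'|p i s1 s3].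
  exact: rank1_form_lin3.
move: v vW.
apply: (plane_sections EF (h := fun v => rank1_form w h _ v)) => [a v v'|//].
exact: rank1_form_lin4.
Qed.

Lemma flag_orbit12_locally_poly f : set_fun (flag4 F) (pgl_orbit (rep 12)) f ->
  (forall E, flag4 F E -> flag_rel (f E) E) ->
  locally_poly fc (flag4 F) (plucker _ 3) f.
Proof.
move=> fYX fR; apply: generated_locally_poly => [E /fYX/dim_orbit //|E EF S Ssec].
have frame E' (EF' : flag4 F E') := flag_frame (fYX _ EF') EF' (fR _ EF').
have [g [gu -> EE] ] := frame E EF.
have [LE WE HE] : [/\ E.1.1 = proj_act g (line0 F), E.1.2 = proj_act g (plane0 F) &
  E.2 = proj_act g (hyper0 F)] by rewrite EE.
have rank1_in E' w h u v : flag4 F E' -> w \in E'.1.2 -> u \in E'.1.2 ->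
    v \in E'.1.2 -> w \in E'.1.1 \/ h \in E'.2 -> rank1_form w h u v \in f E'.
  move=> EF'; have [k [ku -> ->] ] := frame E' EF' => /= wW uW vW wh.
  exact: section_frame.
apply: (section_frame_onto gu) => [l a u v|w h u v]; rewrite -?LE -?WE -?HE.
  move=> lL uW vW; apply: (plane_pair_sections (w := l) (h := a) EF _ uW vW).
  move=> p i s1 s3 q j r1 r3; move: l lL.
  apply: (line_sections EF (h := fun l => rank1_form l a _ _)) => [|p' i' t2 t3].
    by move=> *; exact: rank1_form_lin1.
  apply: (Ssec (fun c => rank1_form (contr (c \o line_coord t2 t3) p' i') a
    (contr (c \o plane_coord s1 s3) p i) (contr (c \o plane_coord r1 r3) q j))).
  exists (1 + (0 + (1 + 1)))%N; split.
    apply: hmx_rank1_form; [|exact: hmxC| |]; exact: hmx_contr_reindex.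
  move=> E' EF'; have [_ _ _ /andP[/subvP LW _] ] := EF'.
  have lL := contr_line_in t2 t3 p' i' EF'.
  apply: (rank1_in _ _ _ _ _ EF' (LW _ lL)); last by left.
    exact: contr_plane_in.
  exact: contr_plane_in.
move=> wW hH uW vW; apply: (plane_pair_sections (w := w) (h := h) EF _ uW vW).
move=> p i s1 s3 q j r1 r3; move: w wW.
apply: (plane_sections EF (h := fun w => rank1_form w h _ _)) => [|p' i' t1 t3].
  by move=> *; exact: rank1_form_lin1.
move: h hH.
apply: (hyper_sections EF (h := fun h => rank1_form _ h _ _)) => [|k m z1 z2].
  by move=> *; exact: rank1_form_lin2.
apply: (Ssec (fun c => rank1_form (contr (c \o plane_coord t1 t3) p' i')
  (contr (c \o hyper_coord z1 z2) k m)
  (contr (c \o plane_coord s1 s3) p i) (contr (c \o plane_coord r1 r3) q j))).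
exists (1 + (1 + (1 + 1)))%N; split.
  by apply: hmx_rank1_form; exact: hmx_contr_reindex.
move=> E' EF'.
apply: (rank1_in _ _ _ _ _ EF'); try exact: contr_plane_in.
by right; exact: contr_hyper_in.
Qed.

Lemma orbit12_iso : pgl_isomorphic (plucker _ 3) (@conj_act _ 4)
  (pgl_orbit (rep 12)) fc (@flag4_act _) (flag4 F).
Proof.
apply: (@pgl_iso_of_orbits _ _ _ _ _ _ _ _ _ _ _ _ (rep 12) (flag0 F) (@flag_rel F)).
- by move=> g U gu; exact: conj_actK.
- by move=> g E gu; exact: flag4_actK.
- by move=> g U gu; exact: orbit_conj_closed.
- by move=> g E gu; exact: flag4_act_flag4.
- by [].
- exact: flag4_transitive.
- by move=> g U E; exact: flag_rel_act.
- exact: pgl_orbit_refl.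
- exact: flag4_flag0.
- exact: flag_rel_rep.
- exact: flag_rel_rep_uniq.
- exact: flag_rel_flag0.
- exact: orbit12_flag_locally_poly.
exact: flag_orbit12_locally_poly.
Qed.

End FlagOrbitIsomorphism.

Theorem proposition18 (R : realType) :
  [/\ Red R[i] 4 = Ab R[i] 4,
      (pgl_orbits (Red R[i] 4) #= `I_14)%card &
      exists O1 O2 O3 : set {vspace 'M[R[i]]_4},
        [/\ O1 <> O2 /\ O1 <> O3 /\ O2 <> O3,
            [set O | pgl_orbits (Red R[i] 4) O /\ closed_in_grass O]
              = [set O1; O2; O3],
            pgl_isomorphic (plucker _ 3) (@conj_act _ 4) O1
              (plucker _ 1) (@proj_act _ 4) (proj_space R[i] 4),
            pgl_isomorphic (plucker _ 3) (@conj_act _ 4) O2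
              (plucker _ 1) (@dual_proj_act _ 4) (dual_proj_space R[i] 4) &
            pgl_isomorphic (plucker _ 3) (@conj_act _ 4) O3
              (@flag4_coord _) (@flag4_act _) (flag4 R[i])]].
Proof.
rewrite Red_Ab; split=> //; first exact: card_pgl_orbits_Ab.
exists (pgl_orbit (rep R[i] 10)), (pgl_orbit (rep R[i] 11)), (pgl_orbit (rep R[i] 12)).
split; first 1 last.
- exact: closed_orbitsE.
- exact: orbit10_iso.
- exact: orbit11_iso.
- exact: orbit12_iso.
by split; [|split] => kl; have := pgl_orbit_rep_inj _ _ kl => /(_ isT isT).
Qed.
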